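(* (i) For $y\ge8$ there are smooth functions $a_{\pm,y}:[0,y-\frac12y^{1/3}]\to\mathbb C$ such that $$J_\mu(y)=y^{-\frac14}(y-\mu)^{-\frac14}\Big(a_{+,y}(\mu)e^{iyh_1(\mu/y)}+a_{-,y}(\mu)e^{-iyh_1(\mu/y)}\Big)$$ and, for each integer $\alpha\ge0$, there exists $C_\alpha>0$ such that $$|\partial_\mu^\alpha a_{\pm,y}(\mu)|\le C_\alpha(y-\mu)^{-\alpha}\qquad\text{for all }y\ge8,\ \mu\in[0,y-\tfrac12y^{1/3}].$$ (ii) Let $N>0$ and let $\alpha\ge0$ be an integer. Then there exist $C_\alpha>0$ and $C_{\alpha N}>0$ such that $$|\partial_\mu^\alpha J_\mu(y)|\le\begin{cases}C_\alpha\,y^{-\frac{1+\alpha}3}&\text{for }y\ge8,\ \mu\in[y-2y^{1/3},y+2y^{1/3}],\\[2pt]C_{\alpha N}\,\mu^{-\frac14}(\mu-y)^{-\frac14-\alpha}\big(y^{-1}(\mu-y)^3\big)^{-N}&\text{for }y\ge8,\ \mu\in[y+\tfrac12y^{1/3},\infty).\end{cases}$$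
   Context: $J_\mu(y)$ is the Bessel function of the first kind of order $\mu$. The function $h_1$ is defined on $[0,1]$ by $h_1(z)=\sqrt{1-z^2}-z\cos^{-1}z$, with $\cos^{-1}z\in[0,\pi/2]$. The constants $C_\alpha$, $C_{\alpha N}$ do not depend on $y$ and $\mu$. *)

(* Defs.v *)
From Stdlib Require Export Reals Factorial.
From Coquelicot Require Export Coquelicot.

Open Scope R_scope.

(** Euler's integral; the value is meaningful for [0 < x] only. *)
Definition Gamma (x : R) : R :=
  RInt_gen (fun t => Rpower t (x - 1) * exp (- t))
    (at_right 0) (Rbar_locally p_infty).

(** [BesselJ mu y] is $J_\mu(y)$.  The series is meaningful for [0 < y] and
    [-1 < mu], where every Gamma factor has a positive argument. *)
Definition BesselJ (mu y : R) : R :=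
  Series (fun k =>
    (-1) ^ k / (INR (fact k) * Gamma (INR k + mu + 1))
      * Rpower (y / 2) (2 * INR k + mu)).

(** On [0 <= z <= 1], [acos z] takes its values in [0, PI / 2]. *)
Definition h1 (z : R) : R := sqrt (1 - z ^ 2) - z * acos z.

Definition Cexp (z : C) : C :=
  (RtoC (exp (Re z)) * (cos (Im z), sin (Im z)))%C.

(** Derivatives relative to a set [D], of functions of a real variable with
    complex values: on a closed interval these are one-sided at the
    endpoints, and values of [f] outside [D] play no role. *)
Definition is_derive_on (D : R -> Prop) (f : R -> C) (x : R) (l : C) : Prop :=
  @filterdiff R_AbsRing R_NormedModule C_R_NormedModule
    f (within D (locally x)) (fun h : R => scal h l).

(** As with Coquelicot's [Derive], the value is meaningful only where the
    derivative exists; it is then unique if [x] is not isolated in [D]. *)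
Definition Derive_on (D : R -> Prop) (f : R -> C) (x : R) : C :=
  @iota C_R_CompleteNormedModule (is_derive_on D f x).

Fixpoint Derive_n_on (D : R -> Prop) (f : R -> C) (n : nat) : R -> C :=
  match n with
  | O => f
  | S n => Derive_on D (Derive_n_on D f n)
  end.

Definition smooth_on (D : R -> Prop) (f : R -> C) : Prop :=
  forall (n : nat) (x : R), D x ->
    exists l : C, is_derive_on D (Derive_n_on D f n) x l.

Definition osc_range (y mu : R) : Prop :=
  0 <= mu <= y - 1 / 2 * Rpower y (1 / 3).

(* Main.v *)
Require Import Defs.
From Stdlib Require Import Reals Lra Lia Psatz.
From Coquelicot Require Import Coquelicot.
Open Scope R_scope.

(** The Bessel function is a contour integral: with [F w = exp (y sinh w - mu w)],
    [J_mu (y)] is [1 / (2 PI i)] times the integral of [F] over a loop from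
    [oo - i PI] to [oo + i PI], that is, [1 / PI] times the imaginary part of the
    integral from any real point (or from [- oo]) to [oo + i PI]. All bounds come
    from moving the contour to a place where [F] is small.

    Contours are moved without complex analysis. The function [Psi], the vertical
    integral of [Re F] from the real axis, is the imaginary part of a primitive of
    [F]; by the Cauchy-Riemann equations its differential is [Im (F dw)], so the
    integral over any path is a difference of values of [Psi] ([RInt_path],
    [CInt_path]), and only the ends at infinity have to be compared.

    The representation follows from the power series ([BesselJ_Loop]) by expanding
    [exp (- (y/2) e^-w)]. Each term is Hankel's integral for [1 / Gamma]
    ([Hankel]), which is proved as follows. Euler's and Hankel's integrals satisfy
    reciprocal functional equations, so [Gamma (nu + 1)] times Hankel's integral has
    period 1 in [nu]. It is constant because [Gamma (n + nu + 1)] is asymptotic to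
    [n! n^nu] by convexity ([Gamma_ratio]), while Laplace's method compares Hankel's
    integral at [n + nu] with its known value at [n] ([Loop_asym]).

    For [mu] near or above [y], take [w = x0 + r + i v], [cos v = 1 / cosh r]. There
    [Re sinh w = sinh x0 + cosh x0 tanh r], and the modulus of [F] is explicit. A
    derivative in [mu] multiplies [F] by [- w]. With [x0 = 0] the integrand lives at
    the scale [r = y^(-1/3)], which gives the bound in the transition region
    ([transition_bound]). With [x0 = min (sqrt ((mu - y) / y)) 1], a little below
    the saddle point, the factor [F x0] is exponentially small in
    [((mu - y)^3 / y)^(1/2)] or in [mu - y] ([monotonic_region]).

    For [mu] below [y] the saddle points are [i beta] and [- i beta], with
    [y cos beta = mu]. Putting [w = i beta + s] and [S = sqrt (y^2 - mu^2)],
    [y sinh w - mu w = i y h1 (mu / y) + S i (cosh s - 1) + mu (sinh s - s)].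
    The oscillating exponential has come out, and the amplitude is an integral over
    a contour in [s] that is independent of [y] and [mu], with parameters [S] and
    [mu] that enter linearly. On a contour of slope 1 to the right and 1/2 to the
    left the two terms have nonpositive real parts, the first at most
    [- S r^2 / 2]. Rescaling by [S^(-1/2)] shows that the integrals [SaddleInt j k],
    with [j] factors [i (cosh s - 1)] and [k] factors [sinh s - s], are
    [O (S^(-1/2 - j - 3k/2))] ([SaddleInt_bound]). Differentiation in [S]
    and [mu] raises [j] and [k]; so [(y - mu) d/dmu] maps polynomials in a few
    bounded functions of [(y, mu)] and in the normalised integrals to such
    polynomials ([deriv_on_ev]). This closed calculus yields all derivatives of the
    amplitudes with the bound [C (y - mu)^(- alpha)]. *)

(** * Improper integrals of exponentially small functions *)

Definition cont (f : R -> R) : Prop := forall x, continuous f x.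

Lemma cont_ex_RInt (f : R -> R) (a b : R) : cont f -> ex_RInt f a b.
Proof. intros Hf; apply (ex_RInt_continuous (V := R_CompleteNormedModule)); intros; apply Hf. Qed.

Lemma cont_ext (f g : R -> R) : (forall x, f x = g x) -> cont f -> cont g.
Proof. intros E Hf x; apply (continuous_ext f g x E), Hf. Qed.

Lemma cont_const (c : R) : cont (fun _ => c).
Proof. intros x; apply continuous_const. Qed.

Lemma cont_plus (f g : R -> R) : cont f -> cont g -> cont (fun x => f x + g x).
Proof.
intros Hf Hg x; apply (continuous_plus (K := R_AbsRing) (V := R_NormedModule) f g x);
  [apply Hf | apply Hg].
Qed.

Lemma cont_minus (f g : R -> R) : cont f -> cont g -> cont (fun x => f x - g x).
Proof.
intros Hf Hg x; apply (continuous_minus (K := R_AbsRing) (V := R_NormedModule) f g x);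
  [apply Hf | apply Hg].
Qed.

Lemma cont_mult (f g : R -> R) : cont f -> cont g -> cont (fun x => f x * g x).
Proof.
intros Hf Hg x; apply (continuous_mult (K := R_AbsRing) f g x);
  [apply Hf | apply Hg].
Qed.

Lemma cont_comp (f g : R -> R) : cont f -> cont g -> cont (fun x => g (f x)).
Proof. intros Hf Hg x; apply (continuous_comp f g x); [apply Hf | apply Hg]. Qed.

Lemma cont_derive (f f' : R -> R) : (forall x, is_derive f x (f' x)) -> cont f.
Proof. intros H x; apply (ex_derive_continuous f x); exists (f' x); apply H. Qed.

Lemma cont_exp : cont exp.
Proof. intros x; apply continuous_exp. Qed.

Lemma cont_cos : cont cos.
Proof. intros x; apply continuous_cos. Qed.

Lemma cont_sin : cont sin.
Proof. intros x; apply continuous_sin. Qed.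

Lemma cont_id : cont (fun x => x).
Proof. intros x; apply continuous_id. Qed.

Lemma cont_opp (f : R -> R) : cont f -> cont (fun x => - f x).
Proof.
intros Hf x; apply (continuous_opp (K := R_AbsRing) (V := R_NormedModule) f x), Hf.
Qed.

Ltac solve_cont :=
  lazymatch goal with
  | |- cont (fun _ => ?c) => apply cont_const
  | |- cont (fun x => @?a x + @?b x) => apply (cont_plus a b); solve_cont
  | |- cont (fun x => @?a x - @?b x) => apply (cont_minus a b); solve_cont
  | |- cont (fun x => @?a x * @?b x) => apply (cont_mult a b); solve_cont
  | |- cont (fun x => - @?a x) => apply (cont_opp a); solve_cont
  | |- cont (fun x => exp (@?a x)) => apply (cont_comp a exp); [solve_cont | exact cont_exp]
  | |- cont (fun x => cos (@?a x)) => apply (cont_comp a cos); [solve_cont | exact cont_cos]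
  | |- cont (fun x => sin (@?a x)) => apply (cont_comp a sin); [solve_cont | exact cont_sin]
  | |- _ => first [assumption | exact cont_id]
  end.

Lemma exp_le_compat (x y : R) : x <= y -> exp x <= exp y.
Proof. intros [H | ->]; [left; now apply exp_increasing | apply Rle_refl]. Qed.

Lemma exp_le_1 (x : R) : x <= 0 -> exp x <= 1.
Proof. intros H; rewrite <- exp_0; now apply exp_le_compat. Qed.

Lemma abs_RInt_le_RInt (f g : R -> R) (a b : R) :
  cont f -> cont g -> a <= b -> (forall x, a <= x <= b -> Rabs (f x) <= g x) ->
  Rabs (RInt f a b) <= RInt g a b.
Proof.
intros Hf Hg Hab H.
apply Rle_trans with (RInt (fun t => Rabs (f t)) a b).
- apply abs_RInt_le; [exact Hab | now apply cont_ex_RInt].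
- assert (cont (fun t => Rabs (f t))).
  { apply (cont_comp f Rabs Hf); intros x; apply continuous_Rabs. }
  apply RInt_le; try (now apply cont_ex_RInt); [exact Hab |].
  intros x Hx; apply H; lra.
Qed.

Lemma RInt_abs_swap (f : R -> R) (a b : R) : ex_RInt f b a ->
  Rabs (RInt f a b) = Rabs (RInt f b a).
Proof.
intros H; rewrite <- (opp_RInt_swap (V := R_CompleteNormedModule)) by exact H.
apply Rabs_Ropp.
Qed.

Lemma RInt_exp_neg (M lam a b : R) : 0 < lam ->
  RInt (fun u => M * exp (- lam * u)) a b
  = M / lam * (exp (- lam * a) - exp (- lam * b)).
Proof.
intros Hl.
apply is_RInt_unique.
replace (M / lam * (exp (- lam * a) - exp (- lam * b)))
  with (minus (- M / lam * exp (- lam * b)) (- M / lam * exp (- lam * a)))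
  by (unfold minus, plus, opp; simpl; field; lra).
apply (is_RInt_derive (fun u => - M / lam * exp (- lam * u))).
- intros x _; auto_derive; [exact I | field; lra].
- intros x _. revert x.
  apply cont_derive with (f' := fun x => M * (- lam * exp (- lam * x))).
  intros x; auto_derive; [exact I | ring].
Qed.

Lemma RInt_Chasles_cont (f : R -> R) (a b c : R) : cont f ->
  RInt f a b + RInt f b c = RInt f a c.
Proof.
intros Hf.
apply (RInt_Chasles (V := R_CompleteNormedModule) f a b c); now apply cont_ex_RInt.
Qed.

(** The bound depends on the left end only, so that it gives at once the Cauchy
    criterion at infinity and the size of the whole integral. *)
Lemma RInt_exp_bound (f : R -> R) (M lam a b : R) :
  0 < lam -> cont f -> (forall u, 0 <= u -> Rabs (f u) <= M * exp (- lam * u)) ->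
  0 <= a <= b -> Rabs (RInt f a b) <= M / lam * exp (- lam * a).
Proof.
intros Hl Hf Hb Hab.
assert (HM : 0 <= M).
{ generalize (Hb 0 (Rle_refl 0)) (Rabs_pos (f 0)).
  rewrite Rmult_0_r, exp_0; lra. }
apply Rle_trans with (RInt (fun u => M * exp (- lam * u)) a b).
- apply abs_RInt_le_RInt; [exact Hf | | lra |].
  + apply cont_derive with (f' := fun x => M * (- lam * exp (- lam * x))).
    intros x; auto_derive; [exact I | ring].
  + intros x Hx; apply Hb; lra.
- rewrite RInt_exp_neg by exact Hl.
  apply Rmult_le_compat_l.
  + apply Rdiv_le_0_compat; lra.
  + generalize (exp_pos (- lam * b)); lra.
Qed.

Lemma exp_neg_small (lam eps : R) : 0 < lam -> 0 < eps ->
  exists A, 0 <= A /\ forall u, A < u -> exp (- lam * u) < eps.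
Proof.
intros Hl He.
exists (Rmax 0 (- ln eps / lam)); split; [apply Rmax_l |].
intros u Hu.
rewrite <- (exp_ln eps He); apply exp_increasing.
assert (- ln eps / lam < u) by (eapply Rle_lt_trans; [apply Rmax_r | exact Hu]).
apply (Rmult_lt_compat_l lam) in H; [| exact Hl].
replace (lam * (- ln eps / lam)) with (- ln eps) in H by (field; lra).
lra.
Qed.

Definition half_line_int (f : R -> R) : R := real (Lim (fun b => RInt f 0 b) p_infty).

Lemma half_line_int_unique (f : R -> R) (l : R) :
  is_lim (fun b => RInt f 0 b) p_infty l -> half_line_int f = l.
Proof. intros H; unfold half_line_int; now rewrite (is_lim_unique _ _ _ H). Qed.

Lemma half_line_int_correct (f : R -> R) (M lam : R) :
  0 < lam -> cont f -> (forall u, 0 <= u -> Rabs (f u) <= M * exp (- lam * u)) ->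
  is_lim (fun b => RInt f 0 b) p_infty (half_line_int f).
Proof.
intros Hl Hf Hb.
assert (HM : 0 <= M).
{ generalize (Hb 0 (Rle_refl 0)) (Rabs_pos (f 0)).
  rewrite Rmult_0_r, exp_0; lra. }
assert (HM1 : 0 <= M / lam) by (apply Rdiv_le_0_compat; lra).
destruct (proj1 (filterlim_locally_cauchy (U := R_CompleteSpace)
   (F := Rbar_locally p_infty) (fun b => RInt f 0 b))) as [l Hlim].
- intros eps.
  destruct (exp_neg_small lam (eps / (M / lam + 1)) Hl) as [A [HA0 HA]].
  { apply Rdiv_lt_0_compat; [apply cond_pos | lra]. }
  exists (fun u => A < u); split; [now exists A |].
  assert (aux : forall u v, A < u -> u <= v -> Rabs (RInt f 0 v - RInt f 0 u) < eps).
  { intros u v Hu Huv.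
    assert (E : RInt f 0 v - RInt f 0 u = RInt f u v :> R)
      by (generalize (RInt_Chasles_cont f 0 u v Hf); lra).
    rewrite E.
    eapply Rle_lt_trans; [apply (RInt_exp_bound f M lam u v Hl Hf Hb); lra |].
    specialize (HA u Hu).
    apply Rle_lt_trans with ((M / lam + 1) * exp (- lam * u)).
    - generalize (exp_pos (- lam * u)); nra.
    - apply (Rmult_lt_compat_l (M / lam + 1)) in HA; [| lra].
      replace ((M / lam + 1) * (eps / (M / lam + 1))) with (pos eps) in HA
        by (field; split; lra).
      exact HA. }
  intros u v Hu Hv.
  change (Rabs (RInt f 0 v - RInt f 0 u) < eps).
  destruct (Rle_lt_dec u v) as [H | H].
  + now apply aux.
  + rewrite Rabs_minus_sym; apply aux; lra.
- change (is_lim (fun b => RInt f 0 b) p_infty l) in Hlim.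
  now rewrite (half_line_int_unique f l Hlim).
Qed.

Lemma is_lim_p_le (f : R -> R) (l M A : R) :
  is_lim f p_infty l -> (forall u, A < u -> f u <= M) -> l <= M.
Proof.
intros Hl H.
apply (is_lim_le_loc f (fun _ => M) p_infty l M); [| exact Hl | apply is_lim_const].
exists A; exact H.
Qed.

Lemma is_lim_p_abs_le (f : R -> R) (l M A : R) :
  is_lim f p_infty l -> (forall u, A < u -> Rabs (f u) <= M) -> Rabs l <= M.
Proof.
intros Hl H.
apply Rabs_le; split.
- enough (- l <= M) by lra.
  apply is_lim_p_le with (f := fun u => - f u) (A := A).
  + apply (is_lim_opp f p_infty l Hl).
  + intros u Hu; generalize (Rle_abs (- f u)) (H u Hu); rewrite Rabs_Ropp; lra.
- apply is_lim_p_le with (f := f) (A := A); [exact Hl |].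
  intros u Hu; generalize (Rle_abs (f u)) (H u Hu); lra.
Qed.

Lemma half_line_int_bound (f : R -> R) (M lam : R) :
  0 < lam -> cont f -> (forall u, 0 <= u -> Rabs (f u) <= M * exp (- lam * u)) ->
  Rabs (half_line_int f) <= M / lam.
Proof.
intros Hl Hf Hb.
apply is_lim_p_abs_le with (f := fun b => RInt f 0 b) (A := 0).
- now apply half_line_int_correct with M lam.
- intros u Hu.
  eapply Rle_trans; [apply (RInt_exp_bound f M lam 0 u Hl Hf Hb); lra |].
  rewrite Rmult_0_r, exp_0, Rmult_1_r; apply Rle_refl.
Qed.

Lemma is_lim_squeeze0 (f g : R -> R) :
  (forall u, 0 <= u -> Rabs (f u) <= g u) -> is_lim g p_infty 0 ->
  is_lim f p_infty 0.
Proof.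
intros H Hg.
apply (is_lim_le_le_loc (fun u => - g u) g).
- exists 0; intros u Hu.
  assert (Hu0 : 0 <= u) by lra.
  specialize (H u Hu0).
  apply Rabs_le_between in H; lra.
- replace (Finite 0) with (Rbar_opp 0) by (simpl; f_equal; ring).
  now apply is_lim_opp.
- exact Hg.
Qed.

Lemma is_lim_exp_neg (M lam : R) : 0 < lam ->
  is_lim (fun u => M * exp (- lam * u)) p_infty 0.
Proof.
intros Hl.
replace (Finite 0) with (Rbar_mult M 0) by (simpl; f_equal; ring).
apply (is_lim_scal_l (fun u => exp (- lam * u)) M p_infty 0).
apply (is_lim_comp exp (fun u => - lam * u) p_infty 0 m_infty).
- apply is_lim_exp_m.
- replace m_infty with (Rbar_mult (- lam) p_infty).
  + apply (is_lim_scal_l (fun u => u) (- lam) p_infty p_infty (is_lim_id p_infty)).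
  + apply is_Rbar_mult_unique.
    apply is_Rbar_mult_sym, is_Rbar_mult_p_infty_neg; simpl; lra.
- exists 0; discriminate.
Qed.

(** * Complex exponentials and complex integrands *)

Lemma Cexp_plus (z w : C) : Cexp (z + w)%C = (Cexp z * Cexp w)%C.
Proof.
destruct z as [x y], w as [x' y']; unfold Cexp, Re, Im; simpl.
rewrite exp_plus, cos_plus, sin_plus.
apply injective_projections; simpl; ring.
Qed.

Lemma Re_Cexp (z : C) : Re (Cexp z) = exp (Re z) * cos (Im z).
Proof. unfold Cexp, Re, Im, Cmult, RtoC; simpl; ring. Qed.

Lemma Im_Cexp (z : C) : Im (Cexp z) = exp (Re z) * sin (Im z).
Proof. unfold Cexp, Re, Im, Cmult, RtoC; simpl; ring. Qed.

Lemma Cmod_unit (t : R) : Cmod (cos t, sin t) = 1.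
Proof.
unfold Cmod; simpl.
transitivity (sqrt 1); [f_equal | apply sqrt_1].
generalize (sin2_cos2 t); unfold Rsqr; lra.
Qed.

Lemma Cmod_Cexp (z : C) : Cmod (Cexp z) = exp (Re z).
Proof.
unfold Cexp; rewrite Cmod_mult, Cmod_unit, Cmod_R, Rabs_pos_eq, Rmult_1_r;
  [reflexivity | apply Rlt_le, exp_pos].
Qed.

Lemma Cexp_conj (z : C) : Cexp (Cconj z) = Cconj (Cexp z).
Proof.
unfold Cexp, Cconj, Re, Im, RtoC; simpl; rewrite cos_neg, sin_neg.
apply injective_projections; simpl; ring.
Qed.

Lemma im_le_Cmod (z : C) : Rabs (Im z) <= Cmod z.
Proof.
eapply Rle_trans; [apply Rmax_r | apply (Rmax_Cmod z)].
Qed.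

Lemma Cmod_le_sum (z : C) : Cmod z <= Rabs (Re z) + Rabs (Im z).
Proof.
destruct z as [x y]; unfold Re, Im; simpl.
replace ((x, y) : C) with (RtoC x + RtoC y * Ci)%C
  by (apply injective_projections; simpl; ring).
eapply Rle_trans; [apply Cmod_triangle |].
rewrite Cmod_mult, !Cmod_R, Cmod_Ci; lra.
Qed.

Lemma exp_taylor1 (x : R) : 0 <= exp x - 1 - x <= x ^ 2 * Rmax 1 (exp x).
Proof.
split; [generalize (exp_ineq1_le x); lra |].
assert (H : exp x - 1 <= x * exp x).
{ generalize (exp_ineq1_le (- x)) (exp_pos x); intros H1 H2.
  rewrite exp_Ropp in H1.
  apply (Rmult_le_compat_r (exp x)) in H1; [| lra].
  rewrite Rinv_l in H1; lra. }
destruct (Rle_lt_dec 0 x) as [Hx | Hx].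
- apply Rle_trans with (x * (exp x - 1)); [lra |].
  apply Rle_trans with (x * (x * exp x)); [apply Rmult_le_compat_l; lra |].
  generalize (Rmax_r 1 (exp x)); intros; nra.
- generalize (exp_ineq1_le x); intros H1.
  apply Rle_trans with (x * (exp x - 1)); [lra |].
  generalize (Rmax_l 1 (exp x)); intros; nra.
Qed.

Lemma exp_lip (x : R) : Rabs (exp x - 1) <= Rabs x * Rmax 1 (exp x).
Proof.
assert (H : exp x - 1 <= x * exp x).
{ generalize (exp_ineq1_le (- x)) (exp_pos x); intros H1 H2.
  rewrite exp_Ropp in H1.
  apply (Rmult_le_compat_r (exp x)) in H1; [| lra].
  rewrite Rinv_l in H1; lra. }
generalize (exp_ineq1_le x) (Rmax_l 1 (exp x)) (Rmax_r 1 (exp x)); intros H1 H2 H3.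
destruct (Rle_lt_dec 0 x) as [Hx | Hx].
- rewrite (Rabs_pos_eq x Hx), Rabs_pos_eq by lra; nra.
- assert (exp x < 1) by (rewrite <- exp_0; now apply exp_increasing).
  rewrite !Rabs_left by lra; nra.
Qed.

Lemma sin_abs_le (t : R) : Rabs (sin t) <= Rabs t.
Proof.
assert (aux : forall x, 0 <= x -> Rabs (sin x) <= x).
{ intros x Hx.
  apply Rabs_le; split.
  - destruct (Rle_lt_dec x PI) as [H | H].
    + generalize (sin_ge_0 x Hx H); lra.
    + generalize (SIN_bound x) PI2_1; lra.
  - destruct (Req_dec x 0) as [-> | H]; [rewrite sin_0; lra |].
    left; apply sin_lt_x; lra. }
destruct (Rle_lt_dec 0 t) as [Ht | Ht].
- rewrite (Rabs_pos_eq t Ht); now apply aux.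
- rewrite <- (Rabs_Ropp (sin t)), <- sin_neg, (Rabs_left t Ht); apply aux; lra.
Qed.

Lemma one_minus_cos (t : R) : 0 <= 1 - cos t <= t ^ 2 / 2.
Proof.
split; [generalize (COS_bound t); lra |].
replace t with (2 * (t / 2)) at 1 by field.
rewrite cos_2a_sin.
generalize (sin_abs_le (t / 2)); intros H.
apply Rsqr_le_abs_1 in H; unfold Rsqr in H; lra.
Qed.

Lemma nonneg_of_derive (f f' : R -> R) (b : R) : 0 <= f 0 ->
  (forall x, 0 <= x <= b -> is_derive f x (f' x)) ->
  (forall x, 0 <= x <= b -> 0 <= f' x) -> forall x, 0 <= x <= b -> 0 <= f x.
Proof.
intros H0 Hd Hp x Hx.
destruct (MVT_gen f 0 x f') as [c [Hc E]].
- rewrite Rmin_left, Rmax_right by lra; intros t Ht; apply Hd; lra.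
- rewrite Rmin_left, Rmax_right by lra; intros t Ht.
  apply continuity_pt_filterlim.
  apply (ex_derive_continuous f t); exists (f' t); apply Hd; lra.
- rewrite Rmin_left, Rmax_right in Hc by lra.
  assert (0 <= f' c) by (apply Hp; lra).
  assert (0 <= f' c * (x - 0)) by (apply Rmult_le_pos; lra).
  lra.
Qed.

Lemma x_minus_sin (t : R) : 0 <= t -> 0 <= t - sin t <= t ^ 3 / 6.
Proof.
intros Ht; split; [generalize (sin_abs_le t); rewrite (Rabs_pos_eq t Ht);
  intros H; generalize (Rle_abs (sin t)); lra |].
enough (0 <= t ^ 3 / 6 - t + sin t) by lra.
apply (nonneg_of_derive (fun t => t ^ 3 / 6 - t + sin t)
  (fun t => t ^ 2 / 2 - 1 + cos t) t).
- rewrite sin_0; lra.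
- intros x _; auto_derive; [exact I | field].
- intros x _; generalize (one_minus_cos x); lra.
- lra.
Qed.

Lemma abs_sin_minus (t : R) : Rabs (sin t - t) <= Rabs t ^ 3 / 6.
Proof.
destruct (Rle_lt_dec 0 t) as [H | H].
- generalize (x_minus_sin t H); intros H1.
  rewrite (Rabs_pos_eq t H), Rabs_left1; lra.
- assert (H' : 0 <= - t) by lra.
  generalize (x_minus_sin (- t) H'); intros H1; rewrite sin_neg in H1.
  rewrite (Rabs_left t H), Rabs_pos_eq; lra.
Qed.

Lemma abs_sin_minus_sqr (t : R) : Rabs (sin t - t) <= t ^ 2.
Proof.
rewrite <- (pow2_abs t).
generalize (Rabs_pos t); intros H0.
destruct (Rle_lt_dec (Rabs t) 6) as [H | H].
- generalize (abs_sin_minus t); intros; nra.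
- generalize (Rabs_triang (sin t) (- t)) (sin_abs_le t); rewrite Rabs_Ropp.
  unfold Rminus; intros; nra.
Qed.

(** Taylor's formula at order one, with the remainder controlled by the two
    end values of the exponential only: this is what lets one differentiate
    under the integral sign when both integrands decay, without any bound on
    the growth of [exp (Cmod z)]. *)
Lemma Cexp_taylor1 (z : C) :
  Cmod (Cexp z - 1 - z)%C <= 4 * Cmod z ^ 2 * Rmax 1 (exp (Re z)).
Proof.
destruct z as [x y].
set (m := Rmax 1 (exp (Re (x, y)))).
assert (Hm1 : 1 <= m) by apply Rmax_l.
assert (Hm2 : exp x <= m) by apply (Rmax_r 1 (exp x)).
assert (Hmod : Cmod (x, y) ^ 2 = x ^ 2 + y ^ 2) by apply (Cmod2_alt (x, y)).
rewrite Hmod.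
eapply Rle_trans; [apply Cmod_le_sum |].
replace (Re (Cexp (x, y) - 1 - (x, y))%C) with ((exp x - 1 - x) - exp x * (1 - cos y))
  by (unfold Cexp, Re, Im, RtoC; simpl; ring).
replace (Im (Cexp (x, y) - 1 - (x, y))%C) with ((exp x - 1) * sin y + (sin y - y))
  by (unfold Cexp, Re, Im, RtoC; simpl; ring).
assert (H1 := exp_taylor1 x). assert (H2 := exp_lip x).
change (Rmax 1 (exp x)) with m in H1, H2.
assert (H3 := one_minus_cos y). assert (H4 := sin_abs_le y).
assert (H5 := abs_sin_minus_sqr y).
rewrite <- (pow2_abs x), <- (pow2_abs y) in *.
assert (Hx := Rabs_pos x). assert (Hy := Rabs_pos y).
assert (Hex := exp_pos x).
change (4 * (Rabs x ^ 2 + Rabs y ^ 2) * m) with (4 * (Rabs x ^ 2 + Rabs y ^ 2) * m).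
apply Rle_trans with
  ((Rabs x ^ 2 * m + m * (Rabs y ^ 2 / 2)) + (Rabs x * m * Rabs y + Rabs y ^ 2)).
- apply Rplus_le_compat.
  + unfold Rminus at 1; eapply Rle_trans; [apply Rabs_triang |].
    rewrite Rabs_Ropp; apply Rplus_le_compat.
    * rewrite Rabs_pos_eq; lra.
    * rewrite Rabs_pos_eq by (apply Rmult_le_pos; lra).
      apply Rmult_le_compat; lra.
  + eapply Rle_trans; [apply Rabs_triang |].
    apply Rplus_le_compat; [| exact H5].
    rewrite Rabs_mult; apply Rmult_le_compat; try apply Rabs_pos; lra.
- generalize (pow2_ge_0 (Rabs x - Rabs y)); intros; nra.
Qed.

Definition Ccont (f : R -> C) : Prop :=
  cont (fun x => Re (f x)) /\ cont (fun x => Im (f x)).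

Lemma Ccont_ext (f g : R -> C) : (forall x, f x = g x) -> Ccont f -> Ccont g.
Proof.
intros E [H1 H2]; split; [apply (cont_ext _ _ (fun x => f_equal Re (E x)) H1) |
  apply (cont_ext _ _ (fun x => f_equal Im (E x)) H2)].
Qed.

Lemma Ccont_const (c : C) : Ccont (fun _ => c).
Proof. split; apply cont_const. Qed.

Lemma Ccont_pair (a b : R -> R) : cont a -> cont b -> Ccont (fun x => (a x, b x)).
Proof. intros Ha Hb; now split. Qed.

Lemma Ccont_plus (f g : R -> C) : Ccont f -> Ccont g -> Ccont (fun x => f x + g x)%C.
Proof.
intros [H1 H2] [H3 H4]; split; [apply (cont_plus _ _ H1 H3) | apply (cont_plus _ _ H2 H4)].
Qed.

Lemma Ccont_mult (f g : R -> C) : Ccont f -> Ccont g -> Ccont (fun x => f x * g x)%C.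
Proof.
intros [H1 H2] [H3 H4]; split.
- apply (cont_minus _ _ (cont_mult _ _ H1 H3) (cont_mult _ _ H2 H4)).
- apply (cont_plus _ _ (cont_mult _ _ H1 H4) (cont_mult _ _ H2 H3)).
Qed.

Lemma Ccont_scal (k : C) (f : R -> C) : Ccont f -> Ccont (fun x => k * f x)%C.
Proof. intros H; apply Ccont_mult; [apply Ccont_const | exact H]. Qed.

Lemma Ccont_pow (f : R -> C) (n : nat) : Ccont f -> Ccont (fun x => f x ^ n)%C.
Proof.
intros H; induction n as [| n IH]; simpl; [apply Ccont_const | now apply Ccont_mult].
Qed.

Lemma Ccont_Cexp (f : R -> C) : Ccont f -> Ccont (fun x => Cexp (f x)).
Proof.
intros [H1 H2]; split.
- apply cont_ext with (f := fun x => exp (Re (f x)) * cos (Im (f x))).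
  + intros x; now rewrite Re_Cexp.
  + apply cont_mult; [apply (cont_comp _ _ H1 cont_exp) | apply (cont_comp _ _ H2 cont_cos)].
- apply cont_ext with (f := fun x => exp (Re (f x)) * sin (Im (f x))).
  + intros x; now rewrite Im_Cexp.
  + apply cont_mult; [apply (cont_comp _ _ H1 cont_exp) | apply (cont_comp _ _ H2 cont_sin)].
Qed.

(** Every contour integrand below is made of exponentials, and has such a bound
    once its contour is chosen well; the estimates then all come from [M / lam]. *)
Definition exp_small (f : R -> C) (M lam : R) : Prop :=
  0 < lam /\ Ccont f /\ forall u, 0 <= u -> Cmod (f u) <= M * exp (- lam * u).

Definition CInt (f : R -> C) : C := (half_line_int (fun u => Re (f u)), half_line_int (fun u => Im (f u))).

Lemma exp_small_lim (f : R -> C) (M lam : R) : exp_small f M lam ->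
  is_lim (fun b => RInt (fun u => Re (f u)) 0 b) p_infty (Re (CInt f)) /\
  is_lim (fun b => RInt (fun u => Im (f u)) 0 b) p_infty (Im (CInt f)).
Proof.
intros [Hl [[H1 H2] Hb]]; split; apply half_line_int_correct with M lam; try assumption.
- intros u Hu; eapply Rle_trans; [apply re_le_Cmod | now apply Hb].
- intros u Hu; eapply Rle_trans; [apply im_le_Cmod | now apply Hb].
Qed.

Lemma CInt_bound (f : R -> C) (M lam : R) : exp_small f M lam ->
  Cmod (CInt f) <= 2 * (M / lam).
Proof.
intros [Hl [[H1 H2] Hb]].
eapply Rle_trans; [apply Cmod_le_sum |].
assert (Rabs (Re (CInt f)) <= M / lam).
{ apply (half_line_int_bound (fun u => Re (f u))); try assumption.
  intros u Hu; eapply Rle_trans; [apply re_le_Cmod | now apply Hb]. }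
assert (Rabs (Im (CInt f)) <= M / lam).
{ apply (half_line_int_bound (fun u => Im (f u))); try assumption.
  intros u Hu; eapply Rle_trans; [apply im_le_Cmod | now apply Hb]. }
lra.
Qed.

Lemma CInt_ext (f g : R -> C) : (forall u, f u = g u) -> CInt f = CInt g.
Proof.
intros E; unfold CInt, half_line_int; apply injective_projections; simpl; f_equal;
  apply Lim_ext; intros b; apply RInt_ext; intros u _; now rewrite E.
Qed.

Lemma CInt_unique (f : R -> C) (l : C) :
  is_lim (fun b => RInt (fun u => Re (f u)) 0 b) p_infty (Re l) ->
  is_lim (fun b => RInt (fun u => Im (f u)) 0 b) p_infty (Im l) -> CInt f = l.
Proof.
intros H1 H2; unfold CInt.
rewrite (half_line_int_unique _ _ H1), (half_line_int_unique _ _ H2); now destruct l.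
Qed.

Lemma RInt_lin (a b : R) (f g : R -> R) (t : R) : cont f -> cont g ->
  RInt (fun u => a * f u + b * g u) 0 t = a * RInt f 0 t + b * RInt g 0 t.
Proof.
intros Hf Hg.
apply is_RInt_unique.
apply (is_RInt_plus (V := R_NormedModule) (fun u => a * f u) (fun u => b * g u)).
- apply (is_RInt_scal (V := R_NormedModule) f 0 t a).
  apply (RInt_correct (V := R_CompleteNormedModule)); now apply cont_ex_RInt.
- apply (is_RInt_scal (V := R_NormedModule) g 0 t b).
  apply (RInt_correct (V := R_CompleteNormedModule)); now apply cont_ex_RInt.
Qed.

Lemma is_lim_RInt_lin (a b : R) (f g : R -> R) (lf lg : R) : cont f -> cont g ->
  is_lim (fun t => RInt f 0 t) p_infty lf -> is_lim (fun t => RInt g 0 t) p_infty lg ->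
  is_lim (fun t => RInt (fun u => a * f u + b * g u) 0 t) p_infty (a * lf + b * lg).
Proof.
intros Hf Hg Lf Lg.
apply is_lim_ext with (f := fun t => a * RInt f 0 t + b * RInt g 0 t).
- intros t; symmetry; now apply RInt_lin.
- apply is_lim_plus'.
  + apply (is_lim_scal_l (fun t => RInt f 0 t) a p_infty lf Lf).
  + apply (is_lim_scal_l (fun t => RInt g 0 t) b p_infty lg Lg).
Qed.

Lemma CInt_plus (f g : R -> C) (M lam M' lam' : R) :
  exp_small f M lam -> exp_small g M' lam' ->
  CInt (fun u => f u + g u)%C = (CInt f + CInt g)%C.
Proof.
intros Hf Hg.
destruct (exp_small_lim f M lam Hf) as [F1 F2].
destruct (exp_small_lim g M' lam' Hg) as [G1 G2].
destruct Hf as [_ [[Hf1 Hf2] _]]; destruct Hg as [_ [[Hg1 Hg2] _]].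
apply CInt_unique.
- replace (Re (CInt f + CInt g)%C) with (1 * Re (CInt f) + 1 * Re (CInt g))
    by (unfold Re; simpl; ring).
  eapply is_lim_ext; [| apply (is_lim_RInt_lin 1 1 _ _ _ _ Hf1 Hg1 F1 G1)].
  intros t; apply RInt_ext; intros u _; unfold Re; simpl; ring.
- replace (Im (CInt f + CInt g)%C) with (1 * Im (CInt f) + 1 * Im (CInt g))
    by (unfold Im; simpl; ring).
  eapply is_lim_ext; [| apply (is_lim_RInt_lin 1 1 _ _ _ _ Hf2 Hg2 F2 G2)].
  intros t; apply RInt_ext; intros u _; unfold Im; simpl; ring.
Qed.

Lemma CInt_scal (k : C) (f : R -> C) (M lam : R) :
  exp_small f M lam -> CInt (fun u => k * f u)%C = (k * CInt f)%C.
Proof.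
intros Hf.
destruct (exp_small_lim f M lam Hf) as [F1 F2].
destruct Hf as [_ [[Hf1 Hf2] _]].
apply CInt_unique.
- replace (Re (k * CInt f)%C) with (Re k * Re (CInt f) + (- Im k) * Im (CInt f))
    by (unfold Re, Im; simpl; ring).
  eapply is_lim_ext; [| apply (is_lim_RInt_lin (Re k) (- Im k) _ _ _ _ Hf1 Hf2 F1 F2)].
  intros t; apply RInt_ext; intros u _; unfold Re, Im; simpl; ring.
- replace (Im (k * CInt f)%C) with (Im k * Re (CInt f) + Re k * Im (CInt f))
    by (unfold Re, Im; simpl; ring).
  eapply is_lim_ext; [| apply (is_lim_RInt_lin (Im k) (Re k) _ _ _ _ Hf1 Hf2 F1 F2)].
  intros t; apply RInt_ext; intros u _; unfold Re, Im; simpl; ring.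
Qed.

Lemma exp_small_scal (k : C) (f : R -> C) (M lam : R) :
  exp_small f M lam -> exp_small (fun u => k * f u)%C (Cmod k * M) lam.
Proof.
intros [Hl [Hc Hb]]; split; [exact Hl | split; [now apply Ccont_scal |]].
intros u Hu; rewrite Cmod_mult, Rmult_assoc.
apply Rmult_le_compat_l; [apply Cmod_ge_0 | now apply Hb].
Qed.

Lemma exp_small_plus (f g : R -> C) (M M' lam : R) :
  exp_small f M lam -> exp_small g M' lam ->
  exp_small (fun u => f u + g u)%C (M + M') lam.
Proof.
intros [Hl [Hc Hb]] [_ [Hc' Hb']]; split; [exact Hl | split; [now apply Ccont_plus |]].
intros u Hu; eapply Rle_trans; [apply Cmod_triangle |].
rewrite Rmult_plus_distr_r; apply Rplus_le_compat; auto.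
Qed.

(** * Exponential integrals with two linear parameters *)

Definition expo (b1 b2 : R -> C) (x1 x2 : R) (r : R) : C :=
  (RtoC x1 * b1 r + RtoC x2 * b2 r)%C.

Definition ExpInt (c b1 b2 : R -> C) (x1 x2 : R) : C :=
  CInt (fun r => c r * Cexp (expo b1 b2 x1 x2 r))%C.

(** The square leaves room for the two factors [b1], [b2] that a Taylor
    expansion at order one produces in its remainder. *)
Definition ExpInt_ok (c b1 b2 : R -> C) (x1 x2 M lam : R) : Prop :=
  forall r, 0 <= r ->
    Cmod (c r) * (1 + Cmod (b1 r) + Cmod (b2 r)) ^ 2 * exp (Re (expo b1 b2 x1 x2 r))
    <= M * exp (- lam * r).

Lemma Ccont_expo (b1 b2 : R -> C) (x1 x2 : R) : Ccont b1 -> Ccont b2 ->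
  Ccont (expo b1 b2 x1 x2).
Proof. intros; apply Ccont_plus; now apply Ccont_scal. Qed.

Lemma ExpInt_ok_factor (c g b1 b2 : R -> C) (x1 x2 M lam : R) :
  0 < lam -> Ccont c -> Ccont g -> Ccont b1 -> Ccont b2 ->
  ExpInt_ok c b1 b2 x1 x2 M lam ->
  (forall r, Cmod (g r) <= 1 + Cmod (b1 r) + Cmod (b2 r)) ->
  exp_small (fun r => c r * g r * Cexp (expo b1 b2 x1 x2 r))%C M lam.
Proof.
intros Hl Hc Hg H1 H2 H Hgb; split; [exact Hl | split].
- apply Ccont_mult; [now apply Ccont_mult | now apply Ccont_Cexp, Ccont_expo].
- intros r Hr; eapply Rle_trans; [| now apply H].
  rewrite !Cmod_mult, Cmod_Cexp.
  apply Rmult_le_compat_r; [apply Rlt_le, exp_pos |].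
  generalize (Cmod_ge_0 (c r)) (Cmod_ge_0 (b1 r)) (Cmod_ge_0 (b2 r)) (Hgb r); intros A0 A1 A2 A3.
  apply Rmult_le_compat_l; nra.
Qed.

Lemma ExpInt_ok_small (c b1 b2 : R -> C) (x1 x2 M lam : R) :
  0 < lam -> Ccont c -> Ccont b1 -> Ccont b2 -> ExpInt_ok c b1 b2 x1 x2 M lam ->
  exp_small (fun r => c r * Cexp (expo b1 b2 x1 x2 r))%C M lam.
Proof.
intros Hl Hc H1 H2 H.
destruct (ExpInt_ok_factor c (fun _ => RtoC 1) b1 b2 x1 x2 M lam) as [_ [C B]]; auto.
- apply Ccont_const.
- intros r; rewrite Cmod_1; generalize (Cmod_ge_0 (b1 r)) (Cmod_ge_0 (b2 r)); lra.
- split; [exact Hl | split].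
  + apply Ccont_ext with (2 := C); intros r; now rewrite Cmult_1_r.
  + intros r Hr; specialize (B r Hr); now rewrite Cmult_1_r in B.
Qed.

(** Differentiation under the integral sign: the exponential is expanded
    pointwise, and the remainder decays because both end integrands do. *)
Lemma ExpInt_taylor (c b1 b2 : R -> C) (x1 x2 h1 h2 M lam : R) :
  0 < lam -> Ccont c -> Ccont b1 -> Ccont b2 ->
  ExpInt_ok c b1 b2 x1 x2 M lam -> ExpInt_ok c b1 b2 (x1 + h1) (x2 + h2) M lam ->
  Cmod (ExpInt c b1 b2 (x1 + h1) (x2 + h2) - ExpInt c b1 b2 x1 x2
        - (RtoC h1 * ExpInt (fun r => c r * b1 r) b1 b2 x1 x2
           + RtoC h2 * ExpInt (fun r => c r * b2 r) b1 b2 x1 x2))%C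
  <= 16 * (M / lam) * (Rabs h1 + Rabs h2) ^ 2.
Proof.
intros Hl Cc C1 C2 H0 H1.
set (h := Rabs h1 + Rabs h2).
set (E0 := expo b1 b2 x1 x2).
set (z := expo b1 b2 h1 h2).
assert (Hh : 0 <= h) by (apply Rplus_le_le_0_compat; apply Rabs_pos).
assert (CE : Ccont E0) by now apply Ccont_expo.
assert (Hsum : forall r, expo b1 b2 (x1 + h1) (x2 + h2) r = (E0 r + z r)%C).
{ intros r; unfold E0, z, expo; rewrite !RtoC_plus; ring. }
assert (S0 : exp_small (fun r => c r * Cexp (E0 r))%C M lam)
  by now apply ExpInt_ok_small.
assert (S1 : exp_small (fun r => c r * b1 r * Cexp (E0 r))%C M lam)
  by (apply ExpInt_ok_factor; auto; intros r;
      generalize (Cmod_ge_0 (b1 r)) (Cmod_ge_0 (b2 r)); lra).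
assert (S2 : exp_small (fun r => c r * b2 r * Cexp (E0 r))%C M lam)
  by (apply ExpInt_ok_factor; auto; intros r;
      generalize (Cmod_ge_0 (b1 r)) (Cmod_ge_0 (b2 r)); lra).
assert (S3 : exp_small (fun r => c r * Cexp (E0 r) * (Cexp (z r) - 1 - z r))%C
               (8 * M * h ^ 2) lam).
{ split; [exact Hl | split].
  - apply Ccont_mult; [apply Ccont_mult; [exact Cc | now apply Ccont_Cexp] |].
    assert (Cz : Ccont z) by now apply Ccont_expo.
    apply Ccont_ext with (f := fun r => (Cexp (z r) + RtoC (- 1) + RtoC (- 1) * z r)%C).
    + intros r; apply injective_projections; simpl; ring.
    + apply Ccont_plus; [apply Ccont_plus; [now apply Ccont_Cexp | apply Ccont_const] |
        now apply Ccont_scal].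
  - intros r Hr.
    specialize (H0 r Hr); specialize (H1 r Hr); rewrite Hsum in H1; fold E0 in H0.
    rewrite !Cmod_mult, Cmod_Cexp.
    set (B := 1 + Cmod (b1 r) + Cmod (b2 r)) in *.
    set (e0 := exp (Re (E0 r))) in *.
    replace (Re (E0 r + z r)%C) with (Re (E0 r) + Re (z r)) in H1 by reflexivity.
    rewrite exp_plus in H1; fold e0 in H1.
    generalize (Cmod_ge_0 (c r)) (Cmod_ge_0 (b1 r)) (Cmod_ge_0 (b2 r)) (exp_pos (Re (E0 r)));
      fold e0; intros A0 A1 A2 A3.
    assert (A4 := exp_pos (Re (z r))).
    assert (Hz : Cmod (z r) <= h * B).
    { unfold z, expo; eapply Rle_trans; [apply Cmod_triangle |].
      rewrite !Cmod_mult, !Cmod_R; unfold h, B.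
      generalize (Rabs_pos h1) (Rabs_pos h2); intros; nra. }
    assert (Hz2 : Cmod (z r) ^ 2 <= h ^ 2 * B ^ 2).
    { rewrite <- Rpow_mult_distr; apply pow_incr; split; [apply Cmod_ge_0 | exact Hz]. }
    assert (Hmax : Rmax 1 (exp (Re (z r))) <= 1 + exp (Re (z r)))
      by (apply Rmax_lub; lra).
    apply Rle_trans with (Cmod (c r) * e0 * (4 * (h ^ 2 * B ^ 2) * (1 + exp (Re (z r))))).
    + apply Rmult_le_compat_l; [apply Rmult_le_pos; lra |].
      eapply Rle_trans; [apply Cexp_taylor1 |].
      apply Rmult_le_compat; [| | lra | exact Hmax].
      * generalize (pow2_ge_0 (Cmod (z r))); lra.
      * apply Rle_trans with 1; [lra | apply Rmax_l].
    + replace (Cmod (c r) * e0 * (4 * (h ^ 2 * B ^ 2) * (1 + exp (Re (z r)))))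
        with (4 * h ^ 2 * (Cmod (c r) * B ^ 2 * e0 + Cmod (c r) * B ^ 2 * (e0 * exp (Re (z r)))))
        by ring.
      replace (8 * M * h ^ 2 * exp (- lam * r))
        with (4 * h ^ 2 * (M * exp (- lam * r) + M * exp (- lam * r))) by ring.
      apply Rmult_le_compat_l; [generalize (pow2_ge_0 h); lra | lra]. }
assert (Eq : ExpInt c b1 b2 (x1 + h1) (x2 + h2)
  = (CInt (fun r => c r * Cexp (E0 r))
     + (RtoC h1 * CInt (fun r => c r * b1 r * Cexp (E0 r))
        + RtoC h2 * CInt (fun r => c r * b2 r * Cexp (E0 r)))
     + CInt (fun r => c r * Cexp (E0 r) * (Cexp (z r) - 1 - z r)))%C).
{ rewrite <- (CInt_scal h1 _ _ _ S1), <- (CInt_scal h2 _ _ _ S2).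
  assert (S1' := exp_small_scal h1 _ _ _ S1).
  assert (S2' := exp_small_scal h2 _ _ _ S2).
  rewrite <- (CInt_plus _ _ _ _ _ _ S1' S2').
  assert (S12 := exp_small_plus _ _ _ _ _ S1' S2').
  rewrite <- (CInt_plus _ _ _ _ _ _ S0 S12).
  assert (S012 := exp_small_plus _ _ _ _ _ S0 S12).
  rewrite <- (CInt_plus _ _ _ _ _ _ S012 S3).
  apply CInt_ext; intros r; rewrite Hsum, Cexp_plus.
  change (z r) with (RtoC h1 * b1 r + RtoC h2 * b2 r)%C at 3; ring. }
rewrite Eq; unfold ExpInt; fold E0.
match goal with |- Cmod ?x <= _ =>
  replace x with (CInt (fun r => c r * Cexp (E0 r) * (Cexp (z r) - 1 - z r)))%C by ring end.
eapply Rle_trans; [apply (CInt_bound _ _ _ S3) |].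
right; field; lra.
Qed.

(** * Derivatives relative to a set *)

(** The epsilon-delta form of a derivative relative to [D]; sums, products and
    limits are easier to handle in it than with filters. *)
Definition deriv_on (D : R -> Prop) (f : R -> C) (x : R) (l : C) : Prop :=
  forall eps, 0 < eps -> exists delta, 0 < delta /\
    forall t, D t -> Rabs (t - x) < delta ->
      Cmod (f t - f x - RtoC (t - x) * l)%C <= eps * Rabs (t - x).

Lemma deriv_on_ext (D : R -> Prop) (f g : R -> C) (x : R) (l : C) : D x ->
  (forall t, D t -> f t = g t) -> deriv_on D f x l -> deriv_on D g x l.
Proof.
intros Dx E H eps He; destruct (H eps He) as [d [Hd H1]].
exists d; split; [exact Hd |]; intros t Dt Ht.
rewrite <- !E by assumption; now apply H1.
Qed.

Lemma norm_C_R (z : C) : norm (K := R_AbsRing) (V := C_R_NormedModule) z = Cmod z.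
Proof.
destruct z as [x y].
change (sqrt (Rabs x ^ 2 + Rabs y ^ 2) = sqrt (x ^ 2 + y ^ 2)).
now rewrite !pow2_abs.
Qed.

Lemma scal_C_R (h : R) (l : C) : scal (V := C_R_NormedModule) h l = (RtoC h * l)%C.
Proof.
destruct l as [x y]; apply injective_projections; simpl;
  unfold scal; simpl; unfold mult; simpl; ring.
Qed.

Lemma deriv_on_is_derive_on (D : R -> Prop) (f : R -> C) (x : R) (l : C) :
  D x -> deriv_on D f x l -> is_derive_on D f x l.
Proof.
intros Dx H; split.
- apply (is_linear_scal_l (K := R_AbsRing) (V := C_R_NormedModule) l).
- intros z Hz.
  assert (z = x) as ->.
  { destruct (Req_dec z x) as [E | E]; [exact E | exfalso].
    assert (Hp : 0 < Rabs (z - x)) by (apply Rabs_pos_lt; lra).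
    specialize (Hz (fun t => Rabs (t - z) < Rabs (z - x))).
    destruct Hz as [e He].
    - exists (mkposreal _ Hp); intros t Ht; exact Ht.
    - specialize (He x (ball_center x e) Dx); simpl in He.
      rewrite Rabs_minus_sym in He; lra. }
  intros eps; destruct (H eps (cond_pos eps)) as [d [Hd H1]].
  exists (mkposreal d Hd); intros t Ht Dt.
  specialize (H1 t Dt Ht).
  rewrite norm_C_R.
  change (norm (minus t x)) with (Rabs (t - x)).
  rewrite scal_C_R.
  eapply Rle_trans; [| exact H1].
  right; f_equal.
Qed.

Lemma is_derive_on_deriv_on (D : R -> Prop) (f : R -> C) (x : R) (l : C) :
  is_derive_on D f x l -> deriv_on D f x l.
Proof.
intros [_ H] eps He.
assert (Hx : is_filter_lim (within D (locally x)) x)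
  by (intros P [d HP]; exists d; intros t Ht _; now apply HP).
destruct (H x Hx (mkposreal eps He))
  as [d Hd].
exists d; split; [apply cond_pos |]; intros t Dt Ht.
specialize (Hd t Ht Dt); simpl in Hd.
rewrite norm_C_R in Hd.
change (norm (minus t x)) with (Rabs (t - x)) in Hd.
rewrite scal_C_R in Hd.
eapply Rle_trans; [| exact Hd].
right; f_equal.
Qed.

Lemma deriv_on_unique (D : R -> Prop) (f : R -> C) (x : R) (l1 l2 : C) :
  (forall d, 0 < d -> exists t, D t /\ 0 < Rabs (t - x) < d) ->
  deriv_on D f x l1 -> deriv_on D f x l2 -> l1 = l2.
Proof.
intros Hacc H1 H2.
assert (Hm : Cmod (l1 - l2)%C <= 0).
{ apply Rnot_lt_le; intros Hp.
  assert (He : 0 < Cmod (l1 - l2)%C / 4) by lra.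
  destruct (H1 _ He) as [d1 [Hd1 B1]]; destruct (H2 _ He) as [d2 [Hd2 B2]].
  destruct (Hacc (Rmin d1 d2)) as [t [Dt [Ht0 Ht]]]; [now apply Rmin_pos |].
  specialize (B1 t Dt (Rlt_le_trans _ _ _ Ht (Rmin_l _ _))).
  specialize (B2 t Dt (Rlt_le_trans _ _ _ Ht (Rmin_r _ _))).
  assert (E : Cmod (RtoC (t - x) * (l1 - l2))%C
     <= 2 * (Cmod (l1 - l2)%C / 4 * Rabs (t - x))).
  { replace (RtoC (t - x) * (l1 - l2))%C
      with ((f t - f x - RtoC (t - x) * l2) + - (f t - f x - RtoC (t - x) * l1))%C by ring.
    eapply Rle_trans; [apply Cmod_triangle |]; rewrite Cmod_opp; lra. }
  rewrite Cmod_mult, Cmod_R in E; nra. }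
assert (E : (l1 - l2)%C = 0) by (apply Cmod_eq_0; generalize (Cmod_ge_0 (l1 - l2)%C); lra).
replace l1 with (l1 - l2 + l2)%C by ring; rewrite E; ring.
Qed.

Lemma deriv_on_const (D : R -> Prop) (c : C) (x : R) : deriv_on D (fun _ => c) x 0.
Proof.
intros eps He; exists 1; split; [lra |]; intros t _ _.
replace (c - c - RtoC (t - x) * 0)%C with (RtoC 0) by ring.
rewrite Cmod_0; apply Rmult_le_pos; [lra | apply Rabs_pos].
Qed.

Lemma deriv_on_plus (D : R -> Prop) (f g : R -> C) (x : R) (l m : C) :
  deriv_on D f x l -> deriv_on D g x m -> deriv_on D (fun t => f t + g t)%C x (l + m)%C.
Proof.
intros Hf Hg eps He.
assert (He2 : 0 < eps / 2) by lra.
destruct (Hf _ He2) as [d1 [Hd1 B1]]; destruct (Hg _ He2) as [d2 [Hd2 B2]].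
exists (Rmin d1 d2); split; [now apply Rmin_pos |]; intros t Dt Ht.
specialize (B1 t Dt (Rlt_le_trans _ _ _ Ht (Rmin_l _ _))).
specialize (B2 t Dt (Rlt_le_trans _ _ _ Ht (Rmin_r _ _))).
replace (f t + g t - (f x + g x) - RtoC (t - x) * (l + m))%C
  with ((f t - f x - RtoC (t - x) * l) + (g t - g x - RtoC (t - x) * m))%C by ring.
eapply Rle_trans; [apply Cmod_triangle | lra].
Qed.

Lemma deriv_on_lip (D : R -> Prop) (f : R -> C) (x : R) (l : C) :
  deriv_on D f x l -> exists d, 0 < d /\ forall t, D t -> Rabs (t - x) < d ->
    Cmod (f t - f x)%C <= (Cmod l + 1) * Rabs (t - x).
Proof.
intros H; destruct (H 1 Rlt_0_1) as [d [Hd B]].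
exists d; split; [exact Hd |]; intros t Dt Ht; specialize (B t Dt Ht).
replace (f t - f x)%C with ((f t - f x - RtoC (t - x) * l) + RtoC (t - x) * l)%C by ring.
eapply Rle_trans; [apply Cmod_triangle |].
rewrite Cmod_mult, Cmod_R; lra.
Qed.

Lemma deriv_on_mult (D : R -> Prop) (f g : R -> C) (x : R) (l m : C) :
  deriv_on D f x l -> deriv_on D g x m ->
  deriv_on D (fun t => f t * g t)%C x (l * g x + f x * m)%C.
Proof.
intros Hf Hg eps He.
destruct (deriv_on_lip _ _ _ _ Hf) as [d0 [Hd0 B0]].
destruct (deriv_on_lip _ _ _ _ Hg) as [d3 [Hd3 B3]].
set (a := Cmod (f x)). set (b := Cmod (g x)).
set (k := (Cmod l + 1) * (Cmod m + 1)).
assert (Ha : 0 <= a) by apply Cmod_ge_0. assert (Hb : 0 <= b) by apply Cmod_ge_0.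
assert (Hk : 0 < k) by (generalize (Cmod_ge_0 l) (Cmod_ge_0 m); intros; unfold k; nra).
assert (H1 : 0 < eps / (3 * (b + 1))) by (apply Rdiv_lt_0_compat; lra).
assert (H2 : 0 < eps / (3 * (a + 1))) by (apply Rdiv_lt_0_compat; lra).
assert (H3 : 0 < eps / (3 * k)) by (apply Rdiv_lt_0_compat; lra).
destruct (Hf _ H1) as [d1 [Hd1 B1]]; destruct (Hg _ H2) as [d2 [Hd2 B2]].
exists (Rmin (Rmin d0 d3) (Rmin (Rmin d1 d2) (eps / (3 * k)))); split.
{ repeat apply Rmin_pos; assumption. }
intros t Dt Ht.
assert (T0 : Rabs (t - x) < d0)
  by (eapply Rlt_le_trans; [exact Ht | eapply Rle_trans; apply Rmin_l]).
assert (T3 : Rabs (t - x) < d3)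
  by (eapply Rlt_le_trans; [exact Ht | eapply Rle_trans; [apply Rmin_l | apply Rmin_r]]).
assert (T1 : Rabs (t - x) < d1)
  by (eapply Rlt_le_trans; [exact Ht | eapply Rle_trans; [apply Rmin_r |
        eapply Rle_trans; [apply Rmin_l | apply Rmin_l]]]).
assert (T2 : Rabs (t - x) < d2)
  by (eapply Rlt_le_trans; [exact Ht | eapply Rle_trans; [apply Rmin_r |
        eapply Rle_trans; [apply Rmin_l | apply Rmin_r]]]).
assert (T4 : Rabs (t - x) < eps / (3 * k))
  by (eapply Rlt_le_trans; [exact Ht | eapply Rle_trans; [apply Rmin_r | apply Rmin_r]]).
specialize (B0 t Dt T0); specialize (B1 t Dt T1); specialize (B2 t Dt T2);
  specialize (B3 t Dt T3).
replace (f t * g t - f x * g x - RtoC (t - x) * (l * g x + f x * m))%C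
  with ((f t - f x - RtoC (t - x) * l) * g x + f x * (g t - g x - RtoC (t - x) * m)
        + (f t - f x) * (g t - g x))%C by ring.
eapply Rle_trans; [apply Cmod_triangle |].
apply Rle_trans with ((eps / 3 * Rabs (t - x) + eps / 3 * Rabs (t - x)) + eps / 3 * Rabs (t - x));
  [| lra].
assert (Ht0 := Rabs_pos (t - x)).
apply Rplus_le_compat.
- eapply Rle_trans; [apply Cmod_triangle |].
  rewrite !Cmod_mult; fold a b.
  apply Rplus_le_compat.
  + apply Rle_trans with (eps / (3 * (b + 1)) * Rabs (t - x) * (b + 1)).
    * apply Rmult_le_compat; try lra; apply Cmod_ge_0.
    * right; field; lra.
  + apply Rle_trans with ((a + 1) * (eps / (3 * (a + 1)) * Rabs (t - x))).
    * apply Rmult_le_compat; try lra; apply Cmod_ge_0.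
    * right; field; lra.
- rewrite Cmod_mult.
  apply Rle_trans with (((Cmod l + 1) * Rabs (t - x)) * ((Cmod m + 1) * Rabs (t - x))).
  + apply Rmult_le_compat; try apply Cmod_ge_0; assumption.
  + replace ((Cmod l + 1) * Rabs (t - x) * ((Cmod m + 1) * Rabs (t - x)))
      with (k * Rabs (t - x) * Rabs (t - x)) by (unfold k; ring).
    apply Rmult_le_compat_r; [exact Ht0 |].
    apply Rle_trans with (k * (eps / (3 * k))).
    * apply Rmult_le_compat_l; lra.
    * right; field; lra.
Qed.

Lemma deriv_on_quadratic (D : R -> Prop) (f : R -> C) (x : R) (l : C) (K d : R) :
  0 < d -> (forall t, D t -> Rabs (t - x) < d ->
    Cmod (f t - f x - RtoC (t - x) * l)%C <= K * Rabs (t - x) ^ 2) ->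
  deriv_on D f x l.
Proof.
intros Hd H eps He.
assert (HK : 0 < Rabs K + 1) by (generalize (Rabs_pos K); lra).
assert (He' : 0 < eps / (Rabs K + 1)) by (now apply Rdiv_lt_0_compat).
exists (Rmin d (eps / (Rabs K + 1))); split; [now apply Rmin_pos |].
intros t Dt Ht.
assert (T1 := Rlt_le_trans _ _ _ Ht (Rmin_l _ _)).
assert (T2 := Rlt_le_trans _ _ _ Ht (Rmin_r _ _)).
eapply Rle_trans; [now apply H |].
assert (Ha := Rabs_pos (t - x)). assert (HKa := Rle_abs K).
replace eps with ((Rabs K + 1) * (eps / (Rabs K + 1))) by (field; lra).
apply Rle_trans with ((Rabs K + 1) * Rabs (t - x) * Rabs (t - x)).
- simpl; rewrite Rmult_1_r, <- Rmult_assoc.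
  apply Rmult_le_compat_r; [exact Ha |]; apply Rmult_le_compat_r; lra.
- apply Rmult_le_compat_r; [exact Ha |]; apply Rmult_le_compat_l; lra.
Qed.

Lemma deriv_on_RtoC (D : R -> Prop) (f : R -> R) (x l : R) :
  is_derive f x l -> deriv_on D (fun t => RtoC (f t)) x l.
Proof.
intros [_ H] eps He.
destruct (H x (fun P HP => HP) (mkposreal eps He)) as [d Hd].
exists d; split; [apply cond_pos |]; intros t _ Ht.
specialize (Hd t Ht); simpl in Hd.
rewrite <- RtoC_minus, <- RtoC_mult, <- RtoC_minus, Cmod_R.
exact Hd.
Qed.

Lemma deriv_on_Cconj (D : R -> Prop) (f : R -> C) (x : R) (l : C) :
  deriv_on D f x l -> deriv_on D (fun t => Cconj (f t)) x (Cconj l).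
Proof.
intros H eps He; destruct (H eps He) as [d [Hd B]].
exists d; split; [exact Hd |]; intros t Dt Ht.
rewrite <- Cmod_conj.
match goal with |- Cmod ?z <= _ =>
  replace z with (f t - f x - RtoC (t - x) * l)%C end.
- now apply B.
- apply injective_projections; simpl; ring.
Qed.

(** On a neighbourhood, the relative derivative is the usual one. *)
Lemma deriv_on_Im (f : R -> C) (D : R -> Prop) (x : R) (l : C) :
  locally x D -> deriv_on D f x l -> is_derive (fun t => Im (f t)) x (Im l).
Proof.
intros [e He] H; split; [apply (is_linear_scal_l (K := R_AbsRing) (V := R_NormedModule)) |].
intros z Hz.
assert (z = x) as -> by (symmetry; apply (is_filter_lim_locally_unique x z Hz)).
intros eps; destruct (H eps (cond_pos eps)) as [d [Hd B]].
exists (mkposreal _ (Rmin_pos e d (cond_pos e) Hd)); intros t Ht.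
assert (Ht' : Rabs (t - x) < Rmin e d) by exact Ht.
assert (Dt : D t) by (apply He; eapply Rlt_le_trans; [exact Ht' | apply Rmin_l]).
specialize (B t Dt (Rlt_le_trans _ _ _ Ht' (Rmin_r _ _))).
change (Rabs (Im (f t) - Im (f x) - (t - x) * Im l) <= eps * Rabs (t - x)).
eapply Rle_trans; [| exact B].
eapply Rle_trans; [| apply im_le_Cmod].
right; f_equal; unfold Im; simpl; ring.
Qed.

(** [Derive_n_on] chooses its value among the derivatives, so it is computed by
    uniqueness: a sequence [F] in which each term is the derivative of the
    preceding one must be the sequence of iterated derivatives. *)
Lemma Derive_n_on_eq (D : R -> Prop) (f : R -> C) (F : nat -> R -> C) :
  (forall x, D x -> forall d, 0 < d -> exists t, D t /\ 0 < Rabs (t - x) < d) ->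
  (forall x, D x -> f x = F 0%nat x) ->
  (forall n x, D x -> deriv_on D (F n) x (F (S n) x)) ->
  forall n x, D x ->
    Derive_n_on D f n x = F n x /\ is_derive_on D (Derive_n_on D f n) x (F (S n) x).
Proof.
intros Hacc H0 HF.
assert (aux : forall n, (forall x, D x -> Derive_n_on D f n x = F n x) ->
   forall x, D x -> deriv_on D (Derive_n_on D f n) x (F (S n) x)).
{ intros n E x Dx; apply deriv_on_ext with (F n); auto.
  intros t Dt; symmetry; auto. }
assert (E : forall n x, D x -> Derive_n_on D f n x = F n x).
{ induction n as [| n IH]; intros x Dx; [now apply H0 |].
  change (@iota C_R_CompleteNormedModule
    (is_derive_on D (Derive_n_on D f n) x) = F (S n) x).
  apply (iota_unique (V := C_R_CompleteNormedModule)
    (is_derive_on D (Derive_n_on D f n) x) (F (S n) x)).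
  - intros y Hy; apply (deriv_on_unique D (Derive_n_on D f n) x); [now apply Hacc | |].
    + now apply is_derive_on_deriv_on.
    + now apply aux.
  - apply deriv_on_is_derive_on; [exact Dx | now apply aux]. }
intros n x Dx; split; [now apply E |].
apply deriv_on_is_derive_on; [exact Dx |]; apply aux; auto.
Qed.

(** * Differentiation of proper parameter integrals *)

Lemma continuity_2d_comp (h : R -> R) (g : R -> R -> R) :
  cont h -> (forall x y, continuity_2d_pt g x y) ->
  forall x y, continuity_2d_pt (fun x y => h (g x y)) x y.
Proof.
intros Hh Hg x y; apply continuity_1d_2d_pt_comp; [| apply Hg].
apply continuity_pt_filterlim, Hh.
Qed.

Lemma cont_of_2d (f : R -> R -> R) (x : R) :
  (forall t, continuity_2d_pt f x t) -> cont (f x).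
Proof.
intros H t.
apply (continuous_comp_2 (fun _ => x) (fun t => t) f).
- apply continuous_const.
- apply continuous_id.
- apply continuity_2d_pt_filterlim, H.
Qed.

Lemma is_derive_RInt_upper (f f' : R -> R -> R) (v v' : R -> R) :
  (forall x t, is_derive (fun x => f x t) x (f' x t)) ->
  (forall x t, continuity_2d_pt f' x t) -> (forall x, cont (f x)) ->
  (forall x, is_derive v x (v' x)) ->
  forall x, is_derive (fun x => RInt (f x) 0 (v x)) x
    (RInt (f' x) 0 (v x) + f x (v x) * v' x).
Proof.
intros Hd Hc Hf Hv x.
assert (ED : forall u t, Derive (fun z => f z t) u = f' u t)
  by (intros u t; apply is_derive_unique, Hd).
assert (Hc' : forall x t, continuity_2d_pt (fun u v => Derive (fun z => f z v) u) x t).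
{ intros x0 t; apply continuity_2d_pt_ext with (f := f'); [intros; now rewrite ED | apply Hc]. }
assert (E : RInt (f' x) 0 (v x) + f x (v x) * v' x =
  RInt (fun t => Derive (fun u => f u t) x) 0 (v x) + - f x 0 * 0 + f x (v x) * v' x).
{ rewrite (RInt_ext (fun t => Derive (fun u => f u t) x) (f' x)) by (intros; apply ED); ring. }
rewrite E.
apply (is_derive_RInt_param_bound_comp f (fun _ => 0) v x 0 (v' x)).
- apply filter_forall; intros y; now apply cont_ex_RInt.
- exists (mkposreal 1 Rlt_0_1); apply filter_forall; intros y; now apply cont_ex_RInt.
- exists (mkposreal 1 Rlt_0_1); apply filter_forall; intros y; now apply cont_ex_RInt.
- apply (is_derive_const (K := R_AbsRing) (V := R_NormedModule) 0 x).
- apply Hv.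
- exists (mkposreal 1 Rlt_0_1); apply filter_forall; intros y t _; eexists; apply Hd.
- intros t _; apply Hc'.
- exists (mkposreal 1 Rlt_0_1); intros; apply Hc'.
- exists (mkposreal 1 Rlt_0_1); intros; apply Hc'.
- apply continuity_pt_filterlim, Hf.
- apply continuity_pt_filterlim, Hf.
Qed.

Lemma is_derive_RInt_fixed (f f' : R -> R -> R) (b : R) :
  (forall x t, is_derive (fun x => f x t) x (f' x t)) ->
  (forall x t, continuity_2d_pt f' x t) -> (forall x, cont (f x)) ->
  forall x, is_derive (fun x => RInt (f x) 0 b) x (RInt (f' x) 0 b).
Proof.
intros Hd Hc Hf x.
replace (RInt (f' x) 0 b) with (RInt (f' x) 0 b + f x b * 0) by ring.
apply (is_derive_RInt_upper f f' (fun _ => b) (fun _ => 0) Hd Hc Hf).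
intros y; apply (is_derive_const (K := R_AbsRing) (V := R_NormedModule) b y).
Qed.

(** * The holomorphic integrand exp (p e^w + q e^-w - nu w) *)

Definition argRe (p q nu u v : R) : R :=
  p * exp u * cos v + q * exp (- u) * cos v - nu * u.
Definition argIm (p q nu u v : R) : R :=
  p * exp u * sin v - q * exp (- u) * sin v - nu * v.

(** Real and imaginary part at [w = u + i v]. *)
Definition FRe (p q nu u v : R) : R := exp (argRe p q nu u v) * cos (argIm p q nu u v).
Definition FIm (p q nu u v : R) : R := exp (argRe p q nu u v) * sin (argIm p q nu u v).

(** The imaginary part of the primitive of [F] that is real on the real axis.
    Only this imaginary part is ever needed, and integrating it vertically
    from the real axis makes it a proper real integral. *)
Definition Psi (p q nu u v : R) : R := RInt (FRe p q nu u) 0 v.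

(** The derivative of the real part in [u]; by the Cauchy-Riemann equations it
    is also that of the imaginary part in [v]. *)
Definition dFRe (p q nu u v : R) : R :=
  exp (argRe p q nu u v) *
  ((p * exp u * cos v - q * exp (- u) * cos v - nu) * cos (argIm p q nu u v)
   - (p * exp u * sin v + q * exp (- u) * sin v) * sin (argIm p q nu u v)).

Lemma is_derive_FRe_u (p q nu u v : R) :
  is_derive (fun u => FRe p q nu u v) u (dFRe p q nu u v).
Proof.
unfold FRe, dFRe, argRe, argIm; auto_derive; [exact I | unfold Rminus; ring].
Qed.

Lemma is_derive_FIm_v (p q nu u v : R) :
  is_derive (fun v => FIm p q nu u v) v (dFRe p q nu u v).
Proof.
unfold FIm, dFRe, argRe, argIm; auto_derive; [exact I | unfold Rminus; ring].
Qed.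

Ltac solve_c2d :=
  intros; repeat first
  [ assumption
  | apply continuity_2d_pt_const | apply continuity_2d_pt_id1 | apply continuity_2d_pt_id2
  | apply continuity_2d_pt_plus | apply continuity_2d_pt_minus
  | apply continuity_2d_pt_mult | apply continuity_2d_pt_opp
  | apply (continuity_2d_comp exp); [exact cont_exp | intros]
  | apply (continuity_2d_comp cos); [exact cont_cos | intros]
  | apply (continuity_2d_comp sin); [exact cont_sin | intros] ].

Lemma cont_FRe (p q nu u : R) : cont (FRe p q nu u).
Proof. apply (cont_of_2d (FRe p q nu) u); unfold FRe, argRe, argIm; solve_c2d. Qed.

Lemma cont_dFRe (p q nu u : R) : cont (dFRe p q nu u).
Proof. apply (cont_of_2d (dFRe p q nu) u); unfold dFRe, argRe, argIm; solve_c2d. Qed.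

Lemma FIm_axis (p q nu u : R) : FIm p q nu u 0 = 0.
Proof.
unfold FIm, argIm; rewrite sin_0.
replace (p * exp u * 0 - q * exp (- u) * 0 - nu * 0) with 0 by ring.
rewrite sin_0; ring.
Qed.

Lemma RInt_dFRe (p q nu u v : R) : RInt (dFRe p q nu u) 0 v = FIm p q nu u v.
Proof.
apply is_RInt_unique.
replace (FIm p q nu u v) with (minus (FIm p q nu u v) (FIm p q nu u 0))
  by (rewrite FIm_axis; unfold minus, plus, opp; simpl; ring).
apply (is_RInt_derive (FIm p q nu u)); intros x _;
  [apply is_derive_FIm_v | apply cont_dFRe].
Qed.

(** Cauchy's theorem, in the form that the integral of [F dw] along a path only
    depends on its end points: [Psi] has differential [Im (F dw)]. *)
Lemma is_derive_Psi_path (p q nu : R) (u v u' v' : R -> R) :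
  (forall r, is_derive u r (u' r)) -> (forall r, is_derive v r (v' r)) -> cont u' ->
  forall r, is_derive (fun r => Psi p q nu (u r) (v r)) r
    (u' r * FIm p q nu (u r) (v r) + FRe p q nu (u r) (v r) * v' r).
Proof.
intros Hu Hv Cu' r.
assert (Cu : cont u) by now apply cont_derive with u'.
assert (E : u' r * FIm p q nu (u r) (v r)
  = RInt (fun t => u' r * dFRe p q nu (u r) t) 0 (v r)).
{ rewrite <- RInt_dFRe; symmetry; apply is_RInt_unique.
  apply (is_RInt_scal (V := R_NormedModule) (dFRe p q nu (u r)) 0 (v r) (u' r)).
  apply (RInt_correct (V := R_CompleteNormedModule)), cont_ex_RInt, cont_dFRe. }
rewrite E.
apply (is_derive_RInt_upper (fun r => FRe p q nu (u r))
  (fun r t => u' r * dFRe p q nu (u r) t) v v').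
- intros x t.
  apply (is_derive_comp (fun u => FRe p q nu u t) u x (dFRe p q nu (u x) t) (u' x)).
  + apply is_derive_FRe_u.
  + apply Hu.
- unfold dFRe, argRe, argIm; intros x t.
  assert (U : forall x y, continuity_2d_pt (fun x _ : R => u x) x y)
    by (intros; apply (continuity_2d_comp u (fun x _ => x) Cu); intros;
        apply continuity_2d_pt_id1).
  assert (U' : forall x y, continuity_2d_pt (fun x _ : R => u' x) x y)
    by (intros; apply (continuity_2d_comp u' (fun x _ => x) Cu'); intros;
        apply continuity_2d_pt_id1).
  solve_c2d; first [apply U | apply U'].
- intros x; apply cont_FRe.
- exact Hv.
Qed.

Lemma RInt_path (p q nu : R) (u v u' v' : R -> R) (b : R) :
  (forall r, is_derive u r (u' r)) -> (forall r, is_derive v r (v' r)) ->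
  cont u' -> cont v' ->
  RInt (fun r => u' r * FIm p q nu (u r) (v r) + FRe p q nu (u r) (v r) * v' r) 0 b
  = Psi p q nu (u b) (v b) - Psi p q nu (u 0) (v 0).
Proof.
intros Hu Hv Cu' Cv'.
assert (Cu : cont u) by now apply cont_derive with u'.
assert (Cv : cont v) by now apply cont_derive with v'.
apply is_RInt_unique.
apply (is_RInt_derive (fun r => Psi p q nu (u r) (v r))
  (fun r => u' r * FIm p q nu (u r) (v r) + FRe p q nu (u r) (v r) * v' r)).
- intros x _; now apply is_derive_Psi_path.
- intros x _; revert x.
  match goal with |- forall x, continuous ?f x => change (cont f) end.
  unfold FIm, FRe, argRe, argIm; solve_cont.
Qed.

Lemma Psi_axis (p q nu u : R) : Psi p q nu u 0 = 0.
Proof. unfold Psi; now rewrite RInt_point. Qed.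

(** A derivative in [q] multiplies [F] by [e^-w], which shifts [nu] by one; a
    derivative in [p] shifts it the other way. *)
Lemma is_derive_Psi_q (p q nu u v : R) :
  is_derive (fun q => Psi p q nu u v) q (Psi p q (nu + 1) u v).
Proof.
apply (is_derive_RInt_fixed (fun q => FRe p q nu u) (fun q => FRe p q (nu + 1) u)).
- intros x t; unfold FRe at 1, argRe at 1, argIm at 1; auto_derive; [exact I |].
  unfold FRe.
  replace (argRe p x (nu + 1) u t)
    with ((p * exp u * cos t + x * exp (- u) * cos t - nu * u) + - u) by (unfold argRe; ring).
  replace (argIm p x (nu + 1) u t)
    with ((p * exp u * sin t - x * exp (- u) * sin t - nu * t) - t) by (unfold argIm; ring).
  rewrite (exp_plus _ (- u)), cos_minus; unfold argIm, argRe, Rminus; ring.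
- unfold FRe, argRe, argIm; solve_c2d.
- intros x; apply cont_FRe.
Qed.

Lemma is_derive_Psi_p (p q nu u v : R) :
  is_derive (fun p => Psi p q nu u v) p (Psi p q (nu - 1) u v).
Proof.
apply (is_derive_RInt_fixed (fun p => FRe p q nu u) (fun p => FRe p q (nu - 1) u)).
- intros x t; unfold FRe at 1, argRe at 1, argIm at 1; auto_derive; [exact I |].
  unfold FRe.
  replace (argRe x q (nu - 1) u t)
    with ((x * exp u * cos t + q * exp (- u) * cos t - nu * u) + u) by (unfold argRe; ring).
  replace (argIm x q (nu - 1) u t)
    with ((x * exp u * sin t - q * exp (- u) * sin t - nu * t) + t) by (unfold argIm; ring).
  rewrite (exp_plus _ u), (cos_plus _ t); unfold argIm, argRe, Rminus; ring.
- unfold FRe, argRe, argIm; solve_c2d.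
- intros x; apply cont_FRe.
Qed.

(** * Euler's integral *)

Definition gamma_integrand (x t : R) : R := Rpower t (x - 1) * exp (- t).

Lemma gamma_integrand_cont (x t : R) : 0 < t -> continuous (gamma_integrand x) t.
Proof.
intros Ht; apply (ex_derive_continuous (gamma_integrand x) t).
unfold gamma_integrand, Rpower; auto_derive; exact Ht.
Qed.

Lemma gamma_integrand_bound (x t : R) : 1 <= x -> 0 < t ->
  0 <= gamma_integrand x t <= exp ((x - 1) * ln (2 * x)) * exp (- (1 / 2) * t).
Proof.
intros Hx Ht; unfold gamma_integrand, Rpower; rewrite <- !exp_plus.
split; [apply Rlt_le, exp_pos |].
apply exp_le_compat.
assert (H : ln t <= t / (2 * x) + ln (2 * x)).
{ replace t with (t / (2 * x) * (2 * x)) at 1 by (field; lra).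
  assert (0 < t / (2 * x)) by (apply Rdiv_lt_0_compat; lra).
  rewrite ln_mult by lra.
  apply Rplus_le_compat_r.
  generalize (exp_ineq1_le (ln (t / (2 * x)))); rewrite exp_ln by assumption; lra. }
assert (H2 : (x - 1) * (t / (2 * x)) <= t / 2).
{ replace (t / 2) with (x * (t / (2 * x))) by (field; lra).
  apply Rmult_le_compat_r; [apply Rlt_le, Rdiv_lt_0_compat |]; lra. }
apply (Rmult_le_compat_l (x - 1)) in H; [| lra].
rewrite Rmult_plus_distr_l in H; lra.
Qed.

Lemma ex_RInt_pos (f : R -> R) (a b : R) : (forall t, 0 < t -> continuous f t) ->
  0 < a -> 0 < b -> ex_RInt f a b.
Proof.
intros Hf Ha Hb; apply (ex_RInt_continuous (V := R_CompleteNormedModule)).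
intros z Hz; apply Hf.
eapply Rlt_le_trans; [| apply Hz]; now apply Rmin_pos.
Qed.

Lemma RInt_exp_bound_pos (f : R -> R) (M a b : R) :
  (forall t, 0 < t -> continuous f t) -> 0 <= M ->
  (forall t, 0 < t -> Rabs (f t) <= M * exp (- (1 / 2) * t)) ->
  0 < a <= b -> Rabs (RInt f a b) <= M * (b - a) /\
  Rabs (RInt f a b) <= 2 * M * exp (- (1 / 2) * a).
Proof.
intros Hf HM Hb Hab; split.
- rewrite Rmult_comm; apply abs_RInt_le_const; [lra | apply ex_RInt_pos; auto; lra |].
  intros t Ht; eapply Rle_trans; [apply Hb; lra |].
  rewrite <- (Rmult_1_r M) at 2; apply Rmult_le_compat_l; [exact HM |].
  apply exp_le_1; lra.
- apply Rle_trans with (RInt (fun t => Rabs (f t)) a b).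
  { apply abs_RInt_le; [lra | apply ex_RInt_pos; auto; lra]. }
  apply Rle_trans with (RInt (fun t => M * exp (- (1 / 2) * t)) a b).
  + apply RInt_le; [lra | | |].
    * apply ex_RInt_pos; [| lra | lra].
      intros t Ht; apply (continuous_comp f Rabs); [now apply Hf | apply continuous_Rabs].
    * apply cont_ex_RInt; solve_cont.
    * intros t Ht; apply Hb; lra.
  + rewrite RInt_exp_neg by lra.
    generalize (exp_pos (- (1 / 2) * b)); intros.
    replace (M / (1 / 2)) with (2 * M) by field.
    nra.
Qed.

(** The pieces near [0] and near infinity are small separately, so the
    integrals over [[a, b]] form a Cauchy family. *)
Lemma Gamma_correct (x : R) : 1 <= x ->
  is_RInt_gen (gamma_integrand x) (at_right 0) (Rbar_locally p_infty) (Gamma x).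
Proof.
intros Hx.
apply (RInt_gen_correct (V := R_CompleteNormedModule) (gamma_integrand x)).
set (M := exp ((x - 1) * ln (2 * x))).
assert (HM : 0 < M) by apply exp_pos.
assert (Hc := gamma_integrand_cont x).
assert (Hb : forall t, 0 < t -> Rabs (gamma_integrand x t) <= M * exp (- (1 / 2) * t)).
{ intros t Ht; generalize (gamma_integrand_bound x t Hx Ht); fold M; intros H.
  rewrite Rabs_pos_eq; lra. }
destruct (proj1 (filterlim_locally_cauchy (U := R_CompleteSpace)
   (F := filter_prod (at_right 0) (Rbar_locally p_infty))
   (fun ab => RInt (gamma_integrand x) (fst ab) (snd ab)))) as [l Hlim].
- intros eps.
  destruct (exp_neg_small (1 / 2) (eps / (8 * M))) as [B [HB0 HB]];
    [lra | apply Rdiv_lt_0_compat; [apply cond_pos | lra] |].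
  assert (Hd : 0 < Rmin 1 (eps / (4 * M))).
  { apply Rmin_pos; [lra | apply Rdiv_lt_0_compat; [apply cond_pos | lra]]. }
  set (d := Rmin 1 (eps / (4 * M))) in *.
  exists (fun ab => 0 < fst ab < d /\ Rmax 1 B < snd ab); split.
  { apply (Filter_prod _ _ _ (fun a => 0 < a < d) (fun b => Rmax 1 B < b)).
    - exists (mkposreal d Hd); intros a Ha Ha0.
      change (Rabs (a - 0) < d) in Ha; rewrite Rminus_0_r, Rabs_pos_eq in Ha; lra.
    - now exists (Rmax 1 B).
    - intros a b Ha Hb'; now split. }
  assert (Hd1 : d <= 1) by apply Rmin_l.
  assert (Hd2 : M * d <= eps / 4).
  { apply Rle_trans with (M * (eps / (4 * M))).
    - apply Rmult_le_compat_l; [lra | apply Rmin_r].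
    - right; field; lra. }
  assert (A1 : forall a a', 0 < a < d -> 0 < a' < d -> Rabs (RInt (gamma_integrand x) a a') <= eps / 4).
  { assert (aux : forall a a', 0 < a <= a' -> a' < d -> Rabs (RInt (gamma_integrand x) a a') <= eps / 4).
    { intros a a' Ha Ha'.
      destruct (RInt_exp_bound_pos (gamma_integrand x) M a a' Hc) as [H _]; [lra | exact Hb | lra | nra]. }
    intros a a' Ha Ha'; destruct (Rle_lt_dec a a') as [H | H];
      [| rewrite RInt_abs_swap by (apply ex_RInt_pos; auto; lra)]; apply aux; lra. }
  assert (A2 : forall b b', Rmax 1 B < b -> Rmax 1 B < b' ->
     Rabs (RInt (gamma_integrand x) b b') < eps / 4).
  { assert (H1 := Rmax_l 1 B). assert (H2 := Rmax_r 1 B).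
    assert (aux : forall b b', Rmax 1 B < b -> b <= b' -> Rabs (RInt (gamma_integrand x) b b') < eps / 4).
    { intros b b' Hbb Hb'.
      destruct (RInt_exp_bound_pos (gamma_integrand x) M b b' Hc) as [_ H]; [lra | exact Hb | lra |].
      eapply Rle_lt_trans; [exact H |].
      specialize (HB b (Rle_lt_trans _ _ _ H2 Hbb)).
      apply (Rmult_lt_compat_l (2 * M)) in HB; [| lra].
      replace (2 * M * (eps / (8 * M))) with (eps / 4) in HB by (field; lra); lra. }
    intros b b' Hb1 Hb2; destruct (Rle_lt_dec b b') as [H | H];
      [| rewrite RInt_abs_swap by (apply ex_RInt_pos; auto; lra)]; apply aux; lra. }
  intros [a b] [a' b'] [Ha Hbb] [Ha' Hbb']; simpl in *.
  generalize (Rmax_l 1 B); intros H1.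
  change (Rabs (RInt (gamma_integrand x) a' b' - RInt (gamma_integrand x) a b) < eps).
  assert (E : RInt (gamma_integrand x) a' b' - RInt (gamma_integrand x) a b
     = (RInt (gamma_integrand x) b b' :> R) - (RInt (gamma_integrand x) a a' :> R)).
  { assert (E1 := RInt_Chasles (V := R_CompleteNormedModule) (gamma_integrand x) a a' b'
      ltac:(apply ex_RInt_pos; auto; lra) ltac:(apply ex_RInt_pos; auto; lra)).
    assert (E2 := RInt_Chasles (V := R_CompleteNormedModule) (gamma_integrand x) a b b'
      ltac:(apply ex_RInt_pos; auto; lra) ltac:(apply ex_RInt_pos; auto; lra)).
    unfold plus in E1, E2; simpl in E1, E2; lra. }
  rewrite E.
  eapply Rle_lt_trans; [apply Rabs_triang |]; rewrite Rabs_Ropp.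
  specialize (A1 a a' Ha Ha'); specialize (A2 b b' Hbb Hbb').
  generalize (cond_pos eps); lra.
- exists l; intros P HP.
  specialize (Hlim P HP); unfold filtermap in Hlim.
  unfold filtermapi.
  assert (Hpos : filter_prod (at_right 0) (Rbar_locally p_infty)
      (fun ab : R * R => 0 < fst ab /\ 0 < snd ab)).
  { apply (Filter_prod _ _ _ (fun a => 0 < a) (fun b => 0 < b)).
    - now exists (mkposreal 1 Rlt_0_1).
    - now exists 0.
    - intros; now split. }
  generalize (filter_and _ _ Hpos Hlim); apply filter_imp.
  intros [a b] [[Ha Hbb] H]; simpl in *.
  exists (RInt (gamma_integrand x) a b); split; [| exact H].
  apply (RInt_correct (V := R_CompleteNormedModule)), ex_RInt_pos; auto.
Qed.

Lemma Gamma_unique (x l : R) :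
  is_RInt_gen (gamma_integrand x) (at_right 0) (Rbar_locally p_infty) l -> Gamma x = l.
Proof. intros H; apply (is_RInt_gen_unique (V := R_CompleteNormedModule) (gamma_integrand x) l H). Qed.

Lemma prod_pos : filter_prod (at_right 0) (Rbar_locally p_infty)
  (fun ab : R * R => 0 < fst ab < 1 /\ 1 < snd ab).
Proof.
apply (Filter_prod _ _ _ (fun a => 0 < a < 1) (fun b => 1 < b)).
- exists (mkposreal 1 Rlt_0_1); intros a Ha Ha0.
  change (Rabs (a - 0) < 1) in Ha; rewrite Rminus_0_r, Rabs_pos_eq in Ha; lra.
- now exists 1.
- intros; now split.
Qed.

Lemma is_RInt_gen_antiderivative (F f : R -> R) (la lb : R) :
  (forall t, 0 < t -> is_derive F t (f t)) -> (forall t, 0 < t -> continuous f t) ->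
  filterlim F (at_right 0) (locally la) -> is_lim F p_infty lb ->
  is_RInt_gen f (at_right 0) (Rbar_locally p_infty) (lb - la).
Proof.
intros Hd Hc La Lb.
assert (ED : forall t, 0 < t -> Derive F t = f t)
  by (intros; now apply is_derive_unique, Hd).
assert (Hin : forall a b t, 0 < a < 1 -> 1 < b -> Rmin a b <= t <= Rmax a b -> 0 < t).
{ intros a b t Ha Hb; rewrite Rmin_left by lra; lra. }
apply (is_RInt_gen_ext (V := R_NormedModule) (Derive F) f).
- generalize prod_pos; apply filter_imp; intros [a b] [Ha Hb] t Ht; simpl in *.
  apply ED, (Hin a b); auto; lra.
- apply is_RInt_gen_Derive.
  + generalize prod_pos; apply filter_imp; intros [a b] [Ha Hb] t Ht; simpl in *.
    exists (f t); apply Hd, (Hin a b); auto.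
  + generalize prod_pos; apply filter_imp; intros [a b] [Ha Hb] t Ht; simpl in *.
    assert (Ht0 : 0 < t) by (apply (Hin a b); auto).
    apply (continuous_ext_loc (Derive F) f t); [| now apply Hc].
    exists (mkposreal t Ht0); intros s Hs; symmetry; apply ED.
    change (Rabs (s - t) < t) in Hs; apply Rabs_lt_between in Hs; lra.
  + exact La.
  + exact Lb.
Qed.

Lemma Rpower_bound_01 (x t : R) : 1 <= x -> 0 < t <= 1 -> 0 <= Rpower t x <= t.
Proof.
intros Hx Ht; split; [apply Rlt_le, exp_pos |].
rewrite <- (exp_ln t) at 2 by lra.
apply exp_le_compat.
assert (ln t <= 0) by (rewrite <- ln_1; destruct (proj2 Ht) as [H | ->];
  [left; apply ln_increasing; lra | lra]).
nra.
Qed.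

(** Integration by parts. *)
Lemma Gamma_succ (x : R) : 1 <= x -> Gamma (x + 1) = x * Gamma x.
Proof.
intros Hx.
assert (H1 := Gamma_correct x Hx).
assert (H2 : 1 <= x + 1) by lra. apply Gamma_correct in H2.
assert (H3 : is_RInt_gen (fun t => minus (gamma_integrand (x + 1) t) (scal x (gamma_integrand x t)))
   (at_right 0) (Rbar_locally p_infty) (minus (Gamma (x + 1)) (scal x (Gamma x)))).
{ apply (is_RInt_gen_minus (V := R_NormedModule)); [exact H2 |].
  now apply (is_RInt_gen_scal (V := R_NormedModule)). }
assert (H4 : is_RInt_gen (fun t => minus (gamma_integrand (x + 1) t) (scal x (gamma_integrand x t)))
   (at_right 0) (Rbar_locally p_infty) (0 - 0)).
{ apply is_RInt_gen_antiderivative with (F := fun t => - (Rpower t x * exp (- t))).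
  - intros t Ht; unfold Rpower; auto_derive; [exact Ht |].
    unfold gamma_integrand, Rpower, minus, plus, opp, scal; simpl; unfold mult; simpl.
    replace (x + 1 - 1) with x by ring.
    replace (exp (x * ln t)) with (exp ((x - 1) * ln t) * t).
    + field; lra.
    + rewrite <- (exp_ln t) at 2 by exact Ht; rewrite <- exp_plus; f_equal; ring.
  - intros t Ht.
    apply (continuous_minus (K := R_AbsRing) (V := R_NormedModule)); [now apply gamma_integrand_cont |].
    apply (continuous_scal_r (K := R_AbsRing) (V := R_NormedModule)); now apply gamma_integrand_cont.
  - intros P [e HP].
    exists (mkposreal _ (Rmin_pos 1 e Rlt_0_1 (cond_pos e))); intros t Ht Ht0.
    change (Rabs (t - 0) < Rmin 1 e) in Ht.
    rewrite Rminus_0_r, Rabs_pos_eq in Ht by lra.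
    apply HP; change (Rabs (- (Rpower t x * exp (- t)) - 0) < e).
    rewrite Rminus_0_r, Rabs_Ropp.
    assert (Ht1 : 0 < t <= 1) by (split; [exact Ht0 |];
      left; eapply Rlt_le_trans; [exact Ht | apply Rmin_l]).
    generalize (Rpower_bound_01 x t Hx Ht1); intros H.
    assert (exp (- t) <= 1) by (apply exp_le_1; lra).
    generalize (exp_pos (- t)); intros Hp.
    rewrite Rabs_pos_eq by nra.
    apply Rle_lt_trans with t; [nra |].
    eapply Rlt_le_trans; [exact Ht | apply Rmin_r].
  - set (M := exp ((x + 1 - 1) * ln (2 * (x + 1)))).
    apply (is_lim_le_le_loc (fun t => - (M * exp (- (1 / 2) * t))) (fun _ => 0)).
    + exists 0; intros t Ht.
      generalize (gamma_integrand_bound (x + 1) t ltac:(lra) Ht); unfold gamma_integrand; fold M.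
      replace (x + 1 - 1) with x by ring; lra.
    + replace (Finite 0) with (Rbar_opp 0) by (simpl; f_equal; ring).
      apply is_lim_opp, is_lim_exp_neg; lra.
    + apply is_lim_const. }
assert (E := is_RInt_gen_unique (V := R_CompleteNormedModule) _ _ H3).
rewrite (is_RInt_gen_unique (V := R_CompleteNormedModule) _ _ H4) in E.
unfold minus, plus, opp, scal in E; simpl in E; unfold mult in E; simpl in E; lra.
Qed.

Lemma Gamma_1 : Gamma 1 = 1.
Proof.
apply Gamma_unique.
replace 1 with (0 - (- 1)) at 2 by ring.
apply is_RInt_gen_antiderivative with (F := fun t => - exp (- t)).
- intros t Ht; auto_derive; [exact I |].
  unfold gamma_integrand; rewrite Rminus_diag, Rpower_O by exact Ht; ring.
- intros t Ht; now apply gamma_integrand_cont.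
- apply (filterlim_filter_le_1 (F := locally 0)).
  { apply filter_le_within. }
  replace (-1) with (- exp (- 0)) by (rewrite Ropp_0, exp_0; ring).
  assert (H : cont (fun t => - exp (- t))) by solve_cont.
  apply H.
- replace (Finite 0) with (Rbar_opp 0) by (simpl; f_equal; ring).
  apply is_lim_opp.
  apply is_lim_ext with (f := fun t => 1 * exp (- (1) * t)).
  + intros t; rewrite Rmult_1_l; f_equal; ring.
  + apply is_lim_exp_neg; lra.
Qed.

Lemma Gamma_fact (n : nat) : Gamma (INR n + 1) = INR (fact n).
Proof.
induction n as [| n IH]; [simpl; rewrite Rplus_0_l; apply Gamma_1 |].
rewrite S_INR, Gamma_succ, IH by (generalize (pos_INR n); lra).
rewrite fact_simpl, mult_INR, S_INR; ring.
Qed.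

Lemma exp_convex (s l : R) : 0 <= s <= 1 -> exp (s * l) <= 1 - s + s * exp l.
Proof.
intros Hs.
assert (H1 := exp_ineq1_le (l - s * l)). assert (H2 := exp_ineq1_le (- (s * l))).
assert (H : 1 <= s * exp (l - s * l) + (1 - s) * exp (- (s * l))) by nra.
apply (Rmult_le_compat_r (exp (s * l))) in H; [| apply Rlt_le, exp_pos].
rewrite Rmult_1_l, Rmult_plus_distr_r, !Rmult_assoc, <- !exp_plus in H.
replace (l - s * l + s * l) with l in H by ring.
replace (- (s * l) + s * l) with 0 in H by ring.
rewrite exp_0 in H; lra.
Qed.

(** The weighted inequality between arithmetic and geometric means,
    [t^s <= 1 - s + s t] after rescaling by [c], integrated against the
    Gamma density. *)
Lemma Gamma_interp (x s c : R) : 1 <= x -> 0 <= s <= 1 -> 0 < c ->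
  Gamma (x + s) <= Rpower c s * ((1 - s) * Gamma x + s / c * Gamma (x + 1)).
Proof.
intros Hx Hs Hc.
assert (H1 := Gamma_correct x Hx).
assert (H2 := Gamma_correct (x + 1) ltac:(lra)).
assert (H3 := Gamma_correct (x + s) ltac:(lra)).
set (g := fun t => plus (scal (Rpower c s * (1 - s)) (gamma_integrand x t))
   (scal (Rpower c s * (s / c)) (gamma_integrand (x + 1) t))).
assert (Hg : is_RInt_gen g (at_right 0) (Rbar_locally p_infty)
   (plus (scal (Rpower c s * (1 - s)) (Gamma x))
   (scal (Rpower c s * (s / c)) (Gamma (x + 1))))).
{ apply (is_RInt_gen_plus (V := R_NormedModule));
    now apply (is_RInt_gen_scal (V := R_NormedModule)). }
assert (HN : norm (Gamma (x + s)) <= plus (scal (Rpower c s * (1 - s)) (Gamma x))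
   (scal (Rpower c s * (s / c)) (Gamma (x + 1)))).
{ refine (@RInt_gen_norm R_CompleteNormedModule (at_right 0) (Rbar_locally p_infty)
    _ _ (gamma_integrand (x + s)) g _ _ _ _ H3 Hg).
  - generalize prod_pos; apply filter_imp; intros [a b] [Ha Hb]; simpl in *; lra.
  - generalize prod_pos; apply filter_imp; intros [a b] [Ha Hb] t Ht; simpl in *.
    assert (Ht0 : 0 < t) by lra.
    change (Rabs (gamma_integrand (x + s) t) <= g t).
    rewrite Rabs_pos_eq by (apply gamma_integrand_bound; lra).
    unfold g, gamma_integrand, plus, scal; simpl; unfold mult; simpl.
    assert (E1 : Rpower t (x + s - 1) = Rpower t (x - 1) * Rpower c s * exp (s * ln (t / c))).
    { unfold Rpower; rewrite <- !exp_plus, ln_div by assumption; f_equal; ring. }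
    assert (E2 : Rpower t (x + 1 - 1) = Rpower t (x - 1) * t).
    { rewrite <- (Rpower_1 t) at 3 by exact Ht0; rewrite <- Rpower_plus; f_equal; ring. }
    rewrite E1, E2.
    assert (H := exp_convex s (ln (t / c)) Hs).
    rewrite exp_ln in H by (now apply Rdiv_lt_0_compat).
    replace (Rpower c s * (1 - s) * (Rpower t (x - 1) * exp (- t)) +
       Rpower c s * (s / c) * (Rpower t (x - 1) * t * exp (- t)))
      with (Rpower t (x - 1) * Rpower c s * (1 - s + s * (t / c)) * exp (- t))
      by (field; lra).
    apply Rmult_le_compat_r; [apply Rlt_le, exp_pos |].
    apply Rmult_le_compat_l; [| exact H].
    apply Rmult_le_pos; apply Rlt_le, exp_pos. }
change (Rabs (Gamma (x + s)) <= Rpower c s * (1 - s) * Gamma x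
   + Rpower c s * (s / c) * Gamma (x + 1)) in HN.
generalize (Rle_abs (Gamma (x + s))); lra.
Qed.

(** Interpolating between [n + 1] and [n + 2] gives the upper bound; the lower
    one interpolates between [n + 1 + nu] and [n + 2 + nu] to reach [n + 2]. *)
Lemma Gamma_ratio (nu : R) (n : nat) : 0 <= nu <= 1 -> (1 <= n)%nat ->
  (INR n + 1) / (INR n + 2) * (INR (fact n) * Rpower (INR n) nu)
    <= Gamma (INR n + nu + 1)
    <= (1 + / INR n) * (INR (fact n) * Rpower (INR n) nu).
Proof.
intros Hnu Hn.
assert (Hn1 : 1 <= INR n) by (change 1 with (INR 1); now apply le_INR).
assert (Hf : 0 < INR (fact n)) by apply INR_fact_lt_0.
assert (EF : Gamma (INR n + 1 + 1) = (INR n + 1) * INR (fact n))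
  by (rewrite Gamma_succ, Gamma_fact by lra; reflexivity).
split.
- set (m := INR n + nu + 1).
  assert (H := Gamma_interp m (1 - nu) m ltac:(unfold m; lra) ltac:(lra) ltac:(unfold m; lra)).
  rewrite (Gamma_succ m) in H by (unfold m; lra).
  replace (m + (1 - nu)) with (INR n + 1 + 1) in H by (unfold m; ring).
  rewrite EF in H.
  replace ((1 - (1 - nu)) * Gamma m + (1 - nu) / m * (m * Gamma m)) with (Gamma m) in H
    by (field; unfold m; lra).
  assert (P1 : Rpower (INR n) nu <= Rpower (INR n + 2) nu) by (apply Rle_Rpower_l; lra).
  assert (P2 : Rpower m (1 - nu) <= Rpower (INR n + 2) (1 - nu))
    by (apply Rle_Rpower_l; unfold m; lra).
  assert (P3 : Rpower (INR n + 2) nu * Rpower (INR n + 2) (1 - nu) = INR n + 2).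
  { rewrite <- Rpower_plus; replace (nu + (1 - nu)) with 1 by ring; apply Rpower_1; lra. }
  assert (Q1 : 0 < Rpower (INR n) nu) by apply exp_pos.
  assert (Q2 : 0 < Rpower m (1 - nu)) by apply exp_pos.
  assert (P4 : Rpower (INR n) nu * Rpower m (1 - nu) <= INR n + 2).
  { rewrite <- P3; apply Rmult_le_compat; lra. }
  apply (Rmult_le_reg_l (Rpower m (1 - nu) * (INR n + 2))); [nra |].
  apply Rle_trans with (((INR n + 1) * INR (fact n)) * (Rpower (INR n) nu * Rpower m (1 - nu))).
  + right; field; lra.
  + apply Rle_trans with (((INR n + 1) * INR (fact n)) * (INR n + 2)).
    * apply Rmult_le_compat_l; [nra | exact P4].
    * nra.
- replace (INR n + nu + 1) with ((INR n + 1) + nu) by ring.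
  eapply Rle_trans; [apply (Gamma_interp (INR n + 1) nu (INR n)); lra |].
  rewrite EF, Gamma_fact.
  replace (Rpower (INR n) nu * ((1 - nu) * INR (fact n) + nu / INR n * ((INR n + 1) * INR (fact n))))
    with ((1 + nu * / INR n) * (INR (fact n) * Rpower (INR n) nu)) by (field; lra).
  apply Rmult_le_compat_r; [apply Rmult_le_pos; [lra | apply Rlt_le, exp_pos] |].
  apply Rplus_le_compat_l.
  assert (0 < / INR n) by (apply Rinv_0_lt_compat; lra); nra.
Qed.

(** * Hankel's formula for the reciprocal of Gamma *)

Definition loop_side (p q nu t : R) : R := exp (- p * exp t - q * exp (- t) - nu * t).

(** The limit of [Psi] along the line [Im w = PI]: half the imaginary part of the
    integral of [F] over a loop from [oo - i PI] to [oo + i PI]. *)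
Definition Loop (p q nu : R) : R :=
  Psi p q nu 0 PI - sin (nu * PI) * half_line_int (loop_side p q nu).

Lemma loop_side_cont (p q nu : R) : cont (loop_side p q nu).
Proof. unfold loop_side; solve_cont. Qed.

Lemma loop_side_bound (p q nu t : R) : 0 < p -> 0 <= nu -> 0 <= t ->
  Rabs (loop_side p q nu t) <= exp (Rabs q - p) * exp (- p * t).
Proof.
intros Hp Hnu Ht; unfold loop_side.
rewrite Rabs_pos_eq by (apply Rlt_le, exp_pos).
rewrite <- exp_plus; apply exp_le_compat.
assert (H1 := exp_ineq1_le t).
assert (H2 : - q * exp (- t) <= Rabs q).
{ assert (exp (- t) <= 1) by (apply exp_le_1; lra).
  generalize (exp_pos (- t)) (Rle_abs (- q)) (Rabs_pos q); rewrite Rabs_Ropp; intros; nra. }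
assert (0 <= nu * t) by (now apply Rmult_le_pos); nra.
Qed.

Lemma argRe_PI (p q nu t : R) : argRe p q nu t PI = - p * exp t - q * exp (- t) - nu * t.
Proof. unfold argRe; rewrite cos_PI; ring. Qed.

Lemma FIm_PI (p q nu t : R) : FIm p q nu t PI = - sin (nu * PI) * loop_side p q nu t.
Proof.
unfold FIm, loop_side; rewrite argRe_PI; unfold argIm; rewrite sin_PI.
replace (p * exp t * 0 - q * exp (- t) * 0 - nu * PI) with (- (nu * PI)) by ring.
rewrite sin_neg; ring.
Qed.

Lemma Psi_PI (p q nu u : R) :
  Psi p q nu u PI = Psi p q nu 0 PI - sin (nu * PI) * RInt (loop_side p q nu) 0 u.
Proof.
assert (H := RInt_path p q nu (fun r => r) (fun _ => PI) (fun _ => 1) (fun _ => 0) u).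
assert (E : RInt (fun r => 1 * FIm p q nu r PI + FRe p q nu r PI * 0) 0 u
  = - sin (nu * PI) * RInt (loop_side p q nu) 0 u).
{ rewrite (RInt_ext _ (fun r => scal (- sin (nu * PI)) (loop_side p q nu r))).
  - apply (RInt_scal (V := R_CompleteNormedModule)), cont_ex_RInt, loop_side_cont.
  - intros r _; rewrite FIm_PI; unfold scal; simpl; unfold mult; simpl; ring. }
enough (- sin (nu * PI) * RInt (loop_side p q nu) 0 u
  = Psi p q nu u PI - Psi p q nu 0 PI) by lra.
rewrite <- E; apply H; try apply cont_const.
- intros r; apply (is_derive_id (K := R_AbsRing)).
- intros r; apply (is_derive_const (K := R_AbsRing) (V := R_NormedModule)).
Qed.

Lemma Loop_lim (p q nu : R) : 0 < p -> 0 <= nu ->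
  is_lim (fun u => Psi p q nu u PI) p_infty (Loop p q nu).
Proof.
intros Hp Hnu.
apply is_lim_ext with
  (f := fun u => Psi p q nu 0 PI - sin (nu * PI) * RInt (loop_side p q nu) 0 u).
{ intros u; symmetry; apply Psi_PI. }
unfold Loop; apply is_lim_minus'; [apply is_lim_const |].
apply (is_lim_scal_l (fun u => RInt (loop_side p q nu) 0 u) _ p_infty (half_line_int (loop_side p q nu))).
apply half_line_int_correct with (exp (Rabs q - p)) p; [exact Hp | apply loop_side_cont |].
intros u Hu; now apply loop_side_bound.
Qed.

(** The horizontal translation [w -> w + ln a]. *)
Lemma Loop_scaling (a nu : R) : 0 < a -> 0 <= nu ->
  Loop a 0 nu = Rpower a nu * Loop 1 0 nu.
Proof.
intros Ha Hnu.
assert (E : forall u, Psi a 0 nu u PI = Rpower a nu * Psi 1 0 nu (u + ln a) PI).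
{ intros u; unfold Psi.
  rewrite <- (RInt_scal (V := R_CompleteNormedModule) (FRe 1 0 nu (u + ln a)) 0 PI)
    by (apply cont_ex_RInt, cont_FRe).
  apply RInt_ext; intros v _.
  unfold scal; simpl; unfold mult; simpl.
  unfold FRe, argRe, argIm, Rpower.
  replace (exp (u + ln a)) with (exp u * a) by (rewrite exp_plus, exp_ln; auto).
  rewrite <- Rmult_assoc, <- exp_plus.
  f_equal; f_equal; ring. }
assert (H1 := Loop_lim a 0 nu Ha Hnu).
assert (H2 := Loop_lim 1 0 nu Rlt_0_1 Hnu).
assert (H3 : is_lim (fun u => Rpower a nu * Psi 1 0 nu (u + ln a) PI) p_infty
   (Rpower a nu * Loop 1 0 nu)).
{ apply (is_lim_scal_l (fun u => Psi 1 0 nu (u + ln a) PI) _ p_infty (Loop 1 0 nu)).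
  apply (is_lim_comp (fun u => Psi 1 0 nu u PI) (fun u => u + ln a) p_infty _ p_infty).
  - exact H2.
  - apply (is_lim_plus (fun u => u) (fun _ => ln a) p_infty p_infty (ln a) p_infty);
      [apply is_lim_id | apply is_lim_const | reflexivity].
  - exists 0; discriminate. }
apply is_lim_unique in H1.
rewrite <- (Lim_ext (fun u => Psi a 0 nu u PI) _ p_infty E), (is_lim_unique _ _ _ H3) in H1.
now injection H1.
Qed.

(** Integration by parts, from [d (e^(p e^w - nu w)) = (p e^w - nu) e^(p e^w - nu w) dw]. *)
Lemma Psi_parts (p nu u v : R) :
  p * Psi p 0 (nu - 1) u v - nu * Psi p 0 nu u v = FIm p 0 nu u v.
Proof.
rewrite <- RInt_dFRe.
unfold Psi; symmetry; apply is_RInt_unique.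
apply (is_RInt_ext (fun v => minus (scal p (FRe p 0 (nu - 1) u v)) (scal nu (FRe p 0 nu u v)))).
- intros t _; unfold minus, plus, opp, scal; simpl; unfold mult; simpl.
  unfold dFRe, FRe.
  replace (argRe p 0 (nu - 1) u t) with (argRe p 0 nu u t + u) by (unfold argRe; ring).
  replace (argIm p 0 (nu - 1) u t) with (argIm p 0 nu u t + t) by (unfold argIm; ring).
  rewrite exp_plus, cos_plus; ring.
- apply (is_RInt_minus (V := R_NormedModule)); apply (is_RInt_scal (V := R_NormedModule));
    apply (RInt_correct (V := R_CompleteNormedModule)), cont_ex_RInt, cont_FRe.
Qed.

Lemma Loop_rec (nu : R) : 0 <= nu -> Loop 1 0 nu = (nu + 1) * Loop 1 0 (nu + 1).
Proof.
intros Hnu.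
assert (H1 := Loop_lim 1 0 nu Rlt_0_1 Hnu).
assert (H2 := Loop_lim 1 0 (nu + 1) Rlt_0_1 ltac:(lra)).
assert (H3 : is_lim (fun u => FIm 1 0 (nu + 1) u PI) p_infty 0).
{ apply is_lim_squeeze0 with (g := fun u => exp (Rabs 0 - 1) * exp (- (1) * u)).
  - intros u Hu; rewrite FIm_PI, Rabs_mult, Rabs_Ropp.
    apply Rle_trans with (1 * Rabs (loop_side 1 0 (nu + 1) u)).
    + apply Rmult_le_compat_r; [apply Rabs_pos | apply Rabs_le, SIN_bound].
    + rewrite Rmult_1_l; apply loop_side_bound; lra.
  - apply is_lim_exp_neg; lra. }
assert (H4 : is_lim (fun u => Psi 1 0 nu u PI - (nu + 1) * Psi 1 0 (nu + 1) u PI) p_infty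
   (Loop 1 0 nu - (nu + 1) * Loop 1 0 (nu + 1))).
{ apply is_lim_minus'; [exact H1 |].
  apply (is_lim_scal_l (fun u => Psi 1 0 (nu + 1) u PI) _ p_infty _ H2). }
apply is_lim_ext with (g := fun u => FIm 1 0 (nu + 1) u PI) in H4.
- apply is_lim_unique in H3; apply is_lim_unique in H4; rewrite H3 in H4.
  injection H4; lra.
- intros u; rewrite <- Psi_parts; replace (nu + 1 - 1) with nu by ring; ring.
Qed.

(** For [nu = 0] the two horizontal sides cancel and there remains the mean of
    [e^z] over the circle of radius [p], constant in [p] and equal to [1] at the
    centre. *)
Lemma Loop_zero : Loop 1 0 0 = PI.
Proof.
assert (E0 : Psi 0 0 0 0 PI = PI).
{ unfold Psi; rewrite (RInt_ext _ (fun _ => 1)).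
  - rewrite RInt_const; change ((PI - 0) * 1 = PI :> R); ring.
  - intros v _; unfold FRe, argRe, argIm.
    replace (0 * exp 0 * cos v + 0 * exp (- 0) * cos v - 0 * 0) with 0 by ring.
    replace (0 * exp 0 * sin v - 0 * exp (- 0) * sin v - 0 * v) with 0 by ring.
    rewrite exp_0, cos_0; exact (Rmult_1_r 1). }
destruct (MVT_cor2 (fun p => Psi p 0 0 0 PI) (fun p => Psi p 0 (0 - 1) 0 PI) 0 1 Rlt_0_1)
  as [c [Hc [Hc0 Hc1]]].
{ intros c _; apply is_derive_Reals, is_derive_Psi_p. }
assert (H := Psi_parts c 0 0 PI).
rewrite FIm_PI, !Rmult_0_l, sin_0, Ropp_0, Rmult_0_l, Rminus_0_r in H.
assert (Psi c 0 (0 - 1) 0 PI = 0) as E1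
  by (apply Rmult_integral in H; destruct H; [lra | assumption]).
unfold Loop; rewrite Rmult_0_l, sin_0; rewrite E1, E0 in Hc; lra.
Qed.

Lemma Loop_fact (n : nat) : Loop 1 0 (INR n) = PI / INR (fact n).
Proof.
induction n as [| n IH]; [simpl; rewrite Loop_zero; field |].
rewrite Loop_rec, <- S_INR in IH by apply pos_INR.
assert (H := INR_fact_lt_0 n).
assert (H2 : 0 < INR (S n)) by (apply lt_0_INR; lia).
rewrite fact_simpl, mult_INR.
apply (Rmult_eq_reg_l (INR (S n))); [| lra].
rewrite IH; field; lra.
Qed.

Lemma one_minus_cos_ge (t : R) : 0 <= t <= PI -> t ^ 2 / 18 <= 1 - cos t.
Proof.
intros Ht.
assert (H4 := PI_4).
replace t with (2 * (t / 2)) at 2 by field.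
rewrite cos_2a_sin.
assert (H := x_minus_sin (t / 2) ltac:(lra)).
assert (H1 : t / 6 <= sin (t / 2)).
{ enough ((t / 2) ^ 3 / 6 <= t / 3) by lra.
  assert ((t / 2) ^ 2 <= 4) by nra.
  replace ((t / 2) ^ 3 / 6) with ((t / 2) * (t / 2) ^ 2 / 6) by field; nra. }
nra.
Qed.

Lemma cos_lip (a b : R) : Rabs (cos a - cos b) <= Rabs (a - b).
Proof.
rewrite form2, !Rabs_mult.
assert (H1 := sin_abs_le ((a - b) / 2)).
assert (H2 : Rabs (sin ((a + b) / 2)) <= 1) by (apply Rabs_le, SIN_bound).
assert (H3 := Rabs_pos (sin ((a - b) / 2))). assert (H4 := Rabs_pos (sin ((a + b) / 2))).
rewrite Rabs_div, (Rabs_pos_eq 2) in H1 by lra.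
replace (Rabs (-2)) with 2 by (rewrite Rabs_left; lra).
nra.
Qed.

(** Laplace's method at the saddle point [w = 0] of [n (e^w - w)]: replacing [n]
    by [n + nu] changes the integrand by a factor [1 + O(w)], hence the integral
    by [O(e^n / n)] only, while the integral itself has size [e^n / sqrt n]. *)
Lemma Loop_laplace (n : nat) (nu : R) : (1 <= n)%nat -> 0 <= nu <= 1 ->
  Rabs (Loop (INR n) 0 (INR n + nu) - Loop (INR n) 0 (INR n)) <= 11 * exp (INR n) / INR n.
Proof.
intros Hn Hnu.
set (N := INR n).
assert (HN : 1 <= N) by (change 1 with (INR 1); now apply le_INR).
assert (Hpi := PI_RGT_0).
assert (T : forall m, 0 <= m -> Rabs (sin (m * PI) * half_line_int (loop_side N 0 m)) <= / N).
{ intros m Hm; rewrite Rabs_mult.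
  assert (H1 : Rabs (sin (m * PI)) <= 1) by (apply Rabs_le, SIN_bound).
  assert (H2 : Rabs (half_line_int (loop_side N 0 m)) <= exp (Rabs 0 - N) / N).
  { apply half_line_int_bound; [lra | apply loop_side_cont |].
    intros u Hu; apply loop_side_bound; lra. }
  assert (H3 : exp (Rabs 0 - N) <= 1) by (apply exp_le_1; rewrite Rabs_R0; lra).
  assert (H4 : exp (Rabs 0 - N) / N <= / N).
  { rewrite <- (Rmult_1_l (/ N)); apply Rmult_le_compat_r; [| exact H3].
    apply Rlt_le, Rinv_0_lt_compat; lra. }
  assert (H5 := Rabs_pos (sin (m * PI))). assert (H6 := Rabs_pos (half_line_int (loop_side N 0 m))).
  nra. }
assert (Cg : cont (fun t => exp N * (t * exp (- (N / 18) * (t * t))))) by solve_cont.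
assert (V : Rabs (Psi N 0 (N + nu) 0 PI - Psi N 0 N 0 PI) <= 9 * exp N / N).
{ assert (E : Psi N 0 (N + nu) 0 PI - Psi N 0 N 0 PI
    = RInt (fun t => FRe N 0 (N + nu) 0 t - FRe N 0 N 0 t) 0 PI).
  { symmetry; unfold Psi.
    apply (RInt_minus (V := R_CompleteNormedModule)); apply cont_ex_RInt, cont_FRe. }
  rewrite E.
  eapply Rle_trans.
  - apply (abs_RInt_le_RInt _ (fun t => exp N * (t * exp (- (N / 18) * (t * t))))).
    + apply cont_minus; apply cont_FRe.
    + exact Cg.
    + lra.
    + intros t Ht; unfold FRe.
      replace (argRe N 0 (N + nu) 0 t) with (argRe N 0 N 0 t) by (unfold argRe; ring).
      rewrite <- Rmult_minus_distr_l, Rabs_mult, Rabs_pos_eq by (apply Rlt_le, exp_pos).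
      replace (exp N * (t * exp (- (N / 18) * (t * t))))
        with (exp (N + - (N / 18) * (t * t)) * t) by (rewrite exp_plus; ring).
      apply Rmult_le_compat; [apply Rlt_le, exp_pos | apply Rabs_pos | |].
      * apply exp_le_compat; unfold argRe; rewrite exp_0.
        assert (H := one_minus_cos_ge t Ht); nra.
      * eapply Rle_trans; [apply cos_lip |].
        replace (argIm N 0 (N + nu) 0 t - argIm N 0 N 0 t) with (- (nu * t))
          by (unfold argIm; ring).
        rewrite Rabs_Ropp, Rabs_pos_eq by nra; nra.
  - assert (Hi : is_RInt (fun t => exp N * (t * exp (- (N / 18) * (t * t)))) 0 PI
      (minus (- (9 * exp N / N) * exp (- (N / 18) * (PI * PI)))
         (- (9 * exp N / N) * exp (- (N / 18) * (0 * 0))))).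
    { apply (is_RInt_derive (fun t => - (9 * exp N / N) * exp (- (N / 18) * (t * t)))).
      - intros x _; auto_derive; [exact I | field; lra].
      - intros x _; apply Cg. }
    rewrite (is_RInt_unique _ _ _ _ Hi).
    unfold minus, plus, opp; simpl; rewrite Rmult_0_r, Rmult_0_r, exp_0.
    assert (0 <= 9 * exp N / N) by (apply Rdiv_le_0_compat; [generalize (exp_pos N) |]; lra).
    assert (H1 := exp_pos (- (N / 18) * (PI * PI))); nra. }
assert (T1 := T (N + nu) ltac:(lra)). assert (T2 := T N ltac:(lra)).
assert (H1 : / N <= exp N / N).
{ rewrite <- (Rmult_1_l (/ N)); apply Rmult_le_compat_r;
    [apply Rlt_le, Rinv_0_lt_compat; lra |].
  generalize (exp_ineq1_le N); lra. }
unfold Loop.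
replace (Psi N 0 (N + nu) 0 PI - sin ((N + nu) * PI) * half_line_int (loop_side N 0 (N + nu)) -
   (Psi N 0 N 0 PI - sin (N * PI) * half_line_int (loop_side N 0 N)))
  with ((Psi N 0 (N + nu) 0 PI - Psi N 0 N 0 PI)
    + (- (sin ((N + nu) * PI) * half_line_int (loop_side N 0 (N + nu))) + sin (N * PI) * half_line_int (loop_side N 0 N)))
  by ring.
eapply Rle_trans; [apply Rabs_triang |].
eapply Rle_trans; [apply Rplus_le_compat_l, Rabs_triang |].
rewrite Rabs_Ropp.
replace (11 * exp N / N) with (9 * exp N / N + (exp N / N + exp N / N)) by (field; lra).
lra.
Qed.

Lemma ln_succ_ratio (x : R) : 0 <= x -> 2 * x <= (2 + x) * ln (1 + x).
Proof.
intros Hx.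
enough (0 <= (2 + x) * ln (1 + x) - 2 * x) by lra.
apply (nonneg_of_derive (fun x => (2 + x) * ln (1 + x) - 2 * x)
  (fun x => ln (1 + x) + (2 + x) / (1 + x) - 2) x); [| | | lra].
- rewrite !Rplus_0_r, ln_1; lra.
- intros t Ht; auto_derive; [lra | field; lra].
- intros t Ht.
  apply (nonneg_of_derive (fun x => ln (1 + x) + (2 + x) / (1 + x) - 2)
    (fun x => x / (1 + x) ^ 2) t); [| | | lra].
  + rewrite !Rplus_0_r, ln_1; lra.
  + intros s Hs; auto_derive; [lra | field; lra].
  + intros s Hs; apply Rdiv_le_0_compat; [lra | apply pow_lt; lra].
Qed.

(** The half of Stirling's formula that bounds [n^n / n!] from below. *)
Lemma fact_upper (n : nat) : (1 <= n)%nat ->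
  INR (fact n) * exp (INR n) <= exp 1 * sqrt (INR n) * INR n ^ n.
Proof.
intros Hn; induction Hn as [| n Hn IH].
- simpl; rewrite sqrt_1; lra.
- set (N := INR n) in *.
  assert (HN : 1 <= N) by (change 1 with (INR 1); now apply le_INR).
  rewrite fact_simpl, mult_INR, S_INR; fold N.
  rewrite exp_plus.
  assert (Hs : 0 < sqrt N) by (apply sqrt_lt_R0; lra).
  assert (Hs' : 0 < sqrt (N + 1)) by (apply sqrt_lt_R0; lra).
  assert (Hp : 0 < N ^ n) by (apply pow_lt; lra).
  assert (He := exp_pos 1).
  (* one step amounts to (1 + 1/n)^(n+1/2) >= e *)
  assert (Key : exp 1 * sqrt N * N ^ n <= sqrt (N + 1) * (N + 1) ^ n).
  { assert (HL : 1 <= (N + / 2) * ln (1 + / N)).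
    { assert (H := ln_succ_ratio (/ N) ltac:(apply Rlt_le, Rinv_0_lt_compat; lra)).
      apply (Rmult_le_reg_l (2 * / N)); [apply Rmult_lt_0_compat; [lra |];
        apply Rinv_0_lt_compat; lra |].
      replace (2 * / N * ((N + / 2) * ln (1 + / N))) with ((2 + / N) * ln (1 + / N))
        by (field; lra); lra. }
    assert (EL : ln (1 + / N) = ln (N + 1) - ln N).
    { rewrite <- ln_div by lra; f_equal; field; lra. }
    rewrite EL in HL.
    rewrite <- !Rpower_sqrt, <- !Rpower_pow by lra.
    unfold Rpower; rewrite <- !exp_plus; apply exp_le_compat; fold N; lra. }
  apply Rle_trans with ((N + 1) * exp 1 * (INR (fact n) * exp N)); [right; ring |].
  apply Rle_trans with ((N + 1) * exp 1 * (exp 1 * sqrt N * N ^ n)).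
  + apply Rmult_le_compat_l; [nra | exact IH].
  + apply Rle_trans with ((N + 1) * exp 1 * (sqrt (N + 1) * (N + 1) ^ n)).
    * apply Rmult_le_compat_l; [nra | exact Key].
    * simpl; right; ring.
Qed.

Lemma Loop_asym (n : nat) (nu : R) : (1 <= n)%nat -> 0 <= nu <= 1 ->
  Rabs (INR (fact n) * Rpower (INR n) nu * Loop 1 0 (INR n + nu) - PI)
    <= 11 * exp 1 / sqrt (INR n).
Proof.
intros Hn Hnu.
assert (H := Loop_laplace n nu Hn Hnu).
assert (HU := fact_upper n Hn).
set (N := INR n) in *.
assert (HN : 1 <= N) by (change 1 with (INR 1); now apply le_INR).
rewrite (Loop_scaling N (N + nu)), (Loop_scaling N N) in H by lra.
assert (EL : Loop 1 0 N = PI / INR (fact n)) by apply Loop_fact.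
rewrite EL in H.
assert (Hf : 0 < INR (fact n)) by apply INR_fact_lt_0.
assert (EP : Rpower N N = N ^ n) by (apply Rpower_pow; lra).
rewrite Rpower_plus, EP in H.
assert (Hp : 0 < N ^ n) by (apply pow_lt; lra).
assert (Hs : 0 < sqrt N) by (apply sqrt_lt_R0; lra).
assert (Es : sqrt N * sqrt N = N) by (apply sqrt_sqrt; lra).
apply (Rmult_le_reg_l (N ^ n / INR (fact n))); [now apply Rdiv_lt_0_compat |].
rewrite <- (Rabs_pos_eq (N ^ n / INR (fact n))) at 1 by (apply Rlt_le, Rdiv_lt_0_compat; lra).
rewrite <- Rabs_mult.
replace (N ^ n / INR (fact n) * (INR (fact n) * Rpower N nu * Loop 1 0 (N + nu) - PI))
  with (N ^ n * Rpower N nu * Loop 1 0 (N + nu) - N ^ n * (PI / INR (fact n)))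
  by (field; lra).
eapply Rle_trans; [exact H |].
apply (Rmult_le_reg_l (INR (fact n) * N)); [nra |].
replace (INR (fact n) * N * (11 * exp N / N)) with (11 * (INR (fact n) * exp N)) by (field; lra).
replace (INR (fact n) * N * (N ^ n / INR (fact n) * (11 * exp 1 / sqrt N)))
  with (11 * (exp 1 * sqrt N * N ^ n)).
- lra.
- rewrite <- Es at 3; field; lra.
Qed.

Lemma Gamma_Loop_periodic (nu : R) (n : nat) : 0 <= nu ->
  Gamma (INR n + nu + 1) * Loop 1 0 (INR n + nu) = Gamma (nu + 1) * Loop 1 0 nu.
Proof.
intros Hnu; induction n as [| n IH]; [simpl; now rewrite Rplus_0_l |].
assert (Hn := pos_INR n).
rewrite <- IH, S_INR.
replace (INR n + 1 + nu + 1) with ((INR n + nu + 1) + 1) by ring.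
replace (INR n + 1 + nu) with ((INR n + nu) + 1) by ring.
rewrite Gamma_succ, (Loop_rec (INR n + nu)) by lra; ring.
Qed.

Lemma is_lim_seq_inv_sqrt (k : R) : is_lim_seq (fun n => k / sqrt (INR n)) 0.
Proof.
replace (Finite 0) with (Rbar_mult k 0) by (simpl; f_equal; ring).
apply is_lim_seq_scal_l.
replace (Finite 0) with (Rbar_inv p_infty) by reflexivity.
apply is_lim_seq_inv; [| discriminate].
apply (is_lim_comp_seq sqrt INR p_infty p_infty).
- exact filterlim_sqrt_p.
- exists 0%nat; discriminate.
- apply is_lim_seq_INR.
Qed.

Lemma is_lim_seq_inv_INR (k : R) : is_lim_seq (fun n => / (INR n + k)) 0.
Proof.
replace (Finite 0) with (Rbar_inv p_infty) by reflexivity.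
apply is_lim_seq_inv; [| discriminate].
apply (is_lim_seq_plus INR (fun _ => k) p_infty k p_infty);
  [apply is_lim_seq_INR | apply is_lim_seq_const | reflexivity].
Qed.

(** Euler's and Hankel's integrals satisfy the same functional equation, so
    that their product is periodic; the asymptotics at infinity then identify
    the constant. *)
Lemma Gamma_Loop_01 (nu : R) : 0 <= nu <= 1 -> Gamma (nu + 1) * Loop 1 0 nu = PI.
Proof.
intros Hnu.
set (r := fun n => Gamma (INR n + nu + 1) / (INR (fact n) * Rpower (INR n) nu)).
set (s := fun n => INR (fact n) * Rpower (INR n) nu * Loop 1 0 (INR n + nu)).
assert (Lr : is_lim_seq r 1).
{ apply is_lim_seq_le_le_loc with (u := fun n => (INR n + 1) / (INR n + 2))
    (w := fun n => 1 + / INR n).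
  - exists 1%nat; intros n Hn.
    destruct (Gamma_ratio nu n Hnu Hn) as [H1 H2].
    assert (Hp : 0 < INR (fact n) * Rpower (INR n) nu)
      by (apply Rmult_lt_0_compat; [apply INR_fact_lt_0 | apply exp_pos]).
    unfold r; split; apply (Rmult_le_reg_r _ _ _ Hp).
    + unfold Rdiv at 2; rewrite (Rmult_assoc (Gamma _)), Rinv_l, Rmult_1_r by lra; exact H1.
    + unfold Rdiv; rewrite (Rmult_assoc (Gamma _)), Rinv_l, Rmult_1_r by lra; exact H2.
  - apply is_lim_seq_ext with (u := fun n => 1 - / (INR n + 2)).
    + intros n; generalize (pos_INR n); intros; field; lra.
    + replace (Finite 1) with (Finite (1 - 0)) by (f_equal; ring).
      apply is_lim_seq_minus'; [apply is_lim_seq_const | apply is_lim_seq_inv_INR].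
  - replace (Finite 1) with (Finite (1 + 0)) by (f_equal; ring).
    apply is_lim_seq_plus'; [apply is_lim_seq_const |].
    apply is_lim_seq_ext with (u := fun n => / (INR n + 0)); [intros; now rewrite Rplus_0_r |].
    apply is_lim_seq_inv_INR. }
assert (Ls : is_lim_seq s PI).
{ apply is_lim_seq_le_le_loc with (u := fun n => PI - 11 * exp 1 / sqrt (INR n))
    (w := fun n => PI + 11 * exp 1 / sqrt (INR n)).
  - exists 1%nat; intros n Hn.
    assert (H := Loop_asym n nu Hn Hnu); fold (s n) in H.
    apply Rabs_le_between in H; lra.
  - replace (Finite PI) with (Finite (PI - 0)) by (f_equal; ring).
    apply is_lim_seq_minus'; [apply is_lim_seq_const | apply is_lim_seq_inv_sqrt].
  - replace (Finite PI) with (Finite (PI + 0)) by (f_equal; ring).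
    apply is_lim_seq_plus'; [apply is_lim_seq_const | apply is_lim_seq_inv_sqrt]. }
assert (Lrs := is_lim_seq_mult' _ _ _ _ Lr Ls).
apply is_lim_seq_ext with (v := fun _ => Gamma (nu + 1) * Loop 1 0 nu) in Lrs.
- apply is_lim_seq_unique in Lrs; rewrite Lim_seq_const in Lrs.
  injection Lrs; lra.
- intros n; rewrite <- (Gamma_Loop_periodic nu n) by lra; unfold r, s.
  assert (INR (fact n) <> 0) by apply INR_fact_neq_0.
  assert (0 < Rpower (INR n) nu) by apply exp_pos.
  field; split; [lra | assumption].
Qed.

Lemma Hankel (a nu : R) : 0 < a -> 0 <= nu ->
  Loop a 0 nu = PI * (Rpower a nu / Gamma (nu + 1)).
Proof.
intros Ha Hnu.
destruct (nfloor_ex nu Hnu) as [n Hn].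
assert (H : Gamma (nu + 1) * Loop 1 0 nu = PI).
{ replace nu with (INR n + (nu - INR n)) by ring.
  rewrite Gamma_Loop_periodic by lra; apply Gamma_Loop_01; lra. }
assert (HG : Gamma (nu + 1) <> 0).
{ intros E; rewrite E in H; generalize PI_RGT_0; lra. }
rewrite Loop_scaling, <- H by assumption; field; exact HG.
Qed.

(** * The loop integral for the Bessel function *)

Lemma Derive_n_Psi_q (a nu u v : R) (n : nat) : forall s,
  ex_derive_n (fun s => Psi a (- s) nu u v) n s /\
  Derive_n (fun s => Psi a (- s) nu u v) n s = (-1) ^ n * Psi a (- s) (nu + INR n) u v.
Proof.
set (f := fun s => Psi a (- s) nu u v).
set (F := fun n s => (-1) ^ n * Psi a (- s) (nu + INR n) u v).
assert (HF : forall n s, is_derive (F n) s (F (S n) s)).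
{ intros m s; unfold F.
  replace ((-1) ^ S m * Psi a (- s) (nu + INR (S m)) u v)
    with ((-1) ^ m * ((- (1)) * Psi a (- s) ((nu + INR m) + 1) u v))
    by (rewrite S_INR, Rplus_assoc; simpl; ring).
  apply (is_derive_scal (fun s => Psi a (- s) (nu + INR m) u v)).
  apply (is_derive_comp (fun q => Psi a q (nu + INR m) u v) (fun s => - s)).
  - apply is_derive_Psi_q.
  - auto_derive; [exact I | ring]. }
induction n as [| n IH]; intros s.
- split; [exact I |]; simpl; rewrite Rplus_0_r, Rmult_1_l; reflexivity.
- assert (E : forall t, Derive_n f n t = F n t) by (intros t; apply IH).
  assert (D : is_derive (Derive_n f n) s (F (S n) s)).
  { apply is_derive_ext with (f := F n); [intros; symmetry; apply E | apply HF]. }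
  split; [now exists (F (S n) s) |].
  change (Derive (Derive_n f n) s = F (S n) s); now apply is_derive_unique.
Qed.

Lemma Psi_PI_bound (a q nu u : R) : 0 < a -> - a <= q <= 0 -> 0 <= nu -> 0 <= u ->
  Rabs (Psi a q nu u PI) <= PI * exp a + / a.
Proof.
intros Ha Hq Hnu Hu.
assert (Hpi := PI_RGT_0).
rewrite Psi_PI; unfold Rminus; eapply Rle_trans; [apply Rabs_triang |].
apply Rplus_le_compat.
- replace PI with (PI - 0) at 2 by ring.
  apply abs_RInt_le_const; [lra | apply cont_ex_RInt, cont_FRe |].
  intros t Ht; unfold FRe; rewrite Rabs_mult, Rabs_pos_eq by (apply Rlt_le, exp_pos).
  rewrite <- (Rmult_1_r (exp a)); apply Rmult_le_compat;
    [apply Rlt_le, exp_pos | apply Rabs_pos | | apply Rabs_le, COS_bound].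
  apply exp_le_compat; unfold argRe; rewrite Ropp_0, exp_0.
  generalize (COS_bound t); intros; nra.
- rewrite Rabs_Ropp, Rabs_mult.
  assert (H1 : Rabs (sin (nu * PI)) <= 1) by (apply Rabs_le, SIN_bound).
  assert (H2 : Rabs (RInt (loop_side a q nu) 0 u) <= exp (Rabs q - a) / a * exp (- a * 0)).
  { apply RInt_exp_bound; [exact Ha | apply loop_side_cont | | lra].
    intros t Ht; now apply loop_side_bound. }
  assert (H3 : exp (Rabs q - a) <= 1).
  { apply exp_le_1; rewrite Rabs_left1 by lra; lra. }
  rewrite Rmult_0_r, exp_0, Rmult_1_r in H2.
  assert (H4 : exp (Rabs q - a) / a <= / a).
  { rewrite <- (Rmult_1_l (/ a)); apply Rmult_le_compat_r; [| exact H3].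
    now apply Rlt_le, Rinv_0_lt_compat. }
  generalize (Rabs_pos (sin (nu * PI))) (Rabs_pos (RInt (loop_side a q nu) 0 u)); nra.
Qed.

Lemma is_lim_sum_f_R0 (f : nat -> R -> R) (l : nat -> R) (n : nat) :
  (forall k, is_lim (f k) p_infty (l k)) ->
  is_lim (fun u => sum_f_R0 (fun k => f k u) n) p_infty (sum_f_R0 l n).
Proof.
intros H; induction n as [| n IH]; simpl; [apply H |].
now apply is_lim_plus'.
Qed.

Lemma Loop_taylor (a mu : R) (n : nat) : 0 < a -> 0 <= mu ->
  Rabs (Loop a (- a) mu
    - sum_f_R0 (fun k => a ^ k / INR (fact k) * ((-1) ^ k * Loop a 0 (mu + INR k))) n)
  <= a ^ S n / INR (fact (S n)) * (PI * exp a + / a).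
Proof.
intros Ha Hmu.
apply is_lim_p_abs_le with (A := 0) (f := fun u => Psi a (- a) mu u PI
  - sum_f_R0 (fun k => a ^ k / INR (fact k) * ((-1) ^ k * Psi a 0 (mu + INR k) u PI)) n).
- apply is_lim_minus'; [now apply Loop_lim |].
  apply is_lim_sum_f_R0; intros k.
  apply (is_lim_scal_l (fun u => (-1) ^ k * Psi a 0 (mu + INR k) u PI) _ p_infty
    ((-1) ^ k * Loop a 0 (mu + INR k))).
  apply (is_lim_scal_l (fun u => Psi a 0 (mu + INR k) u PI) _ p_infty
    (Loop a 0 (mu + INR k))).
  apply Loop_lim; [exact Ha | generalize (pos_INR k); lra].
- intros u Hu.
  destruct (Taylor_Lagrange (fun s => Psi a (- s) mu u PI) n 0 a Ha) as [z [Hz E]].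
  { intros t _ k _; apply Derive_n_Psi_q. }
  rewrite E, (proj2 (Derive_n_Psi_q a mu u PI (S n) z)).
  rewrite !Rminus_0_r.
  rewrite (sum_eq (fun m => a ^ m / INR (fact m)
      * Derive_n (fun s => Psi a (- s) mu u PI) m 0)
    (fun k => a ^ k / INR (fact k) * ((-1) ^ k * Psi a 0 (mu + INR k) u PI))).
  + match goal with |- Rabs (?A + ?B - ?A) <= _ => replace (A + B - A) with B by ring end.
    rewrite !Rabs_mult, pow_1_abs, Rmult_1_l, Rabs_pos_eq
      by (apply Rdiv_le_0_compat; [apply pow_le; lra | apply INR_fact_lt_0]).
    apply Rmult_le_compat_l.
    * apply Rdiv_le_0_compat; [apply pow_le; lra | apply INR_fact_lt_0].
    * apply Psi_PI_bound; try lra; generalize (pos_INR (S n)); lra.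
  + intros k _; rewrite (proj2 (Derive_n_Psi_q a mu u PI k 0)), Ropp_0; reflexivity.
Qed.

(** Schlaefli's integral. Expanding [e^(- (y/2) e^-w)] is a Taylor expansion in the
    parameter [q], whose remainder is uniform along the loop; Hankel's formula
    evaluates each term, and the power series comes out. *)
Lemma BesselJ_Loop (mu y : R) : 0 < y -> 0 <= mu ->
  PI * BesselJ mu y = Loop (y / 2) (- (y / 2)) mu.
Proof.
intros Hy Hmu.
set (a := y / 2). assert (Ha : 0 < a) by (unfold a; lra).
assert (Hpi := PI_RGT_0).
enough (H : BesselJ mu y = / PI * Loop a (- a) mu) by (rewrite H; field; lra).
unfold BesselJ; apply is_series_unique.
assert (HC : 0 < PI * exp a + / a).
{ generalize (exp_pos a) (Rinv_0_lt_compat a Ha); intros; nra. }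
assert (Lim0 : is_lim_seq (fun n => a ^ S n / INR (fact (S n)) * (PI * exp a + / a)) 0).
{ replace (Finite 0) with (Rbar_mult 0 (PI * exp a + / a)) by (simpl; f_equal; ring).
  apply is_lim_seq_scal_r.
  apply (is_lim_seq_incr_1 (fun n => a ^ n / INR (fact n))).
  apply is_lim_seq_Reals, cv_speed_pow_fact. }
set (S := fun n => sum_f_R0
  (fun k => a ^ k / INR (fact k) * ((-1) ^ k * Loop a 0 (mu + INR k))) n).
assert (LS : is_lim_seq S (Loop a (- a) mu)).
{ set (r := fun n => a ^ Datatypes.S n / INR (fact (Datatypes.S n)) * (PI * exp a + / a)) in *.
  apply is_lim_seq_le_le with (u := fun n => Loop a (- a) mu - r n)
    (w := fun n => Loop a (- a) mu + r n).
  - intros n; assert (H := Loop_taylor a mu n Ha Hmu); fold (S n) (r n) in H.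
    apply Rabs_le_between in H; lra.
  - replace (Finite (Loop a (- a) mu)) with (Finite (Loop a (- a) mu - 0)) by (f_equal; ring).
    apply is_lim_seq_minus'; [apply is_lim_seq_const | exact Lim0].
  - replace (Finite (Loop a (- a) mu)) with (Finite (Loop a (- a) mu + 0)) by (f_equal; ring).
    apply is_lim_seq_plus'; [apply is_lim_seq_const | exact Lim0]. }
apply (is_lim_seq_scal_l S (/ PI)) in LS.
simpl in LS.
change (is_lim_seq (sum_n (fun k : nat =>
   (-1) ^ k / (INR (fact k) * Gamma (INR k + mu + 1)) * Rpower a (2 * INR k + mu)))
   (/ PI * Loop a (- a) mu)).
eapply is_lim_seq_ext; [| exact LS].
intros n; unfold S; rewrite sum_n_Reals, scal_sum.
apply sum_eq; intros k _.
rewrite (Hankel a (mu + INR k)) by (generalize (pos_INR k); lra).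
replace (2 * INR k + mu) with (INR k + (mu + INR k)) by ring.
rewrite (Rpower_plus (INR k)), Rpower_pow by exact Ha.
replace (mu + INR k + 1) with (INR k + mu + 1) by ring.
assert (INR (fact k) <> 0) by apply INR_fact_neq_0.
unfold Rdiv; rewrite Rinv_mult.
generalize (/ Gamma (INR k + mu + 1)); intros g.
field; split; [assumption | lra].
Qed.

(** * Hyperbolic functions and the Gudermannian *)

Lemma cosh_pos (x : R) : 0 < cosh x.
Proof. unfold cosh; generalize (exp_pos x) (exp_pos (- x)); lra. Qed.

Lemma cosh_sqr (x : R) : cosh x * cosh x = 1 + sinh x * sinh x.
Proof.
unfold cosh, sinh.
assert (E : exp x * exp (- x) = 1) by (rewrite <- exp_plus, Rplus_opp_r; apply exp_0).
nra.
Qed.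

Lemma cosh_ge_1 (x : R) : 1 <= cosh x.
Proof. generalize (cosh_pos x) (cosh_sqr x); intros; nra. Qed.

Lemma is_derive_sinh (x : R) : is_derive sinh x (cosh x).
Proof. apply is_derive_Reals, derivable_pt_lim_sinh. Qed.

Lemma is_derive_cosh (x : R) : is_derive cosh x (sinh x).
Proof. apply is_derive_Reals, derivable_pt_lim_cosh. Qed.

Lemma cont_sinh : cont sinh.
Proof. apply (cont_derive _ _ is_derive_sinh). Qed.

Lemma cont_cosh : cont cosh.
Proof. apply (cont_derive _ _ is_derive_cosh). Qed.

Lemma sinh_at_0 : sinh 0 = 0.
Proof. unfold sinh; rewrite Ropp_0; field. Qed.

Lemma sinh_plus (a b : R) : sinh (a + b) = sinh a * cosh b + cosh a * sinh b.
Proof. unfold sinh, cosh; rewrite Ropp_plus_distr, !exp_plus; field. Qed.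

Lemma sinh_opp (a : R) : sinh (- a) = - sinh a.
Proof. unfold sinh; rewrite Ropp_involutive; field. Qed.

Lemma cosh_opp (a : R) : cosh (- a) = cosh a.
Proof. unfold cosh; rewrite Ropp_involutive; field. Qed.

Lemma sinh_ge (x : R) : 0 <= x -> x <= sinh x.
Proof.
intros Hx.
enough (0 <= sinh x - x) by lra.
apply (nonneg_of_derive (fun x => sinh x - x) (fun x => cosh x - 1) x); [| | | lra].
- rewrite sinh_at_0; lra.
- intros t _; auto_derive; [exact I | ring].
- intros t _; generalize (cosh_ge_1 t); lra.
Qed.

Lemma tanh_bounds (r : R) : 0 <= r -> 0 <= tanh r <= 1 /\ r / (1 + r) <= tanh r <= r.
Proof.
intros Hr.
assert (Hs := sinh_ge r Hr). assert (Hc := cosh_pos r).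
assert (H1 : sinh r < cosh r) by (unfold sinh, cosh; generalize (exp_pos (- r)); lra).
unfold tanh; repeat split.
- apply Rdiv_le_0_compat; lra.
- apply (Rmult_le_reg_r (cosh r) _ _ Hc); unfold Rdiv.
  rewrite Rmult_assoc, Rinv_l by lra; lra.
- apply (Rmult_le_reg_r (cosh r * (1 + r))); [nra |].
  replace (r / (1 + r) * (cosh r * (1 + r))) with (r * cosh r) by (field; lra).
  replace (sinh r / cosh r * (cosh r * (1 + r))) with (sinh r * (1 + r)) by (field; lra).
  (* r (cosh r - sinh r) = r exp (- r) <= sinh r *)
  assert (E : cosh r - sinh r = exp (- r)) by (unfold sinh, cosh; field).
  assert (exp (- r) <= 1) by (apply exp_le_1; lra); nra.
- enough (0 <= r * cosh r - sinh r).
  { apply (Rmult_le_reg_r (cosh r) _ _ Hc); unfold Rdiv.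
    rewrite Rmult_assoc, Rinv_l by lra; lra. }
  apply (nonneg_of_derive (fun x => x * cosh x - sinh x) (fun x => x * sinh x) r); [| | | lra].
  + rewrite sinh_at_0; lra.
  + intros t _; auto_derive; [exact I | ring].
  + intros t Ht; generalize (sinh_ge t (proj1 Ht)); intros; nra.
Qed.

(** The Gudermannian. The curve [r + i gd r] is the contour used to the right
    of a saddle point: along it [sinh w = tanh r + i sinh r] has a bounded real
    part, and [cosh w = 1 + i sinh r tanh r]. *)
Definition gd (r : R) : R := atan (sinh r).

Lemma sqrt_cosh (r : R) : sqrt (1 + (sinh r)²) = cosh r.
Proof.
unfold Rsqr; rewrite <- cosh_sqr; apply sqrt_square, Rlt_le, cosh_pos.
Qed.

Lemma cos_gd (r : R) : cos (gd r) = / cosh r.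
Proof. unfold gd; rewrite cos_atan, sqrt_cosh; unfold Rdiv; ring. Qed.

Lemma sin_gd (r : R) : sin (gd r) = tanh r.
Proof. unfold gd; rewrite sin_atan, sqrt_cosh; reflexivity. Qed.

Lemma is_derive_gd (r : R) : is_derive gd r (/ cosh r).
Proof.
assert (Hc := cosh_pos r).
replace (/ cosh r) with (cosh r * / (1 + sinh r ^ 2)).
- apply (is_derive_comp atan sinh); [apply is_derive_Reals, derivable_pt_lim_atan
    | apply is_derive_sinh].
- replace (sinh r ^ 2) with (sinh r * sinh r) by ring.
  rewrite <- cosh_sqr; field; lra.
Qed.

Lemma cont_inv_cosh : cont (fun r => / cosh r).
Proof.
intros r; apply (continuous_comp cosh Rinv); [apply cont_cosh |].
apply continuous_Rinv; generalize (cosh_pos r); lra.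
Qed.

Lemma gd_0 : gd 0 = 0.
Proof. unfold gd; rewrite sinh_at_0; apply atan_0. Qed.

Lemma gd_bounds (r : R) : 0 <= r -> 0 <= gd r <= r /\ gd r < PI / 2.
Proof.
intros Hr; repeat split.
- apply (nonneg_of_derive gd (fun r => / cosh r) r); [rewrite gd_0; lra | | | lra].
  + intros; apply is_derive_gd.
  + intros t _; apply Rlt_le, Rinv_0_lt_compat, cosh_pos.
- enough (0 <= r - gd r) by lra.
  apply (nonneg_of_derive (fun r => r - gd r) (fun r => 1 - / cosh r) r);
    [rewrite gd_0; lra | | | lra].
  + intros t _; apply (is_derive_minus (K := R_AbsRing) (V := R_NormedModule) (fun t => t) gd);
      [apply (is_derive_id (K := R_AbsRing)) | apply is_derive_gd].
  + intros t _; assert (/ cosh t <= / 1) by (apply Rinv_le_contravar; [lra | apply cosh_ge_1]).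
    rewrite Rinv_1 in H; lra.
- apply atan_bound.
Qed.

(** * From paths to improper integrals *)

Definition FC (p q nu u v : R) : C := (FRe p q nu u v, FIm p q nu u v).

Lemma FC_Cexp (p q nu u v : R) : FC p q nu u v = Cexp (argRe p q nu u v, argIm p q nu u v).
Proof.
unfold FC, FRe, FIm; apply injective_projections; unfold Cexp, Re, Im; simpl; ring.
Qed.

Lemma CInt_path (p q nu : R) (u v u' v' : R -> R) (M lam : R) :
  (forall r, is_derive u r (u' r)) -> (forall r, is_derive v r (v' r)) ->
  cont u' -> cont v' ->
  exp_small (fun r => (u' r, v' r) * FC p q nu (u r) (v r))%C M lam ->
  is_lim (fun b => Psi p q nu (u b) (v b)) p_infty
    (Psi p q nu (u 0) (v 0)
     + Im (CInt (fun r => (u' r, v' r) * FC p q nu (u r) (v r))%C)).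
Proof.
intros Hu Hv Cu Cv HG.
destruct (exp_small_lim _ _ _ HG) as [_ H].
assert (H2 := is_lim_plus' _ _ _ _ _ (is_lim_const (Psi p q nu (u 0) (v 0)) p_infty) H).
eapply is_lim_ext; [| exact H2].
intros b; simpl.
rewrite (RInt_ext _ (fun r => u' r * FIm p q nu (u r) (v r) + FRe p q nu (u r) (v r) * v' r)).
- rewrite RInt_path by assumption; ring.
- intros r _; unfold Im; simpl; ring.
Qed.

Lemma argRe_Bessel (y mu u v : R) : argRe (y / 2) (- (y / 2)) mu u v = y * sinh u * cos v - mu * u.
Proof. unfold argRe, sinh; field. Qed.

Lemma argIm_Bessel (y mu u v : R) : argIm (y / 2) (- (y / 2)) mu u v = y * cosh u * sin v - mu * v.
Proof. unfold argIm, cosh; field. Qed.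

(** Far to the right, moving up to the line [Im w = PI] only helps, the cosine
    being decreasing on [0, PI]. *)
Lemma Psi_right_end (y mu u v : R) : 0 < y -> 0 <= u -> 0 <= v <= PI ->
  Rabs (Psi (y / 2) (- (y / 2)) mu u v - Psi (y / 2) (- (y / 2)) mu u PI)
  <= PI * exp (argRe (y / 2) (- (y / 2)) mu u v).
Proof.
intros Hy Hu Hv.
set (p := y / 2). set (q := - p).
assert (E : Psi p q mu u v - Psi p q mu u PI = - RInt (FRe p q mu u) v PI).
{ unfold Psi; generalize (RInt_Chasles_cont (FRe p q mu u) 0 v PI (cont_FRe p q mu u)); lra. }
rewrite E, Rabs_Ropp.
apply Rle_trans with ((PI - v) * exp (argRe p q mu u v)).
- apply abs_RInt_le_const; [lra | apply cont_ex_RInt, cont_FRe |].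
  intros t Ht; unfold FRe; rewrite Rabs_mult, Rabs_pos_eq by (apply Rlt_le, exp_pos).
  rewrite <- (Rmult_1_r (exp (argRe p q mu u v))); apply Rmult_le_compat;
    [apply Rlt_le, exp_pos | apply Rabs_pos | | apply Rabs_le, COS_bound].
  apply exp_le_compat; unfold p, q; rewrite !argRe_Bessel.
  assert (cos t <= cos v) by (apply cos_decr_1; lra).
  assert (0 <= y * sinh u) by (apply Rmult_le_pos; [| apply Rle_trans with u; [| apply sinh_ge]]; lra).
  nra.
- apply Rmult_le_compat_r; [apply Rlt_le, exp_pos | lra].
Qed.

Lemma cos_le_abs (t v : R) : Rabs v <= PI -> Rabs t <= Rabs v -> cos v <= cos t.
Proof.
intros Hv Ht.
assert (E : forall x, cos (Rabs x) = cos x).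
{ intros x; unfold Rabs; destruct (Rcase_abs x); [apply cos_neg | reflexivity]. }
rewrite <- (E v), <- (E t).
apply cos_decr_1; auto; try apply Rabs_pos; lra.
Qed.

(** Far to the left the real axis is within reach, where [Psi] vanishes. *)
Lemma Psi_left_end (y mu u v : R) : 0 < y -> 0 <= u -> Rabs v <= PI ->
  Rabs (Psi (y / 2) (- (y / 2)) mu (- u) v)
  <= PI * exp (argRe (y / 2) (- (y / 2)) mu (- u) v).
Proof.
intros Hy Hu Hv.
set (p := y / 2). set (q := - p).
set (B := exp (argRe p q mu (- u) v)).
assert (HB : 0 < B) by apply exp_pos.
assert (Hb : forall t, Rabs t <= Rabs v -> Rabs (FRe p q mu (- u) t) <= B).
{ intros t Ht; unfold FRe; rewrite Rabs_mult, Rabs_pos_eq by (apply Rlt_le, exp_pos).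
  rewrite <- (Rmult_1_r B); apply Rmult_le_compat;
    [apply Rlt_le, exp_pos | apply Rabs_pos | | apply Rabs_le, COS_bound].
  apply exp_le_compat; unfold p, q; rewrite !argRe_Bessel, sinh_opp.
  assert (H := cos_le_abs t v Hv Ht).
  assert (0 <= y * sinh u) by (apply Rmult_le_pos; [| apply Rle_trans with u; [| apply sinh_ge]]; lra).
  nra. }
apply Rle_trans with (Rabs v * B); [| apply Rmult_le_compat_r; lra].
unfold Psi; destruct (Rle_lt_dec 0 v) as [H | H].
- rewrite (Rabs_pos_eq v H) in *.
  replace v with (v - 0) at 2 by ring.
  apply abs_RInt_le_const; [exact H | apply cont_ex_RInt, cont_FRe |].
  intros t Ht; apply Hb; rewrite Rabs_pos_eq; lra.
- rewrite RInt_abs_swap, (Rabs_left v H) in * by apply cont_ex_RInt, cont_FRe.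
  replace (- v) with (0 - v) by ring.
  apply abs_RInt_le_const; [lra | apply cont_ex_RInt, cont_FRe |].
  intros t Ht; apply Hb; rewrite Rabs_left1; lra.
Qed.

Lemma pow_le_exp (n : nat) : forall t, 0 <= t -> t ^ n <= INR (fact n) * exp t.
Proof.
induction n as [| n IH]; intros t Ht.
- simpl; generalize (exp_ineq1_le t); lra.
- enough (0 <= INR (fact (S n)) * exp t - t ^ S n) by lra.
  apply (nonneg_of_derive (fun t => INR (fact (S n)) * exp t - t ^ S n)
    (fun t => INR (S n) * (INR (fact n) * exp t - t ^ n)) t); [| | | lra].
  + rewrite exp_0; simpl pow; rewrite Rmult_0_l; generalize (INR_fact_lt_0 (S n)); lra.
  + intros x _.
    replace (INR (S n) * (INR (fact n) * exp x - x ^ n))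
      with (INR (fact (S n)) * exp x - INR (S n) * 1 * x ^ Nat.pred (S n))
      by (rewrite fact_simpl, mult_INR; simpl Nat.pred; ring).
    apply (is_derive_minus (K := R_AbsRing) (V := R_NormedModule)
      (fun t => INR (fact (S n)) * exp t) (fun t => t ^ S n)).
    * apply (is_derive_scal exp x _ (exp x)), is_derive_exp.
    * apply (is_derive_pow (fun t => t) (S n) x 1), (is_derive_id (K := R_AbsRing)).
  + intros x Hx; apply Rmult_le_pos; [apply pos_INR |]; specialize (IH x (proj1 Hx)); lra.
Qed.

Lemma pow_le_exp_scaled (n : nat) (eta t : R) : 0 < eta -> 0 <= t ->
  t ^ n <= INR (fact n) / eta ^ n * exp (eta * t).
Proof.
intros He Ht.
assert (H := pow_le_exp n (eta * t) ltac:(nra)).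
assert (Hp : 0 < eta ^ n) by now apply pow_lt.
rewrite Rpow_mult_distr in H.
apply (Rmult_le_reg_l _ _ _ Hp).
replace (eta ^ n * (INR (fact n) / eta ^ n * exp (eta * t)))
  with (INR (fact n) * exp (eta * t)) by (field; lra).
exact H.
Qed.

(** * Derivatives in the order, by a fixed contour through a real point *)

(** [- w] on the contour [w = x0 + r + i gd r]. *)
Definition mgamma (x0 r : R) : C := (- (x0 + r), - gd r).

(** The whole factor [exp (y sinh w) dw/dr] is kept in the amplitude, so that
    the exponential depends on [mu] alone and its derivatives bring down powers
    of [- w]. *)
Definition amp (y x0 : R) (n : nat) (r : R) : C :=
  ((1, / cosh r)%R * Cexp (y * (sinh (x0 + r) * cos (gd r)), y * (cosh (x0 + r) * sin (gd r)))%R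
   * mgamma x0 r ^ n)%C.

Definition Jint (y x0 : R) (n : nat) (mu : R) : C :=
  ExpInt (amp y x0 n) (fun _ => RtoC 0) (mgamma x0) 0 mu.

Lemma Ccont_mgamma (x0 : R) : Ccont (mgamma x0).
Proof.
apply Ccont_pair.
- solve_cont.
- apply cont_opp, (cont_derive _ _ is_derive_gd).
Qed.

Lemma Ccont_amp (y x0 : R) (n : nat) : Ccont (amp y x0 n).
Proof.
assert (Cg : cont gd) by apply (cont_derive _ _ is_derive_gd).
apply Ccont_mult; [apply Ccont_mult | apply Ccont_pow, Ccont_mgamma].
- apply Ccont_pair; [apply cont_const | apply cont_inv_cosh].
- apply Ccont_Cexp, Ccont_pair.
  + apply cont_mult; [apply cont_const |]; apply cont_mult.
    * apply (cont_comp (fun r => x0 + r) sinh); [solve_cont | apply cont_sinh].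
    * apply (cont_comp gd cos Cg cont_cos).
  + apply cont_mult; [apply cont_const |]; apply cont_mult.
    * apply (cont_comp (fun r => x0 + r) cosh); [solve_cont | apply cont_cosh].
    * apply (cont_comp gd sin Cg cont_sin).
Qed.

(** The logarithm of the modulus of the integrand. On this contour
    [sinh w] has real part [sinh x0 + cosh x0 tanh r], hence stays bounded. *)
Definition height (y x0 mu r : R) : R :=
  y * sinh x0 - mu * x0 + y * cosh x0 * tanh r - mu * r.

Lemma Cmod_pair1 (t : R) : 0 <= t <= 1 -> Cmod (1, t) <= 2.
Proof.
intros Ht; eapply Rle_trans; [apply Cmod_le_sum |]; unfold Re, Im; simpl.
rewrite Rabs_R1, Rabs_pos_eq; lra.
Qed.

Lemma inv_cosh_bounds (r : R) : 0 <= / cosh r <= 1.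
Proof.
split; [apply Rlt_le, Rinv_0_lt_compat, cosh_pos |].
rewrite <- Rinv_1; apply Rinv_le_contravar; [lra | apply cosh_ge_1].
Qed.

Lemma Cmod_mgamma (x0 r : R) : 0 <= x0 -> 0 <= r -> Cmod (mgamma x0 r) <= x0 + 2 * r.
Proof.
intros Hx Hr; eapply Rle_trans; [apply Cmod_le_sum |]; unfold mgamma, Re, Im; simpl.
destruct (gd_bounds r Hr) as [H _].
rewrite !Rabs_Ropp, !Rabs_pos_eq; lra.
Qed.

Lemma amp_bound (y x0 mu r : R) (n : nat) : 0 <= x0 -> 0 <= r ->
  Cmod (amp y x0 n r) * exp (Re (expo (fun _ => RtoC 0) (mgamma x0) 0 mu r))
  <= 2 * (x0 + 2 * r) ^ n * exp (height y x0 mu r).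
Proof.
intros Hx Hr; unfold amp.
rewrite !Cmod_mult, Cmod_Cexp, Cmod_pow.
match goal with |- _ * exp ?A * _ * exp ?B <= _ => set (e1 := exp A); set (e2 := exp B) end.
assert (E : e1 * e2 = exp (height y x0 mu r)).
{ unfold e1, e2; rewrite <- exp_plus; f_equal; unfold expo, mgamma, Re; simpl.
  rewrite cos_gd, sinh_plus; unfold height, tanh.
  assert (Hc := cosh_pos r); field; lra. }
assert (H1 := Cmod_pair1 _ (inv_cosh_bounds r)).
assert (H2 : Cmod (mgamma x0 r) ^ n <= (x0 + 2 * r) ^ n)
  by (apply pow_incr; split; [apply Cmod_ge_0 | now apply Cmod_mgamma]).
assert (H3 := Cmod_ge_0 (1, / cosh r)%R).
assert (H4 : 0 <= Cmod (mgamma x0 r) ^ n) by (apply pow_le, Cmod_ge_0).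
replace (Cmod (1, / cosh r)%R * e1 * Cmod (mgamma x0 r) ^ n * e2)
  with (Cmod (1, / cosh r)%R * Cmod (mgamma x0 r) ^ n * (e1 * e2)) by ring.
rewrite E; apply Rmult_le_compat_r; [apply Rlt_le, exp_pos |].
now apply Rmult_le_compat.
Qed.

Lemma Jint_ok (y x0 m : R) (n : nat) : 0 < y -> 0 <= x0 -> 0 < m ->
  exists M, forall mu, m <= mu ->
    ExpInt_ok (amp y x0 n) (fun _ => RtoC 0) (mgamma x0) 0 mu M (m / 2).
Proof.
intros Hy Hx Hm.
set (K := INR (fact (n + 2)) / (m / 4) ^ (n + 2)).
exists (2 * (K * exp (m / 4 * (1 + x0))) * exp (y * sinh x0 + y * cosh x0)).
intros mu Hmu r Hr.
assert (Hs := sinh_ge x0 Hx). assert (Hc := cosh_pos x0).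
set (z := 1 + x0 + 2 * r).
assert (Hz : z ^ (n + 2) <= K * exp (m / 4 * z))
  by (apply pow_le_exp_scaled; unfold z; lra).
assert (Hpe := amp_bound y x0 mu r n Hx Hr).
assert (Hexp : exp (height y x0 mu r) <= exp (y * sinh x0 + y * cosh x0) * exp (- m * r)).
{ rewrite <- exp_plus; apply exp_le_compat; unfold height.
  destruct (tanh_bounds r Hr) as [[_ Ht] _].
  assert (0 <= mu * x0) by (apply Rmult_le_pos; lra).
  assert (y * cosh x0 * tanh r <= y * cosh x0 * 1)
    by (apply Rmult_le_compat_l; [apply Rmult_le_pos |]; lra).
  assert (m * r <= mu * r) by (apply Rmult_le_compat_r; lra).
  lra. }
assert (Hg := Cmod_mgamma x0 r Hx Hr). assert (Hg0 := Cmod_ge_0 (mgamma x0 r)).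
rewrite Cmod_0, Rplus_0_r.
set (E := exp (Re (expo (fun _ => RtoC 0) (mgamma x0) 0 mu r))) in *.
assert (HE : 0 < E) by apply exp_pos.
assert (Hz2 : (1 + Cmod (mgamma x0 r)) ^ 2 <= z ^ 2)
  by (apply pow_incr; unfold z; lra).
assert (Hzn : (x0 + 2 * r) ^ n <= z ^ n) by (apply pow_incr; unfold z; lra).
assert (HA := Cmod_ge_0 (amp y x0 n r)).
replace (Cmod (amp y x0 n r) * (1 + Cmod (mgamma x0 r)) ^ 2 * E)
  with ((Cmod (amp y x0 n r) * E) * (1 + Cmod (mgamma x0 r)) ^ 2) by ring.
apply Rle_trans with ((2 * z ^ n * exp (height y x0 mu r)) * z ^ 2).
- apply Rmult_le_compat; [nra | apply pow2_ge_0 | | exact Hz2].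
  eapply Rle_trans; [exact Hpe |].
  apply Rmult_le_compat_r; [apply Rlt_le, exp_pos | lra].
- replace (2 * z ^ n * exp (height y x0 mu r) * z ^ 2)
    with (2 * z ^ (n + 2) * exp (height y x0 mu r)) by (rewrite pow_add; ring).
  apply Rle_trans with (2 * (K * exp (m / 4 * z))
    * (exp (y * sinh x0 + y * cosh x0) * exp (- m * r))).
  + apply Rmult_le_compat; [| apply Rlt_le, exp_pos | lra | exact Hexp].
    assert (0 <= z ^ (n + 2)) by (apply pow_le; unfold z; lra); lra.
  + right.
    replace (exp (m / 4 * z)) with (exp (m / 4 * (1 + x0)) * exp (m / 2 * r))
      by (rewrite <- exp_plus; f_equal; unfold z; field).
    replace (exp (- m * r)) with (exp (- (m / 2) * r) * exp (- (m / 2) * r))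
      by (rewrite <- exp_plus; f_equal; field).
    assert (E1 : exp (m / 2 * r) * exp (- (m / 2) * r) = 1)
      by (rewrite <- exp_plus; replace (m / 2 * r + - (m / 2) * r) with 0 by ring; apply exp_0).
    set (e1 := exp (m / 2 * r)) in *. set (e2 := exp (- (m / 2) * r)) in *.
    replace (2 * (K * (exp (m / 4 * (1 + x0)) * e1)) *
      (exp (y * sinh x0 + y * cosh x0) * (e2 * e2)))
      with (2 * (K * exp (m / 4 * (1 + x0))) * exp (y * sinh x0 + y * cosh x0)
            * (e1 * e2) * e2) by ring.
    rewrite E1; ring.
Qed.

Lemma deriv_on_Jint (y x0 mu : R) (n : nat) : 0 < y -> 0 <= x0 -> 0 < mu ->
  deriv_on (fun t => 0 < t) (Jint y x0 n) mu (Jint y x0 (S n) mu).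
Proof.
intros Hy Hx Hmu.
destruct (Jint_ok y x0 (mu / 2) n Hy Hx ltac:(lra)) as [M HM].
apply deriv_on_quadratic with (K := 16 * (M / (mu / 2 / 2))) (d := mu / 2); [lra |].
intros t Ht Htm.
apply Rabs_lt_between in Htm.
assert (H := ExpInt_taylor (amp y x0 n) (fun _ => RtoC 0) (mgamma x0) 0 mu 0 (t - mu)
  M (mu / 2 / 2) ltac:(lra) (Ccont_amp y x0 n) (Ccont_const 0) (Ccont_mgamma x0)
  (HM mu ltac:(lra))).
rewrite Rplus_0_r, Rabs_R0, Rplus_0_l in H.
replace (mu + (t - mu)) with t in H by ring.
specialize (H (HM t ltac:(lra))).
eapply Rle_trans; [| exact H].
right; f_equal; unfold Jint.
assert (E : ExpInt (amp y x0 (S n)) (fun _ => RtoC 0) (mgamma x0) 0 mu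
   = ExpInt (fun r => amp y x0 n r * mgamma x0 r)%C (fun _ => RtoC 0) (mgamma x0) 0 mu).
{ apply CInt_ext; intros r; f_equal; unfold amp; simpl; ring. }
rewrite E; ring.
Qed.

Lemma is_lim_height (y x0 mu : R) : 0 < y -> 0 <= x0 -> 0 < mu ->
  is_lim (fun r => PI * exp (height y x0 mu r)) p_infty 0.
Proof.
intros Hy Hx Hmu.
apply is_lim_squeeze0 with (g := fun r =>
  PI * exp (y * sinh x0 + y * cosh x0) * exp (- mu * r)); [| now apply is_lim_exp_neg].
intros r Hr.
assert (Hpi := PI_RGT_0).
rewrite Rabs_pos_eq by (apply Rmult_le_pos; [lra | apply Rlt_le, exp_pos]).
rewrite Rmult_assoc; apply Rmult_le_compat_l; [lra |].
rewrite <- exp_plus; apply exp_le_compat; unfold height.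
destruct (tanh_bounds r Hr) as [[_ Ht] _].
assert (Hc := cosh_pos x0).
assert (0 <= mu * x0) by (apply Rmult_le_pos; lra).
assert (y * cosh x0 * tanh r <= y * cosh x0 * 1)
  by (apply Rmult_le_compat_l; [apply Rmult_le_pos |]; lra).
lra.
Qed.

Lemma argRe_height (y x0 mu r : R) :
  argRe (y / 2) (- (y / 2)) mu (x0 + r) (gd r) = height y x0 mu r.
Proof.
rewrite argRe_Bessel, cos_gd, sinh_plus; unfold height, tanh.
assert (Hc := cosh_pos r); field; lra.
Qed.

Lemma BesselJ_Jint (y x0 mu : R) : 0 < y -> 0 <= x0 -> 0 < mu ->
  PI * BesselJ mu y = Im (Jint y x0 0 mu).
Proof.
intros Hy Hx Hmu.
rewrite BesselJ_Loop by lra.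
set (p := y / 2).
destruct (Jint_ok y x0 mu 0 Hy Hx Hmu) as [M HM].
assert (Hs := ExpInt_ok_small _ _ _ _ _ _ _ (ltac:(lra) : 0 < mu / 2)
  (Ccont_amp y x0 0) (Ccont_const 0) (Ccont_mgamma x0) (HM mu (Rle_refl mu))).
set (G := fun r => ((1, / cosh r)%R * FC p (- p)%R mu (x0 + r)%R (gd r))%C).
assert (EG : forall r, (amp y x0 0 r * Cexp (expo (fun _ => RtoC 0) (mgamma x0) 0 mu r))%C = G r).
{ intros r; unfold amp, G; simpl.
  rewrite FC_Cexp, Cmult_1_r, <- Cmult_assoc, <- Cexp_plus; f_equal; f_equal.
  unfold p; rewrite argRe_Bessel, argIm_Bessel.
  apply injective_projections; unfold expo, mgamma; simpl; ring. }
assert (HG : exp_small G M (mu / 2)).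
{ destruct Hs as [H1 [H2 H3]]; split; [exact H1 | split].
  - now apply Ccont_ext with (2 := H2).
  - intros u Hu; rewrite <- EG; now apply H3. }
assert (EJ : Jint y x0 0 mu = CInt G) by (apply CInt_ext, EG).
rewrite EJ.
assert (L1 := CInt_path p (- p) mu (fun r => x0 + r) gd (fun _ => 1) (fun r => / cosh r)
  M (mu / 2) ltac:(intros; auto_derive; [exact I | ring]) is_derive_gd (cont_const 1)
  cont_inv_cosh HG).
rewrite gd_0, Psi_axis, Rplus_0_l in L1.
fold G in L1.
assert (L2 : is_lim (fun r => Psi p (- p) mu (x0 + r) PI) p_infty (Loop p (- p) mu)).
{ apply (is_lim_comp (fun u => Psi p (- p) mu u PI) (fun r => x0 + r) p_infty _ p_infty).
  - apply Loop_lim; unfold p; lra.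
  - apply (is_lim_plus (fun _ => x0) (fun u => u) p_infty x0 p_infty p_infty);
      [apply is_lim_const | apply is_lim_id | reflexivity].
  - exists 0; discriminate. }
assert (L3 : is_lim (fun r => Psi p (- p) mu (x0 + r) (gd r) - Psi p (- p) mu (x0 + r) PI)
  p_infty 0).
{ apply is_lim_squeeze0 with (g := fun r => PI * exp (height y x0 mu r));
    [| now apply is_lim_height].
  intros r Hr; rewrite <- argRe_height.
  destruct (gd_bounds r Hr) as [[H0 _] H1].
  apply Psi_right_end; lra. }
assert (L4 := is_lim_minus' _ _ _ _ _ L1 L2).
apply is_lim_unique in L3; apply is_lim_unique in L4.
rewrite L3 in L4; apply (f_equal real) in L4.
change (0 = Im (CInt G) - Loop p (- p) mu) in L4; lra.
Qed.

(** The value does not depend on [x0]: any real starting point may be used, and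
    it may be chosen in terms of [mu] after differentiating. *)
Lemma BesselJ_derive_n (y x0 : R) (n : nat) : 0 < y -> 0 <= x0 -> forall mu, 0 < mu ->
  ex_derive_n (fun nu => BesselJ nu y) n mu /\
  Derive_n (fun nu => BesselJ nu y) n mu = / PI * Im (Jint y x0 n mu).
Proof.
intros Hy Hx.
assert (Hpi := PI_RGT_0).
induction n as [| n IH]; intros mu Hmu.
- split; [exact I |].
  change (BesselJ mu y = / PI * Im (Jint y x0 0 mu)).
  rewrite <- (BesselJ_Jint y x0 mu) by assumption; field; lra.
- assert (Hloc : locally mu (fun t => 0 < t)).
  { exists (mkposreal mu Hmu); intros t Ht.
    change (Rabs (t - mu) < mu) in Ht; apply Rabs_lt_between in Ht; lra. }
  assert (D : is_derive (Derive_n (fun nu => BesselJ nu y) n) mu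
     (/ PI * Im (Jint y x0 (S n) mu))).
  { apply is_derive_ext_loc with (f := fun t => / PI * Im (Jint y x0 n t)).
    - revert Hloc; apply filter_imp; intros t Ht; symmetry; now apply IH.
    - apply (is_derive_scal (fun t => Im (Jint y x0 n t))).
      apply (deriv_on_Im _ (fun t => 0 < t)); [exact Hloc | now apply deriv_on_Jint]. }
  split; [now eexists; exact D |].
  exact (is_derive_unique _ _ _ D).
Qed.

Lemma BesselJ_derive_n_bound (y x0 mu M lam : R) (n : nat) :
  0 < y -> 0 <= x0 -> 0 < mu -> 0 < lam ->
  (forall r, 0 <= r -> 2 * (x0 + 2 * r) ^ n * exp (height y x0 mu r) <= M * exp (- lam * r)) ->
  ex_derive_n (fun nu => BesselJ nu y) n mu /\
  Rabs (Derive_n (fun nu => BesselJ nu y) n mu) <= M / lam.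
Proof.
intros Hy Hx Hmu Hl H.
destruct (BesselJ_derive_n y x0 n Hy Hx mu Hmu) as [H1 H2]; split; [exact H1 |].
rewrite H2.
assert (HB : Cmod (Jint y x0 n mu) <= 2 * (M / lam)).
{ apply CInt_bound; split; [exact Hl | split].
  - apply Ccont_mult; [apply Ccont_amp | apply Ccont_Cexp, Ccont_expo;
      [apply Ccont_const | apply Ccont_mgamma]].
  - intros r Hr; rewrite Cmod_mult, Cmod_Cexp.
    eapply Rle_trans; [now apply amp_bound | now apply H]. }
assert (HI := im_le_Cmod (Jint y x0 n mu)).
assert (H3 := PI2_3_2). unfold PI2 in H3.
assert (Hpi : / PI <= / 2) by (apply Rinv_le_contravar; lra).
assert (Hpi0 : 0 < / PI) by (apply Rinv_0_lt_compat; lra).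
rewrite Rabs_mult, (Rabs_pos_eq (/ PI)) by lra.
apply Rle_trans with (/ 2 * (2 * (M / lam))); [| lra].
apply Rmult_le_compat; try lra; apply Rabs_pos.
Qed.

(** * The transition region *)

Lemma cube_root (y : R) : 8 <= y ->
  2 <= Rpower y (1 / 3) /\ Rpower y (1 / 3) ^ 3 = y.
Proof.
intros Hy; split.
- replace 2 with (Rpower 8 (1 / 3)) at 1.
  + apply Rle_Rpower_l; lra.
  + replace 8 with (Rpower 2 (INR 3)) by (rewrite Rpower_pow by lra; ring).
    rewrite Rpower_mult.
    replace (INR 3 * (1 / 3)) with 1 by (simpl; field).
    apply Rpower_1; lra.
- rewrite <- Rpower_pow by apply exp_pos.
  rewrite Rpower_mult.
  replace (1 / 3 * INR 3) with 1 by (simpl; field).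
  apply Rpower_1; lra.
Qed.

Lemma minus_tanh_ge (r : R) : 0 <= r <= 4 -> r ^ 3 / 75 <= r - tanh r.
Proof.
intros Hr.
enough (0 <= r - tanh r - r ^ 3 / 75) by lra.
apply (nonneg_of_derive (fun r => r - tanh r - r ^ 3 / 75)
  (fun r => tanh r ^ 2 - r ^ 2 / 25) 4); [| | | exact Hr].
- unfold tanh; rewrite sinh_at_0; unfold Rdiv; lra.
- intros x _.
  assert (Hc := cosh_pos x).
  replace (tanh x ^ 2 - x ^ 2 / 25)
    with ((1 - (cosh x * cosh x - sinh x * sinh x) / (cosh x) ^ 2) - x ^ 2 / 25)
    by (unfold tanh; field; lra).
  unfold tanh; auto_derive; [lra | field; lra].
- intros x Hx.
  destruct (tanh_bounds x (proj1 Hx)) as [[H0 _] [H1 _]].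
  assert (x / 5 <= x / (1 + x)).
  { apply Rmult_le_compat_l; [lra |]; apply Rinv_le_contravar; lra. }
  assert ((x / 5) ^ 2 <= tanh x ^ 2) by (apply pow_incr; lra).
  lra.
Qed.

(** With [Y = y^(1/3)], the modulus of the integrand decays at the scale [r = 1/Y]. *)
Lemma transition_height (y mu r : R) : 8 <= y ->
  y - 2 * Rpower y (1 / 3) <= mu -> 0 <= r ->
  height y 0 mu r <= 20 - Rpower y (1 / 3) * r.
Proof.
intros Hy Hmu Hr.
destruct (cube_root y Hy) as [HY E]; set (Y := Rpower y (1 / 3)) in *.
unfold height; rewrite sinh_at_0, cosh_0, !Rmult_0_r, Rmult_1_r.
assert (HY2 : 4 <= Y ^ 2) by nra.
(* for r <= 4 the cubic term wins over the linear one; beyond, mu >= y / 2 does *)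
destruct (Rle_lt_dec r 4) as [H | H].
- assert (H1 := minus_tanh_ge r (conj Hr H)).
  assert (H2 : y * (r ^ 3 / 75) <= y * (r - tanh r)) by (apply Rmult_le_compat_l; lra).
  assert (H3 : y * (r ^ 3 / 75) = (Y * r) ^ 3 / 75) by (rewrite <- E; field).
  assert (H4 : (y - 2 * Y) * r <= mu * r) by (apply Rmult_le_compat_r; lra).
  set (x := Y * r) in *.
  assert (Hx : 0 <= x) by (unfold x; apply Rmult_le_pos; lra).
  (* the tangent at x = 9 bounds the concave function 3 x - x^3 / 75 by 20 *)
  assert (H5 : 0 <= (x - 9) ^ 2 * (x + 18)) by (apply Rmult_le_pos; [apply pow2_ge_0 | lra]).
  assert (H6 : 2 * Y * r = 2 * x) by (unfold x; ring).
  nra.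
- destruct (tanh_bounds r Hr) as [[_ H1] _].
  assert (H2 : 4 * Y <= y) by (rewrite <- E; nra).
  assert (H3 : y / 2 * r <= mu * r) by (apply Rmult_le_compat_r; lra).
  assert (H4 : y * tanh r <= y) by nra.
  assert (H5 : y * 4 <= y * r) by (apply Rmult_le_compat_l; lra).
  assert (H6 : Y * r <= y / 4 * r) by (apply Rmult_le_compat_r; lra).
  lra.
Qed.

(** Near the transition point the contour starts at [0]. Integrating
    [r^n exp (- Y r)] gives [Y^(- n - 1)]. *)
Lemma transition_bound (n : nat) : exists C, 0 < C /\ forall y mu, 8 <= y ->
  y - 2 * Rpower y (1 / 3) <= mu <= y + 2 * Rpower y (1 / 3) ->
  ex_derive_n (fun nu => BesselJ nu y) n mu /\
  Rabs (Derive_n (fun nu => BesselJ nu y) n mu)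
    <= C * Rpower y (- ((1 + INR n) / 3)).
Proof.
set (K := INR (fact n) / (1 / 2) ^ n).
assert (HK : 0 < K) by (apply Rdiv_lt_0_compat; [apply INR_fact_lt_0 | apply pow_lt; lra]).
assert (H2n : 0 < 2 ^ n) by (apply pow_lt; lra).
exists (4 * 2 ^ n * K * exp 20); split.
{ apply Rmult_lt_0_compat; [apply Rmult_lt_0_compat; [lra | exact HK] | apply exp_pos]. }
intros y mu Hy Hmu.
destruct (cube_root y Hy) as [HY E]; set (Y := Rpower y (1 / 3)) in *.
assert (H4Y : 4 * Y <= y) by (rewrite <- E; assert (4 <= Y ^ 2) by nra; nra).
assert (HYn : 0 < Y ^ n) by (apply pow_lt; lra).
assert (EY : Rpower y (- ((1 + INR n) / 3)) = / (Y * Y ^ n)).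
{ replace (Y * Y ^ n) with (Y ^ S n) by reflexivity.
  rewrite <- Rpower_pow by apply exp_pos; unfold Y; rewrite Rpower_mult, S_INR.
  rewrite <- Rpower_Ropp; f_equal; field. }
rewrite EY.
replace (4 * 2 ^ n * K * exp 20 * / (Y * Y ^ n))
  with ((2 * 2 ^ n * K * exp 20 / Y ^ n) / (Y / 2)) by (field; lra).
apply (BesselJ_derive_n_bound y 0 mu); try lra.
intros r Hr.
rewrite Rplus_0_l.
assert (Hh := transition_height y mu r Hy (proj1 Hmu) Hr); fold Y in Hh.
assert (Hx : 0 <= Y * r) by (apply Rmult_le_pos; lra).
assert (HP := pow_le_exp_scaled n (1 / 2) (Y * r) ltac:(lra) Hx); fold K in HP.
replace ((2 * r) ^ n) with (2 ^ n / Y ^ n * (Y * r) ^ n)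
  by (rewrite !Rpow_mult_distr; field; lra).
apply Rle_trans with (2 * (2 ^ n / Y ^ n * (K * exp (1 / 2 * (Y * r)))) * exp (20 - Y * r)).
- assert (0 < 2 ^ n / Y ^ n) by (now apply Rdiv_lt_0_compat).
  assert (0 <= (Y * r) ^ n) by (now apply pow_le).
  apply Rmult_le_compat; [| apply Rlt_le, exp_pos | | now apply exp_le_compat].
  + apply Rmult_le_pos; [lra |]; apply Rmult_le_pos; lra.
  + apply Rmult_le_compat_l; [lra |]; apply Rmult_le_compat_l; lra.
- right.
  replace (exp (20 - Y * r)) with (exp 20 * (exp (- (Y / 2) * r) * exp (- (1 / 2 * (Y * r)))))
    by (rewrite <- !exp_plus; f_equal; field).
  assert (E1 : exp (1 / 2 * (Y * r)) * exp (- (1 / 2 * (Y * r))) = 1)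
    by (rewrite <- exp_plus, Rplus_opp_r; apply exp_0).
  set (e1 := exp (1 / 2 * (Y * r))) in *. set (e2 := exp (- (1 / 2 * (Y * r)))) in *.
  replace (2 * (2 ^ n / Y ^ n * (K * e1)) * (exp 20 * (exp (- (Y / 2) * r) * e2)))
    with (2 * 2 ^ n * K * exp 20 / Y ^ n * exp (- (Y / 2) * r) * (e1 * e2)) by (field; lra).
  rewrite E1; ring.
Qed.

(** * The monotonic region *)

Lemma cosh_le_01 (x : R) : 0 <= x <= 1 -> cosh x <= 7 / 4.
Proof.
intros Hx; unfold cosh.
assert (E : exp x * exp (- x) = 1) by (rewrite <- exp_plus, Rplus_opp_r; apply exp_0).
assert (H1 : 1 <= exp x) by (generalize (exp_ineq1_le x); lra).
assert (H2 : exp x <= 3) by (apply Rle_trans with (exp 1); [apply exp_le_compat; lra | apply exp_le_3]).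
assert (H3 := exp_pos (- x)).
nra.
Qed.

Lemma sinh_le_01 (x : R) : 0 <= x <= 1 -> sinh x <= 7 / 4 * x.
Proof.
intros Hx.
enough (0 <= 7 / 4 * x - sinh x) by lra.
apply (nonneg_of_derive (fun x => 7 / 4 * x - sinh x) (fun x => 7 / 4 - cosh x) 1);
  [rewrite sinh_at_0; lra | | | exact Hx].
- intros t _.
  auto_derive; [exact I | ring].
- intros t Ht; generalize (cosh_le_01 t Ht); lra.
Qed.

Lemma cosh_minus_1_le_01 (x : R) : 0 <= x <= 1 -> cosh x <= 1 + 7 / 8 * x ^ 2.
Proof.
intros Hx.
enough (0 <= 1 + 7 / 8 * x ^ 2 - cosh x) by lra.
apply (nonneg_of_derive (fun x => 1 + 7 / 8 * x ^ 2 - cosh x)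
  (fun x => 7 / 4 * x - sinh x) 1); [rewrite cosh_0; lra | | | exact Hx].
- intros t _.
  auto_derive; [exact I | field].
- intros t Ht; generalize (sinh_le_01 t Ht); lra.
Qed.

Lemma sinh_minus_le_01 (x : R) : 0 <= x <= 1 -> sinh x <= x + 3 / 10 * x ^ 3.
Proof.
intros Hx.
enough (0 <= x + 3 / 10 * x ^ 3 - sinh x) by lra.
apply (nonneg_of_derive (fun x => x + 3 / 10 * x ^ 3 - sinh x)
  (fun x => 1 + 9 / 10 * x ^ 2 - cosh x) 1); [rewrite sinh_at_0; lra | | | exact Hx].
- intros t _.
  auto_derive; [exact I | field].
- intros t Ht; generalize (cosh_minus_1_le_01 t Ht) (pow2_ge_0 t); lra.
Qed.

(** [x0] stays below the saddle point [arcosh (mu / y)], so that the modulus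
    has already decayed at [x0] and keeps decaying along the contour. *)
Lemma monotonic_height (y d x0 r : R) : 8 <= y -> 0 < d -> 0 <= x0 <= 1 ->
  y * x0 ^ 2 <= d -> 0 <= r ->
  height y x0 (y + d) r <= - (7 / 10) * (d * x0) - 1 / 8 * d * r.
Proof.
intros Hy Hd Hx Hxd Hr; unfold height.
assert (Hs := sinh_minus_le_01 x0 Hx). assert (Hc := cosh_minus_1_le_01 x0 Hx).
destruct (tanh_bounds r Hr) as [[H0 _] [_ Ht]].
assert (Hc0 := cosh_pos x0).
assert (A1 : y * sinh x0 <= y * (x0 + 3 / 10 * x0 ^ 3)) by (apply Rmult_le_compat_l; lra).
assert (A2 : y * x0 ^ 2 * x0 <= d * x0) by (apply Rmult_le_compat_r; lra).
assert (A3 : y * cosh x0 * tanh r <= y * cosh x0 * r)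
  by (apply Rmult_le_compat_l; [apply Rmult_le_pos |]; lra).
assert (A4 : y * cosh x0 <= y * (1 + 7 / 8 * x0 ^ 2)) by (apply Rmult_le_compat_l; lra).
assert (A5 : y * cosh x0 * r <= (y + 7 / 8 * d) * r) by (apply Rmult_le_compat_r; lra).
nra.
Qed.

Lemma Rpower_le_exp (s : R) : 0 <= s -> exists C, 0 < C /\
  forall t, 0 < t -> Rpower t s <= C * exp (6 / 10 * t).
Proof.
intros Hs.
set (K := s / (6 / 10) + 1).
assert (HK : 0 < K) by (unfold K; assert (0 <= s / (6 / 10)) by (apply Rdiv_le_0_compat; lra); lra).
exists (exp (s * ln K)); split; [apply exp_pos |].
intros t Ht; unfold Rpower; rewrite <- exp_plus; apply exp_le_compat.
assert (H : ln t <= t / K + ln K).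
{ replace t with (t / K * K) at 1 by (field; lra).
  assert (0 < t / K) by now apply Rdiv_lt_0_compat.
  rewrite ln_mult by lra; apply Rplus_le_compat_r.
  generalize (exp_ineq1_le (ln (t / K))); rewrite exp_ln by assumption; lra. }
apply (Rmult_le_compat_l s) in H; [| exact Hs].
assert (H2 : s * (t / K) <= 6 / 10 * t).
{ replace (6 / 10 * t) with (6 / 10 * K * (t / K)) by (field; lra).
  apply Rmult_le_compat_r; [apply Rlt_le; now apply Rdiv_lt_0_compat | unfold K; lra]. }
lra.
Qed.

(** The powers of [|w| <= x0 + 2 r] cost [d^-n] after a small part of the
    exponential is spent. *)
Lemma monotonic_bound (n : nat) : exists C, 0 < C /\ forall y d x0, 8 <= y -> 0 < d ->
  0 <= x0 <= 1 -> y * x0 ^ 2 <= d ->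
  ex_derive_n (fun nu => BesselJ nu y) n (y + d) /\
  Rabs (Derive_n (fun nu => BesselJ nu y) n (y + d))
    <= C * (/ (d * d ^ n) * exp (- (6 / 10) * (d * x0))).
Proof.
set (K := INR (fact n) / (1 / 20) ^ n).
assert (HK : 0 < K) by (apply Rdiv_lt_0_compat; [apply INR_fact_lt_0 | apply pow_lt; lra]).
exists (80 * K); split; [lra |].
intros y d x0 Hy Hd Hx Hxd.
assert (Hdn : 0 < d ^ n) by now apply pow_lt.
replace (80 * K * (/ (d * d ^ n) * exp (- (6 / 10) * (d * x0))))
  with ((2 * K * exp (- (6 / 10) * (d * x0)) / d ^ n) / (d / 40)) by (field; lra).
apply (BesselJ_derive_n_bound y x0); try lra.
intros r Hr.
assert (Hh := monotonic_height y d x0 r Hy Hd Hx Hxd Hr).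
assert (Hdx : 0 <= d * x0) by (apply Rmult_le_pos; lra).
assert (Hdr : 0 <= d * r) by (apply Rmult_le_pos; lra).
assert (HP := pow_le_exp_scaled n (1 / 20) (d * (x0 + 2 * r)) ltac:(lra)
  ltac:(apply Rmult_le_pos; lra)); fold K in HP.
rewrite Rpow_mult_distr in HP.
apply (Rmult_le_reg_l _ _ _ Hdn).
replace (d ^ n * (2 * (x0 + 2 * r) ^ n * exp (height y x0 (y + d) r)))
  with (2 * (d ^ n * (x0 + 2 * r) ^ n) * exp (height y x0 (y + d) r)) by ring.
apply Rle_trans with (2 * (K * exp (1 / 20 * (d * (x0 + 2 * r))))
  * exp (- (7 / 10) * (d * x0) - 1 / 8 * d * r)).
- apply Rmult_le_compat; [| apply Rlt_le, exp_pos | lra | now apply exp_le_compat].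
  apply Rmult_le_pos; [lra |]; apply Rmult_le_pos; apply pow_le; lra.
- replace (d ^ n * (2 * K * exp (- (6 / 10) * (d * x0)) / d ^ n * exp (- (d / 40) * r)))
    with (2 * K * (exp (- (6 / 10) * (d * x0)) * exp (- (d / 40) * r))) by (field; lra).
  replace (2 * (K * exp (1 / 20 * (d * (x0 + 2 * r)))) * exp (- (7 / 10) * (d * x0) - 1 / 8 * d * r))
    with (2 * K * (exp (1 / 20 * (d * (x0 + 2 * r))) * exp (- (7 / 10) * (d * x0) - 1 / 8 * d * r)))
    by ring.
  apply Rmult_le_compat_l; [lra |].
  rewrite <- !exp_plus; apply exp_le_compat; nra.
Qed.

Lemma Rpower_pow_neg (d : R) (n : nat) : 0 < d ->
  Rpower d (- (1 / 4) - INR n) = Rpower d (3 / 4) * / (d * d ^ n).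
Proof.
intros Hd.
replace (d * d ^ n) with (d ^ S n) by reflexivity.
rewrite <- Rpower_pow, <- Rpower_Ropp, <- Rpower_plus, S_INR by exact Hd.
f_equal; field.
Qed.

(** The choice [x0 = min (sqrt (d / y)) 1] makes [exp (- d x0)] beat every power
    of [d^3 / y]. *)
Lemma monotonic_weight (N : R) : 0 < N -> exists C, 0 < C /\ forall y d,
  8 <= y -> 1 / 2 * Rpower y (1 / 3) <= d ->
  exists x0, 0 <= x0 <= 1 /\ y * x0 ^ 2 <= d /\
    exp (- (6 / 10) * (d * x0))
    <= C * (Rpower (y + d) (- (1 / 4)) * Rpower d (3 / 4) * Rpower (/ y * d ^ 3) (- N)).
Proof.
intros HN.
destruct (Rpower_le_exp (2 * N) ltac:(lra)) as [C1 [HC1 B1]].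
destruct (Rpower_le_exp (3 * N) ltac:(lra)) as [C2 [HC2 B2]].
exists (2 * (C1 + C2)); split; [lra |].
intros y d Hy Hd.
destruct (cube_root y Hy) as [HY E]; set (Y := Rpower y (1 / 3)) in *.
assert (Hd1 : 1 <= d) by lra.
assert (Hd3 : 0 < d ^ 3) by (apply pow_lt; lra).
assert (Hiy : 0 < / y) by (apply Rinv_0_lt_compat; lra).
set (X := / y * d ^ 3).
assert (HX : 0 < X) by (unfold X; apply Rmult_lt_0_compat; lra).
assert (HX8 : y <= 8 * d ^ 3).
{ rewrite <- E; replace (8 * d ^ 3) with ((2 * d) ^ 3) by ring; apply pow_incr; lra. }
(* the algebraic factor loses at most a constant: (y + d) <= 16 d^3 *)
assert (HA : 1 <= 2 * (Rpower (y + d) (- (1 / 4)) * Rpower d (3 / 4))).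
{ assert (E1 : Rpower d (3 / 4) = Rpower (d ^ 3) (1 / 4)).
  { rewrite <- Rpower_pow, Rpower_mult by lra; f_equal; simpl; field. }
  assert (E2 : 2 = Rpower 16 (1 / 4)).
  { replace 16 with (Rpower 2 (INR 4)) by (rewrite Rpower_pow by lra; ring).
    rewrite Rpower_mult; replace (INR 4 * (1 / 4)) with 1 by (simpl; field).
    rewrite Rpower_1; lra. }
  assert (H1 : Rpower (y + d) (1 / 4) <= 2 * Rpower d (3 / 4)).
  { rewrite E1, E2 at 1; rewrite Rpower_mult_distr by lra.
    apply Rle_Rpower_l; [lra |].
    assert (d <= d ^ 3) by (assert (1 <= d ^ 2) by nra; nra). lra. }
  assert (Hp : 0 < Rpower (y + d) (1 / 4)) by apply exp_pos.
  rewrite Rpower_Ropp.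
  apply (Rmult_le_reg_l _ _ _ Hp).
  replace (Rpower (y + d) (1 / 4) * (2 * (/ Rpower (y + d) (1 / 4) * Rpower d (3 / 4))))
    with (2 * Rpower d (3 / 4)) by (field; lra). lra. }
set (A := Rpower (y + d) (- (1 / 4)) * Rpower d (3 / 4)) in *.
assert (HXN : 0 < Rpower X (- N)) by apply exp_pos.
assert (Main : forall x0 C, 0 < C -> C <= C1 + C2 ->
    Rpower X N <= C * exp (6 / 10 * (d * x0)) ->
    exp (- (6 / 10) * (d * x0)) <= 2 * (C1 + C2) * (A * Rpower X (- N))).
{ intros x0 C HC HCC HB.
  set (t := 6 / 10 * (d * x0)) in *.
  replace (- (6 / 10) * (d * x0)) with (- t) by (unfold t; ring).
  assert (Et : exp t * exp (- t) = 1) by (rewrite <- exp_plus, Rplus_opp_r; apply exp_0).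
  assert (EX : Rpower X N * Rpower X (- N) = 1).
  { rewrite <- Rpower_plus, Rplus_opp_r; apply Rpower_O, HX. }
  assert (P1 := exp_pos t). assert (P2 := exp_pos (- t)).
  assert (H : exp (- t) <= C * Rpower X (- N)).
  { apply (Rmult_le_compat_r (exp (- t) * Rpower X (- N))) in HB; [| nra].
    replace (Rpower X N * (exp (- t) * Rpower X (- N)))
      with (exp (- t) * (Rpower X N * Rpower X (- N))) in HB by ring.
    replace (C * exp t * (exp (- t) * Rpower X (- N)))
      with (C * Rpower X (- N) * (exp t * exp (- t))) in HB by ring.
    rewrite EX, Et in HB; lra. }
  apply Rle_trans with ((C1 + C2) * Rpower X (- N)).
  - apply Rle_trans with (1 := H); apply Rmult_le_compat_r; lra.
  - replace (2 * (C1 + C2) * (A * Rpower X (- N)))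
      with ((C1 + C2) * Rpower X (- N) * (2 * A)) by ring.
    rewrite <- (Rmult_1_r ((C1 + C2) * Rpower X (- N))) at 1.
    apply Rmult_le_compat_l; [apply Rmult_le_pos; lra | exact HA]. }
destruct (Rle_lt_dec d y) as [Hdy | Hdy].
- set (x0 := sqrt (d / y)).
  assert (Hdiv : 0 < d / y) by (apply Rdiv_lt_0_compat; lra).
  assert (Hx2 : x0 ^ 2 = d / y) by (unfold x0; rewrite pow2_sqrt; lra).
  assert (Hx0 : 0 < x0) by (now apply sqrt_lt_R0).
  assert (Hx1 : x0 <= 1).
  { unfold x0; rewrite <- sqrt_1; apply sqrt_le_1_alt.
    apply (Rmult_le_reg_r y); [lra |]; unfold Rdiv; rewrite Rmult_assoc, Rinv_l by lra; lra. }
  exists x0; split; [lra | split; [rewrite Hx2; right; field; lra |]].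
  apply (Main x0 C1); [exact HC1 | lra |].
  replace (Rpower X N) with (Rpower (d * x0) (2 * N)).
  + apply B1; apply Rmult_lt_0_compat; lra.
  + replace X with ((d * x0) ^ 2)
      by (unfold X; rewrite Rpow_mult_distr, Hx2; field; lra).
    rewrite <- (Rpower_pow 2), Rpower_mult by (apply Rmult_lt_0_compat; lra).
    f_equal; simpl; ring.
- exists 1; split; [lra | split; [lra |]].
  apply (Main 1 C2); [exact HC2 | lra |].
  rewrite Rmult_1_r.
  eapply Rle_trans; [| apply (B2 d); lra].
  replace (3 * N) with (INR 3 * N) by (simpl; ring).
  rewrite <- Rpower_mult, Rpower_pow by lra.
  apply Rle_Rpower_l; [lra | split; [exact HX |]].
  unfold X; rewrite <- (Rmult_1_l (d ^ 3)) at 2; apply Rmult_le_compat_r; [lra |].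
  rewrite <- Rinv_1; apply Rinv_le_contravar; lra.
Qed.

Lemma monotonic_region (n : nat) (N : R) : 0 < N -> exists C, 0 < C /\
  forall y mu, 8 <= y -> y + 1 / 2 * Rpower y (1 / 3) <= mu ->
  ex_derive_n (fun nu => BesselJ nu y) n mu /\
  Rabs (Derive_n (fun nu => BesselJ nu y) n mu)
    <= C * Rpower mu (- (1 / 4)) * Rpower (mu - y) (- (1 / 4) - INR n)
       * Rpower (/ y * (mu - y) ^ 3) (- N).
Proof.
intros HN.
destruct (monotonic_bound n) as [C1 [HC1 B1]].
destruct (monotonic_weight N HN) as [C2 [HC2 B2]].
exists (C1 * C2); split; [now apply Rmult_lt_0_compat |].
intros y mu Hy Hmu.
set (d := mu - y).
assert (Hd : 1 / 2 * Rpower y (1 / 3) <= d) by (unfold d; lra).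
destruct (cube_root y Hy) as [HY _].
assert (Hd0 : 0 < d) by lra.
destruct (B2 y d Hy Hd) as [x0 [Hx [Hxd Hw]]].
destruct (B1 y d x0 Hy Hd0 Hx Hxd) as [H1 H2].
replace (y + d) with mu in * by (unfold d; ring).
split; [exact H1 |].
eapply Rle_trans; [exact H2 |].
rewrite Rpower_pow_neg by exact Hd0.
assert (Hdn : 0 < d * d ^ n) by (apply Rmult_lt_0_compat; [| apply pow_lt]; lra).
assert (Hin : 0 < / (d * d ^ n)) by now apply Rinv_0_lt_compat.
replace (C1 * C2 * Rpower mu (- (1 / 4)) * (Rpower d (3 / 4) * / (d * d ^ n))
    * Rpower (/ y * d ^ 3) (- N))
  with (C1 * (/ (d * d ^ n) * (C2 * (Rpower mu (- (1 / 4)) * Rpower d (3 / 4)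
    * Rpower (/ y * d ^ 3) (- N))))) by ring.
apply Rmult_le_compat_l; [lra |]; apply Rmult_le_compat_l; [lra | exact Hw].
Qed.

(** * The oscillatory region: integrals through the saddle point *)

Lemma cosh_ge (r : R) : 0 <= r -> 1 + r ^ 2 / 2 <= cosh r.
Proof.
intros Hr.
enough (0 <= cosh r - (1 + r ^ 2 / 2)) by lra.
apply (nonneg_of_derive (fun r => cosh r - (1 + r ^ 2 / 2)) (fun r => sinh r - r) r);
  [rewrite cosh_0; lra | | | lra].
- intros t _.
  auto_derive; [exact I | field].
- intros t Ht; generalize (sinh_ge t (proj1 Ht)); lra.
Qed.

Lemma sinh_ge3 (r : R) : 0 <= r -> r + r ^ 3 / 6 <= sinh r.
Proof.
intros Hr.
enough (0 <= sinh r - (r + r ^ 3 / 6)) by lra.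
apply (nonneg_of_derive (fun r => sinh r - (r + r ^ 3 / 6)) (fun r => cosh r - (1 + r ^ 2 / 2)) r);
  [rewrite sinh_at_0; lra | | | lra].
- intros t _.
  auto_derive; [exact I | field].
- intros t Ht; generalize (cosh_ge t (proj1 Ht)); lra.
Qed.

Lemma cosh_le_exp (r : R) : 0 <= r -> cosh r <= exp r.
Proof.
intros Hr; unfold cosh.
assert (exp (- r) <= exp r) by (apply exp_le_compat; lra); lra.
Qed.

Lemma sinh_le (r : R) : 0 <= r -> sinh r <= r * exp r.
Proof.
intros Hr.
destruct (tanh_bounds r Hr) as [_ [_ H]].
assert (Hc := cosh_pos r); assert (He := cosh_le_exp r Hr).
apply Rle_trans with (r * cosh r); [| now apply Rmult_le_compat_l].
unfold tanh in H; apply (Rmult_le_compat_r (cosh r)) in H; [| lra].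
unfold Rdiv in H; rewrite Rmult_assoc, Rinv_l in H; lra.
Qed.

Lemma cosh_minus_1_le (r : R) : 0 <= r -> cosh r - 1 <= r ^ 2 * exp r.
Proof.
intros Hr.
enough (0 <= r * (r * exp r) - (cosh r - 1)) by (simpl; lra).
assert (aux : forall b, 0 <= b -> forall t, 0 <= t <= b -> 0 <= b * sinh t - (cosh t - 1)).
{ intros b Hb t Ht.
  apply (nonneg_of_derive (fun t => b * sinh t - (cosh t - 1))
    (fun t => b * cosh t - sinh t) b); [rewrite sinh_at_0, cosh_0; lra | | | exact Ht].
  - intros x _.
    auto_derive; [exact I | ring].
  - intros x Hx.
    destruct (tanh_bounds x (proj1 Hx)) as [_ [_ H]].
    assert (Hc := cosh_pos x).
    unfold tanh in H; apply (Rmult_le_compat_r (cosh x)) in H; [| lra].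
    unfold Rdiv in H; rewrite Rmult_assoc, Rinv_l in H by lra; nra. }
assert (H := aux r Hr r (conj Hr (Rle_refl r))).
assert (H2 := sinh_le r Hr); nra.
Qed.

Lemma sinh_minus_le (r : R) : 0 <= r -> sinh r - r <= r ^ 3 * exp r.
Proof.
intros Hr.
enough (0 <= r * (r * r * exp r) - (sinh r - r)) by (simpl; lra).
assert (aux : forall t, 0 <= t <= r -> 0 <= (r * r * exp r) * t - (sinh t - t)).
{ intros t Ht.
  apply (nonneg_of_derive (fun t => (r * r * exp r) * t - (sinh t - t))
    (fun t => r * r * exp r - (cosh t - 1)) r); [rewrite sinh_at_0; lra | | | exact Ht].
  - intros x _.
    auto_derive; [exact I | ring].
  - intros x Hx.
    assert (H := cosh_minus_1_le x (proj1 Hx)).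
    assert (x ^ 2 * exp x <= r ^ 2 * exp r).
    { apply Rmult_le_compat; [apply pow2_ge_0 | apply Rlt_le, exp_pos | | apply exp_le_compat; lra].
      apply pow_incr; lra. }
    simpl in *; lra. }
assert (H := aux r (conj Hr (Rle_refl r))); lra.
Qed.

(** Half of a contour through the saddle point: [s = eps (r + i v r)], [r >= 0].
    The last two conditions say that, of the two terms of the phase
    [S i (cosh s - 1) + mu (sinh s - s)], the first has real part at most
    [- S r^2 / 2] and the second has a nonpositive one. *)
Definition arc (eps : R) (v v' : R -> R) : Prop :=
  (eps = 1 \/ eps = - 1) /\ (forall r, is_derive v r (v' r)) /\ cont v' /\ v 0 = 0 /\
  forall r, 0 <= r -> 0 <= v r <= r /\ v r < PI / 2 /\ 0 <= v' r <= 1 /\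
    r ^ 2 / 2 <= sinh r * sin (v r) /\ eps * (sinh r * cos (v r) - r) <= 0.

Lemma arc_right : arc 1 gd (fun r => / cosh r).
Proof.
split; [now left |]; split; [exact is_derive_gd |]; split; [exact cont_inv_cosh |];
  split; [exact gd_0 |].
intros r Hr.
destruct (gd_bounds r Hr) as [H1 H2].
assert (Hc := cosh_pos r). assert (Hc1 := cosh_ge_1 r).
split; [exact H1 |]; split; [exact H2 |]; split; [apply inv_cosh_bounds |]; split.
- rewrite sin_gd; unfold tanh.
  assert (H := cosh_ge r Hr). assert (E := cosh_sqr r).
  apply (Rmult_le_reg_r (cosh r)); [exact Hc |].
  replace (sinh r * (sinh r / cosh r) * cosh r) with (sinh r * sinh r) by (field; lra).
  nra.
- rewrite cos_gd; destruct (tanh_bounds r Hr) as [_ [_ H]].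
  unfold tanh, Rdiv in H; lra.
Qed.

(** To the left, a slope below [1 / sqrt 3] at the saddle is needed for the cubic
    term to decay; the slope is [1 / 2] here, and [sinh r >= r sqrt (1 + r^2 / 4)]
    gives both conditions. *)
Lemma arc_left : arc (- 1) (fun r => atan (r / 2)) (fun r => (1 / 2) / (1 + (r / 2) ^ 2)).
Proof.
assert (Hd : forall r, is_derive (fun r => atan (r / 2)) r ((1 / 2) / (1 + (r / 2) ^ 2))).
{ intros r.
  assert (H0 := pow2_ge_0 (r / 2)).
  apply (is_derive_comp atan (fun r => r / 2) r (/ (1 + (r / 2) ^ 2)) (1 / 2)).
  - apply is_derive_Reals, derivable_pt_lim_atan.
  - auto_derive; [exact I | field]. }
assert (Hv' : forall r, 0 <= (1 / 2) / (1 + (r / 2) ^ 2) <= 1 / 2).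
{ intros r; assert (H0 := pow2_ge_0 (r / 2)); split.
  - apply Rdiv_le_0_compat; lra.
  - apply (Rmult_le_reg_r (1 + (r / 2) ^ 2)); [lra |].
    unfold Rdiv at 1; rewrite Rmult_assoc, Rinv_l by lra; lra. }
assert (H00 : atan (0 / 2) = 0) by (replace (0 / 2) with 0 by field; apply atan_0).
split; [now right |]; split; [exact Hd |]; split.
{ intros r.
  assert (H0 := pow2_ge_0 (r / 2)).
  apply (ex_derive_continuous (fun r => (1 / 2) / (1 + (r / 2) ^ 2)) r).
  auto_derive; simpl in *; lra. }
split; [exact H00 |].
intros r Hr.
assert (HQ : 0 < 1 + (r / 2)²) by (generalize (Rle_0_sqr (r / 2)); lra).
set (Q := sqrt (1 + (r / 2)²)).
assert (HQ0 : 0 < Q) by now apply sqrt_lt_R0.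
assert (HQ2 : Q * Q = 1 + (r / 2) * (r / 2)) by (apply sqrt_sqrt, Rlt_le, HQ).
assert (HQ1 : Q <= 1 + r ^ 2 / 8).
{ assert (0 <= (r ^ 2) ^ 2) by apply pow2_ge_0.
  assert (0 <= r ^ 2) by apply pow2_ge_0.
  apply Rsqr_incr_0; unfold Rsqr; lra. }
assert (Hs := sinh_ge3 r Hr).
assert (Hr3 : 0 <= r ^ 3) by now apply pow_le.
assert (HrQ : r * Q <= sinh r) by nra.
split; [split |].
- apply (nonneg_of_derive (fun r => atan (r / 2)) (fun r => (1 / 2) / (1 + (r / 2) ^ 2)) r);
    [lra | intros; apply Hd | intros; apply Hv' | lra].
- enough (0 <= r - atan (r / 2)) by lra.
  apply (nonneg_of_derive (fun r => r - atan (r / 2))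
    (fun r => 1 - (1 / 2) / (1 + (r / 2) ^ 2)) r); [lra | | | lra].
  + intros t _; apply (is_derive_minus (K := R_AbsRing) (V := R_NormedModule)
      (fun r => r) (fun r => atan (r / 2))); [apply (is_derive_id (K := R_AbsRing)) | apply Hd].
  + intros t _; generalize (Hv' t); lra.
- split; [apply atan_bound |]; split; [generalize (Hv' r); lra |].
  rewrite cos_atan, sin_atan; fold Q; split.
  + apply (Rmult_le_reg_r Q); [exact HQ0 |].
    replace (sinh r * (r / 2 / Q) * Q) with (sinh r * (r / 2)) by (field; lra); nra.
  + enough (r <= sinh r * (1 / Q)) by lra.
    apply (Rmult_le_reg_r Q); [exact HQ0 |].
    replace (sinh r * (1 / Q) * Q) with (sinh r) by (field; lra); exact HrQ.
Qed.

(** [i (cosh s - 1)] and [sinh s - s] at [s = eps (r + i v r)]. *)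
Definition phase1 (v : R -> R) (r : R) : C :=
  (- (sinh r * sin (v r)), cosh r * cos (v r) - 1).
Definition phase2 (eps : R) (v : R -> R) (r : R) : C :=
  (eps * (sinh r * cos (v r) - r), eps * (cosh r * sin (v r) - v r)).
Definition arcamp (eps : R) (v v' : R -> R) (j k : nat) (r : R) : C :=
  ((1, v' r)%R * phase1 v r ^ j * phase2 eps v r ^ k)%C.

Definition ArcInt (eps : R) (v v' : R -> R) (j k : nat) (S mu : R) : C :=
  ExpInt (arcamp eps v v' j k) (phase1 v) (phase2 eps v) S mu.

Lemma Ccont_phase1 (v : R -> R) : cont v -> Ccont (phase1 v).
Proof.
intros Cv; assert (Cs := cont_sinh); assert (Cc := cont_cosh).
apply Ccont_pair; solve_cont.
Qed.

Lemma Ccont_phase2 (eps : R) (v : R -> R) : cont v -> Ccont (phase2 eps v).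
Proof.
intros Cv; assert (Cs := cont_sinh); assert (Cc := cont_cosh).
apply Ccont_pair; solve_cont.
Qed.

Lemma Ccont_arcamp (eps : R) (v v' : R -> R) (j k : nat) : cont v -> cont v' ->
  Ccont (arcamp eps v v' j k).
Proof.
intros Cv Cv'; apply Ccont_mult; [apply Ccont_mult |].
- apply Ccont_pair; [apply cont_const | exact Cv'].
- apply Ccont_pow, Ccont_phase1, Cv.
- apply Ccont_pow, Ccont_phase2, Cv.
Qed.

Lemma phase1_bound (eps : R) (v v' : R -> R) (r : R) : arc eps v v' -> 0 <= r ->
  Cmod (phase1 v r) <= 2 * r ^ 2 * exp r.
Proof.
intros [_ [_ [_ [_ H]]]] Hr; destruct (H r Hr) as [H1 [H2 [_ [H4 _]]]].
assert (Hs := sinh_ge r Hr).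
assert (Hs2 := sinh_le r Hr). assert (Hc := cosh_minus_1_le r Hr).
assert (Hc1 := cosh_ge_1 r).
assert (Hsin := sin_abs_le (v r)); rewrite (Rabs_pos_eq (v r)) in Hsin by lra.
assert (Hcos := one_minus_cos (v r)).
assert (Hcos0 : 0 <= cos (v r)) by (apply cos_ge_0; lra).
assert (He : 1 <= exp r) by (generalize (exp_ineq1_le r); lra).
assert (Hv2 : (v r) ^ 2 <= r ^ 2) by (apply pow_incr; lra).
assert (Hre : 0 <= r ^ 2 * (exp r - 1)) by (apply Rmult_le_pos; [apply pow2_ge_0 | lra]).
eapply Rle_trans; [apply Cmod_le_sum |]; unfold phase1, Re, Im; simpl fst; simpl snd.
replace (2 * r ^ 2 * exp r) with (r ^ 2 * exp r + r ^ 2 * exp r) by ring.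
apply Rplus_le_compat.
- rewrite Rabs_Ropp, Rabs_mult, (Rabs_pos_eq (sinh r)) by lra.
  replace (r ^ 2 * exp r) with ((r * exp r) * r) by ring.
  apply Rmult_le_compat; [lra | apply Rabs_pos | exact Hs2 | lra].
- apply Rabs_le; split; [nra |].
  assert (cos (v r) <= 1) by lra; nra.
Qed.

Lemma phase2_bound (eps : R) (v v' : R -> R) (r : R) : arc eps v v' -> 0 <= r ->
  Cmod (phase2 eps v r) <= 3 * r ^ 3 * exp r.
Proof.
intros [Heps [_ [_ [_ H]]]] Hr; destruct (H r Hr) as [H1 [H2 [_ [H4 _]]]].
assert (Hs := sinh_ge r Hr).
assert (Hs2 := sinh_le r Hr). assert (Hs3 := sinh_minus_le r Hr).
assert (Hc := cosh_minus_1_le r Hr). assert (Hc1 := cosh_ge_1 r).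
assert (Hsin := sin_abs_le (v r)); rewrite (Rabs_pos_eq (v r)) in Hsin by lra.
assert (Hsin3 := abs_sin_minus (v r)); rewrite (Rabs_pos_eq (v r)) in Hsin3 by lra.
assert (Hcos := one_minus_cos (v r)).
assert (He : 1 <= exp r) by (generalize (exp_ineq1_le r); lra).
assert (Hv2 : (v r) ^ 2 <= r ^ 2) by (apply pow_incr; lra).
assert (Hv3 : (v r) ^ 3 <= r ^ 3) by (apply pow_incr; lra).
assert (Hr3 : 0 <= r ^ 3) by now apply pow_le.
assert (Heps1 : Rabs eps = 1) by (destruct Heps as [-> | ->];
  [apply Rabs_R1 | rewrite Rabs_left; lra]).
eapply Rle_trans; [apply Cmod_le_sum |]; unfold phase2, Re, Im; simpl fst; simpl snd.
rewrite !Rabs_mult, Heps1, !Rmult_1_l.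
assert (A1 : Rabs (sinh r * cos (v r) - r) <= 3 / 2 * (r ^ 3 * exp r)).
{ replace (sinh r * cos (v r) - r) with ((sinh r - r) + - (sinh r * (1 - cos (v r)))) by ring.
  eapply Rle_trans; [apply Rabs_triang |]; rewrite Rabs_Ropp.
  rewrite (Rabs_pos_eq (sinh r - r)) by lra.
  rewrite Rabs_pos_eq by (apply Rmult_le_pos; lra).
  assert (sinh r * (1 - cos (v r)) <= (r * exp r) * (r ^ 2 / 2))
    by (apply Rmult_le_compat; lra).
  replace ((r * exp r) * (r ^ 2 / 2)) with (1 / 2 * (r ^ 3 * exp r)) in H0 by field; lra. }
assert (A2 : Rabs (cosh r * sin (v r) - v r) <= 3 / 2 * (r ^ 3 * exp r)).
{ replace (cosh r * sin (v r) - v r) with ((cosh r - 1) * sin (v r) + (sin (v r) - v r)) by ring.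
  eapply Rle_trans; [apply Rabs_triang |].
  rewrite Rabs_mult, (Rabs_pos_eq (cosh r - 1)) by lra.
  assert ((cosh r - 1) * Rabs (sin (v r)) <= (r ^ 2 * exp r) * r)
    by (apply Rmult_le_compat; [lra | apply Rabs_pos | exact Hc | lra]).
  replace (r ^ 2 * exp r * r) with (r ^ 3 * exp r) in H0 by ring.
  assert (r ^ 3 * 1 <= r ^ 3 * exp r) by (apply Rmult_le_compat_l; lra).
  lra. }
lra.
Qed.

Lemma arc_height (eps : R) (v v' : R -> R) (S mu r : R) : arc eps v v' -> 0 <= r ->
  0 <= S -> 0 <= mu -> Re (expo (phase1 v) (phase2 eps v) S mu r) <= - (S * r ^ 2 / 2).
Proof.
intros [_ [_ [_ [_ H]]]] Hr HS Hmu; destruct (H r Hr) as [_ [_ [_ [H4 H5]]]].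
unfold expo, phase1, phase2, Re; simpl fst.
rewrite !Rmult_0_l, !Rminus_0_r.
assert (S * (r ^ 2 / 2) <= S * (sinh r * sin (v r))) by now apply Rmult_le_compat_l.
assert (0 <= mu * (- (eps * (sinh r * cos (v r) - r)))) by (apply Rmult_le_pos; lra).
lra.
Qed.

(** After rescaling [t = sqrt S * r], the Gaussian factor absorbs the growth of
    the amplitude, and each [phase1] counts for [1/S], each [phase2] for [S^(-3/2)]. *)
Lemma arcamp_bound (eps : R) (v v' : R -> R) (j k : nat) : arc eps v v' ->
  exists M, 0 < M /\ forall s mu r, 1 <= s -> 0 <= mu -> 0 <= r ->
    Cmod (arcamp eps v v' j k r) * exp (Re (expo (phase1 v) (phase2 eps v) (s ^ 2) mu r))
    <= M / s ^ (2 * j + 3 * k) * exp (- s * r).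
Proof.
intros Harc.
set (N := (2 * j + 3 * k)%nat).
set (m := INR (j + k) + 1).
exists (2 * (2 ^ j * 3 ^ k) * INR (fact N) * exp ((m + 1) ^ 2 / 2)).
assert (H2j : 0 < 2 ^ j) by (apply pow_lt; lra).
assert (H3k : 0 < 3 ^ k) by (apply pow_lt; lra).
assert (H23 : 0 < 2 ^ j * 3 ^ k) by now apply Rmult_lt_0_compat.
assert (HF : 0 < INR (fact N)) by apply INR_fact_lt_0.
assert (HF2 : 0 < 2 * (2 ^ j * 3 ^ k) * INR (fact N))
  by (apply Rmult_lt_0_compat; [lra | exact HF]).
split; [apply Rmult_lt_0_compat; [exact HF2 | apply exp_pos] |].
intros s mu r Hs Hmu Hr.
assert (Hh := arc_height eps v v' (s ^ 2) mu r Harc Hr ltac:(apply pow2_ge_0) Hmu).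
assert (B1 := phase1_bound eps v v' r Harc Hr). assert (B2 := phase2_bound eps v v' r Harc Hr).
assert (Hv' : 0 <= v' r <= 1) by (destruct Harc as [_ [_ [_ [_ H]]]]; apply (H r Hr)).
set (t := s * r). assert (Ht : 0 <= t) by (apply Rmult_le_pos; lra).
assert (Htr : r <= t) by (unfold t; nra).
assert (HsN : 0 < s ^ N) by (apply pow_lt; lra).
assert (HA : Cmod (arcamp eps v v' j k r)
   <= 2 * (2 ^ j * 3 ^ k) * (t ^ N / s ^ N) * exp (INR (j + k) * t)).
{ unfold arcamp; rewrite !Cmod_mult, !Cmod_pow.
  apply Rle_trans with (2 * (2 * r ^ 2 * exp r) ^ j * (3 * r ^ 3 * exp r) ^ k).
  - apply Rmult_le_compat; [apply Rmult_le_pos; [| apply pow_le]; apply Cmod_ge_0 |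
      apply pow_le, Cmod_ge_0 | | apply pow_incr; split; [apply Cmod_ge_0 | exact B2]].
    apply Rmult_le_compat; [apply Cmod_ge_0 | apply pow_le, Cmod_ge_0 |
      now apply Cmod_pair1 | apply pow_incr; split; [apply Cmod_ge_0 | exact B1]].
  - replace (t ^ N / s ^ N) with (r ^ N)
      by (unfold t; rewrite Rpow_mult_distr; field; lra).
    replace (2 * (2 * r ^ 2 * exp r) ^ j * (3 * r ^ 3 * exp r) ^ k)
      with (2 * (2 ^ j * 3 ^ k) * r ^ N * exp (INR (j + k) * r)).
    + assert (0 <= r ^ N) by now apply pow_le.
      apply Rmult_le_compat_l; [apply Rmult_le_pos; lra |].
      apply exp_le_compat, Rmult_le_compat_l; [apply pos_INR | exact Htr].
    + assert (EE : exp (INR (j + k) * r) = exp r ^ j * exp r ^ k).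
      { rewrite <- pow_add, <- Rpower_pow by apply exp_pos.
        unfold Rpower; now rewrite ln_exp. }
      unfold N; rewrite EE, !Rpow_mult_distr, !pow_add, !pow_mult; ring. }
assert (HE : exp (Re (expo (phase1 v) (phase2 eps v) (s ^ 2) mu r)) <= exp (- (t ^ 2 / 2))).
{ apply exp_le_compat; unfold t; rewrite Rpow_mult_distr; lra. }
assert (HtN := pow_le_exp N t Ht).
assert (HtN0 : 0 <= t ^ N) by now apply pow_le.
apply Rle_trans with (2 * (2 ^ j * 3 ^ k) * (INR (fact N) * exp t / s ^ N)
  * exp (INR (j + k) * t) * exp (- (t ^ 2 / 2))).
- apply Rmult_le_compat; [apply Cmod_ge_0 | apply Rlt_le, exp_pos | | exact HE].
  eapply Rle_trans; [exact HA |].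
  apply Rmult_le_compat_r; [apply Rlt_le, exp_pos |].
  apply Rmult_le_compat_l; [lra |].
  apply Rmult_le_compat_r; [apply Rlt_le, Rinv_0_lt_compat; lra | exact HtN].
- replace (2 * (2 ^ j * 3 ^ k) * (INR (fact N) * exp t / s ^ N)
    * exp (INR (j + k) * t) * exp (- (t ^ 2 / 2)))
    with (2 * (2 ^ j * 3 ^ k) * INR (fact N) / s ^ N *
      (exp t * exp (INR (j + k) * t) * exp (- (t ^ 2 / 2)))) by (field; lra).
  replace (2 * (2 ^ j * 3 ^ k) * INR (fact N) * exp ((m + 1) ^ 2 / 2) / s ^ N * exp (- s * r))
    with (2 * (2 ^ j * 3 ^ k) * INR (fact N) / s ^ N * (exp ((m + 1) ^ 2 / 2) * exp (- s * r)))
    by (field; lra).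
  apply Rmult_le_compat_l.
  + apply Rmult_le_pos; [lra | apply Rlt_le, Rinv_0_lt_compat; lra].
  + rewrite <- !exp_plus; apply exp_le_compat.
    assert (H := pow2_ge_0 (m + 1 - t)); unfold m in *; unfold t in *; nra.
Qed.

(** By [(1 + b + c)^2 <= 3 (1 + b^2 + c^2)] the extra square turns into amplitudes
    with two more factors. Uniformity in [S >= 1] is all that differentiation
    needs. *)
Lemma arc_ok (eps : R) (v v' : R -> R) (j k : nat) : arc eps v v' ->
  exists M, forall S mu, 1 <= S -> 0 <= mu ->
    ExpInt_ok (arcamp eps v v' j k) (phase1 v) (phase2 eps v) S mu M 1.
Proof.
intros Harc.
destruct (arcamp_bound eps v v' j k Harc) as [M0 [HM0 B0]].
destruct (arcamp_bound eps v v' (2 + j) k Harc) as [M1 [HM1 B1]].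
destruct (arcamp_bound eps v v' j (2 + k) Harc) as [M2 [HM2 B2]].
exists (3 * (M0 + M1 + M2)); intros S mu HS Hmu r Hr.
assert (Hs : 1 <= sqrt S) by (rewrite <- sqrt_1; now apply sqrt_le_1_alt).
assert (Es : sqrt S ^ 2 = S) by (apply pow2_sqrt; lra).
assert (Crude : forall M n, 0 < M ->
    M / sqrt S ^ n * exp (- sqrt S * r) <= M * exp (- (1) * r)).
{ intros M n HM; assert (Hp : 1 <= sqrt S ^ n) by now apply pow_R1_Rle.
  apply Rmult_le_compat; [apply Rdiv_le_0_compat; lra | apply Rlt_le, exp_pos | |
    apply exp_le_compat; nra].
  apply Rle_div_l; nra. }
specialize (B0 (sqrt S) mu r Hs Hmu Hr); specialize (B1 (sqrt S) mu r Hs Hmu Hr);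
  specialize (B2 (sqrt S) mu r Hs Hmu Hr).
assert (A0 := Rle_trans _ _ _ B0 (Crude M0 _ HM0)).
assert (A1 := Rle_trans _ _ _ B1 (Crude M1 _ HM1)).
assert (A2 := Rle_trans _ _ _ B2 (Crude M2 _ HM2)).
rewrite Es in A0, A1, A2.
assert (E1 : Cmod (arcamp eps v v' (2 + j) k r) = Cmod (arcamp eps v v' j k r) * Cmod (phase1 v r) ^ 2)
  by (rewrite <- Cmod_pow, <- Cmod_mult; f_equal; unfold arcamp; simpl; ring).
assert (E2 : Cmod (arcamp eps v v' j (2 + k) r)
    = Cmod (arcamp eps v v' j k r) * Cmod (phase2 eps v r) ^ 2)
  by (rewrite <- Cmod_pow, <- Cmod_mult; f_equal; unfold arcamp; simpl; ring).
rewrite E1 in A1; rewrite E2 in A2.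
set (a := Cmod (arcamp eps v v' j k r)) in *.
set (b := Cmod (phase1 v r)) in *. set (c := Cmod (phase2 eps v r)) in *.
set (e := exp (Re (expo (phase1 v) (phase2 eps v) S mu r))) in *.
assert (Hae : 0 <= a * e) by (apply Rmult_le_pos; [apply Cmod_ge_0 | apply Rlt_le, exp_pos]).
apply Rle_trans with (3 * (a * e + a * b ^ 2 * e + a * c ^ 2 * e)); [| lra].
replace (a * (1 + b + c) ^ 2 * e) with (a * e * (1 + b + c) ^ 2) by ring.
replace (3 * (a * e + a * b ^ 2 * e + a * c ^ 2 * e)) with (a * e * (3 * (1 + b ^ 2 + c ^ 2)))
  by ring.
apply Rmult_le_compat_l; [exact Hae |].
generalize (pow2_ge_0 (1 - b)) (pow2_ge_0 (1 - c)) (pow2_ge_0 (b - c)); lra.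
Qed.

Lemma arc_cont (eps : R) (v v' : R -> R) : arc eps v v' -> cont v.
Proof. intros [_ [H _]]; now apply cont_derive with v'. Qed.

Lemma ArcInt_bound (eps : R) (v v' : R -> R) (j k : nat) : arc eps v v' ->
  exists M, 0 < M /\ forall s mu, 1 <= s -> 0 <= mu ->
    Cmod (ArcInt eps v v' j k (s ^ 2) mu) <= M / s ^ (1 + 2 * j + 3 * k).
Proof.
intros Harc; destruct (arcamp_bound eps v v' j k Harc) as [M [HM H]].
exists (2 * M); split; [lra |]; intros s mu Hs Hmu.
assert (HsN : 0 < s ^ (2 * j + 3 * k)) by (apply pow_lt; lra).
replace (2 * M / s ^ (1 + 2 * j + 3 * k)) with (2 * (M / s ^ (2 * j + 3 * k) / s)).
- apply CInt_bound; split; [lra | split].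
  + assert (Cv := arc_cont _ _ _ Harc).
    apply Ccont_mult; [apply Ccont_arcamp; [exact Cv | apply Harc] |
      apply Ccont_Cexp, Ccont_expo; [now apply Ccont_phase1 | now apply Ccont_phase2]].
  + intros r Hr; rewrite Cmod_mult, Cmod_Cexp; now apply H.
- replace (1 + 2 * j + 3 * k)%nat with (S (2 * j + 3 * k)) by lia.
  set (n := (2 * j + 3 * k)%nat) in *; simpl pow; field; lra.
Qed.

Lemma ArcInt_taylor (eps : R) (v v' : R -> R) (j k : nat) : arc eps v v' ->
  exists K, forall S mu S' mu', 1 <= S -> 0 <= mu -> 1 <= S' -> 0 <= mu' ->
    Cmod (ArcInt eps v v' j k S' mu' - ArcInt eps v v' j k S mu
      - (RtoC (S' - S) * ArcInt eps v v' (1 + j) k S mu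
         + RtoC (mu' - mu) * ArcInt eps v v' j (1 + k) S mu))%C
    <= K * (Rabs (S' - S) + Rabs (mu' - mu)) ^ 2.
Proof.
intros Harc; destruct (arc_ok eps v v' j k Harc) as [M HM].
assert (Cv := arc_cont _ _ _ Harc).
exists (16 * (M / 1)); intros S mu S' mu' HS Hmu HS' Hmu'.
assert (H := ExpInt_taylor (arcamp eps v v' j k) (phase1 v) (phase2 eps v) S mu (S' - S) (mu' - mu)
  M 1 Rlt_0_1 (Ccont_arcamp _ _ _ _ _ Cv (proj1 (proj2 (proj2 Harc)))) (Ccont_phase1 v Cv)
  (Ccont_phase2 eps v Cv) (HM S mu HS Hmu)).
replace (S + (S' - S)) with S' in H by ring.
replace (mu + (mu' - mu)) with mu' in H by ring.
specialize (H (HM S' mu' HS' Hmu')).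
assert (E1 : ArcInt eps v v' (1 + j) k S mu
  = ExpInt (fun r => arcamp eps v v' j k r * phase1 v r)%C (phase1 v) (phase2 eps v) S mu).
{ apply CInt_ext; intros r; f_equal; unfold arcamp; simpl; ring. }
assert (E2 : ArcInt eps v v' j (1 + k) S mu
  = ExpInt (fun r => arcamp eps v v' j k r * phase2 eps v r)%C (phase1 v) (phase2 eps v) S mu).
{ apply CInt_ext; intros r; f_equal; unfold arcamp; simpl; ring. }
rewrite E1, E2; exact H.
Qed.

(** At the saddle point [w = i beta], [cos beta = mu / y], the exponent
    [y sinh w - mu w] is [i (S - mu beta)], and at [w = i beta + s] it exceeds this
    value by [S i (cosh s - 1) + mu (sinh s - s)]. *)
Lemma arc_phase (y mu eps beta S r : R) (v : R -> R) : (eps = 1 \/ eps = - 1) ->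
  y * cos beta = mu -> y * sin beta = S ->
  Cmult (Cexp (0, S - mu * beta)) (Cexp (expo (phase1 v) (phase2 eps v) S mu r))
  = FC (y / 2) (- (y / 2)) mu (eps * r) (beta + eps * v r).
Proof.
intros Heps Hc Hs.
rewrite FC_Cexp, argRe_Bessel, argIm_Bessel.
change (Cmult (Cexp (0, S - mu * beta)) (Cexp (expo (phase1 v) (phase2 eps v) S mu r)) =
  Cexp (y * sinh (eps * r) * cos (beta + eps * v r) - mu * (eps * r),
        y * cosh (eps * r) * sin (beta + eps * v r) - mu * (beta + eps * v r))).
rewrite <- Cexp_plus; f_equal.
rewrite <- Hc, <- Hs; unfold expo, phase1, phase2; apply injective_projections; simpl;
  destruct Heps as [-> | ->];
  rewrite ?Rmult_1_l, ?(Ropp_mult_distr_l_reverse 1), ?Rmult_1_l, ?sinh_opp, ?cosh_opp,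
    ?cos_plus, ?sin_plus, ?cos_neg, ?sin_neg; ring.
Qed.

Lemma Cmod_Cexp_i (t : R) : Cmod (Cexp (0, t)) = 1.
Proof. rewrite Cmod_Cexp; unfold Re; simpl; apply exp_0. Qed.

Lemma exp_argRe_arc (y mu eps beta S r : R) (v v' : R -> R) : arc eps v v' ->
  y * cos beta = mu -> y * sin beta = S -> 1 <= S -> 0 <= mu -> 0 <= r ->
  exp (argRe (y / 2) (- (y / 2)) mu (eps * r) (beta + eps * v r)) <= exp (1 / 2) * exp (- (1) * r).
Proof.
intros Harc Hc Hs HS Hmu Hr.
assert (E := arc_phase y mu eps beta S r v (proj1 Harc) Hc Hs).
apply (f_equal Cmod) in E.
rewrite Cmod_mult, Cmod_Cexp_i, Rmult_1_l, FC_Cexp, !Cmod_Cexp in E.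
unfold Re at 2 in E; simpl fst in E; rewrite <- E.
rewrite <- exp_plus; apply exp_le_compat.
eapply Rle_trans; [apply (arc_height eps v v'); try assumption; lra |].
assert (H := pow2_ge_0 (r - 1)). assert (H2 := pow2_ge_0 r). nra.
Qed.

Lemma arc_limit (y mu eps beta S : R) (v v' : R -> R) : arc eps v v' ->
  y * cos beta = mu -> y * sin beta = S -> 1 <= S -> 0 <= mu ->
  is_lim (fun r => Psi (y / 2) (- (y / 2)) mu (eps * r) (beta + eps * v r)) p_infty
    (Psi (y / 2) (- (y / 2)) mu 0 beta
     + eps * Im (Cexp (0, S - mu * beta)%R * ArcInt eps v v' 0 0 S mu)%C).
Proof.
intros Harc Hc Hs HS Hmu.
assert (Hcopy := Harc).
destruct Hcopy as [Heps [Hd [Cv' [Hv0 _]]]].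
assert (Cv := arc_cont _ _ _ Harc).
set (p := y / 2).
set (G := fun r => ((eps, eps * v' r)%R * FC p (- p)%R mu (eps * r)%R (beta + eps * v r)%R)%C).
set (w := Cexp (0, S - mu * beta)%R).
assert (EG : forall r, (RtoC eps * w * (arcamp eps v v' 0 0 r *
    Cexp (expo (phase1 v) (phase2 eps v) S mu r)))%C = G r).
{ intros r; unfold G, p; rewrite <- (arc_phase y mu eps beta S r v Heps Hc Hs); fold w.
  replace ((eps, eps * v' r)%R) with (RtoC eps * (1, v' r)%R)%C
    by (apply injective_projections; simpl; ring).
  unfold arcamp; simpl; ring. }
destruct (arc_ok eps v v' 0 0 Harc) as [M HM].
assert (S0 := ExpInt_ok_small _ _ _ _ _ _ _ Rlt_0_1 (Ccont_arcamp eps v v' 0 0 Cv Cv')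
  (Ccont_phase1 v Cv) (Ccont_phase2 eps v Cv) (HM S mu HS Hmu)).
assert (S1 := exp_small_scal (RtoC eps * w)%C _ _ _ S0).
assert (SG : exp_small G (Cmod (RtoC eps * w)%C * M) 1).
{ destruct S1 as [H1 [H2 H3]]; split; [exact H1 | split].
  - now apply Ccont_ext with (2 := H2).
  - intros u Hu; rewrite <- EG; now apply H3. }
assert (EI : CInt G = (RtoC eps * w * ArcInt eps v v' 0 0 S mu)%C).
{ unfold ArcInt, ExpInt; rewrite <- (CInt_scal _ _ _ _ S0).
  apply CInt_ext; intros r; symmetry; apply EG. }
assert (Hpath : forall r, is_derive (fun r => beta + eps * v r) r (eps * v' r)).
{ intros r; replace (eps * v' r) with (0 + eps * v' r) by ring.
  apply (is_derive_plus (K := R_AbsRing) (V := R_NormedModule) (fun _ => beta)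
    (fun r => eps * v r)).
  - apply (is_derive_const (K := R_AbsRing) (V := R_NormedModule)).
  - apply (is_derive_scal v), Hd. }
assert (L := CInt_path p (- p) mu (fun r => eps * r) (fun r => beta + eps * v r)
  (fun _ => eps) (fun r => eps * v' r) _ 1
  ltac:(intros; auto_derive; [exact I | ring])
  Hpath
  (cont_const eps) (cont_mult _ _ (cont_const eps) Cv') SG).
cbv beta in L; fold G in L; rewrite EI, Hv0, !Rmult_0_r, Rplus_0_r in L.
replace (Im (RtoC eps * w * ArcInt eps v v' 0 0 S mu)%C)
  with (eps * Im (w * ArcInt eps v v' 0 0 S mu)%C) in L
  by (unfold Im; simpl; ring).
exact L.
Qed.

(** The integrals over the full contour through the saddle point; the case
    [j = k = 0] is the amplitude of a Hankel function. *)
Definition SaddleInt (j k : nat) (S mu : R) : C :=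
  Cplus (ArcInt 1 gd (fun r => / cosh r) j k S mu)
    (ArcInt (- 1) (fun r => atan (r / 2)) (fun r => (1 / 2) / (1 + (r / 2) ^ 2)) j k S mu).

Lemma h1_phase (y mu : R) : 0 < y -> 0 <= mu < y ->
  y * h1 (mu / y) = sqrt (y ^ 2 - mu ^ 2) - mu * acos (mu / y).
Proof.
intros Hy Hmu; unfold h1.
replace (sqrt (y ^ 2 - mu ^ 2)) with (y * sqrt (1 - (mu / y) ^ 2)); [field; lra |].
rewrite <- (sqrt_pow2 y) at 1 by lra.
rewrite <- sqrt_mult_alt by apply pow2_ge_0.
f_equal; field; lra.
Qed.

(** The contour [i beta + s] runs from [- oo], where [Psi] tends to [0], to the line
    [Im w = beta + PI / 2], along which [Psi] has the same limit as on
    [Im w = PI]. *)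
Lemma BesselJ_SaddleInt (y mu : R) : 0 <= mu < y -> 1 <= sqrt (y ^ 2 - mu ^ 2) ->
  PI * BesselJ mu y = Im (Cexp (0, y * h1 (mu / y))%R * SaddleInt 0 0 (sqrt (y ^ 2 - mu ^ 2))%R mu)%C.
Proof.
intros Hmu HS.
assert (Hy : 0 < y) by lra.
rewrite h1_phase by assumption.
set (S := sqrt (y ^ 2 - mu ^ 2)) in *. set (beta := acos (mu / y)).
assert (Hz : 0 <= mu / y < 1).
{ split; [apply Rdiv_le_0_compat; lra |].
  apply (Rmult_lt_reg_r y); [exact Hy |]; unfold Rdiv.
  rewrite Rmult_assoc, Rinv_l by lra; lra. }
assert (Hc1 : cos beta = mu / y) by (apply cos_acos; lra).
assert (Hc : y * cos beta = mu) by (rewrite Hc1; field; lra).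
assert (Hb := acos_bound (mu / y)); fold beta in Hb.
assert (Hb2 : beta <= PI / 2).
{ apply Rnot_lt_le; intros H.
  assert (cos beta < 0) by (apply cos_lt_0; lra); lra. }
assert (Hs : y * sin beta = S).
{ assert (Hs0 : 0 <= sin beta) by (apply sin_ge_0; lra).
  unfold S; symmetry; rewrite <- (sqrt_pow2 (y * sin beta)) by (apply Rmult_le_pos; lra).
  f_equal; generalize (sin2_cos2 beta); unfold Rsqr; intros H.
  replace (y ^ 2) with (y ^ 2 * (sin beta * sin beta + cos beta * cos beta))
    by (rewrite H; ring).
  rewrite <- Hc; ring. }
rewrite BesselJ_Loop by lra.
set (p := y / 2).
assert (Hpi := PI_RGT_0).
assert (L1 := arc_limit y mu 1 beta S _ _ arc_right Hc Hs HS (proj1 Hmu)).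
assert (L2 : is_lim (fun r => Psi p (- p) mu r PI) p_infty (Loop p (- p) mu))
  by (apply Loop_lim; unfold p; lra).
assert (L3 : is_lim (fun r => Psi p (- p) mu (1 * r) (beta + 1 * gd r) - Psi p (- p) mu r PI)
  p_infty 0).
{ apply is_lim_squeeze0 with (g := fun r => PI * exp (1 / 2) * exp (- (1) * r));
    [| apply is_lim_exp_neg; lra].
  intros r Hr.
  destruct (gd_bounds r Hr) as [[H0 _] H1].
  rewrite Rmult_assoc; eapply Rle_trans;
    [| apply Rmult_le_compat_l; [lra |];
       apply (exp_argRe_arc y mu 1 beta S r _ _ arc_right Hc Hs HS (proj1 Hmu) Hr)].
  rewrite !Rmult_1_l; apply Psi_right_end; lra. }
assert (L4 := arc_limit y mu (- 1) beta S _ _ arc_left Hc Hs HS (proj1 Hmu)).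
assert (L5 : is_lim (fun r => Psi p (- p) mu (-1 * r) (beta + -1 * atan (r / 2))) p_infty 0).
{ apply is_lim_squeeze0 with (g := fun r => PI * exp (1 / 2) * exp (- (1) * r));
    [| apply is_lim_exp_neg; lra].
  intros r Hr.
  destruct arc_left as [_ [_ [_ [_ H]]]]; destruct (H r Hr) as [[H0 _] [H1 _]].
  rewrite Rmult_assoc; eapply Rle_trans;
    [| apply Rmult_le_compat_l; [lra |];
       apply (exp_argRe_arc y mu (- 1) beta S r _ _ arc_left Hc Hs HS (proj1 Hmu) Hr)].
  replace (-1 * r) with (- r) by ring.
  apply Psi_left_end; [lra | exact Hr |].
  apply Rabs_le; lra. }
fold p in L1, L4.
assert (L6 := is_lim_minus' _ _ _ _ _ L1 L2).
apply is_lim_unique in L3; apply is_lim_unique in L6.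
rewrite L3 in L6; apply (f_equal real) in L6; cbn beta iota delta [real] in L6.
apply is_lim_unique in L5; apply is_lim_unique in L4.
rewrite L5 in L4; apply (f_equal real) in L4; cbn beta iota delta [real] in L4.
unfold SaddleInt; rewrite Cmult_plus_distr_l.
set (A := (Cexp (0, S - mu * beta)%R * ArcInt 1 gd (fun r => / cosh r)%R 0 0 S mu)%C) in *.
match type of L4 with 0 = _ + _ * Im ?Z => set (B := Z) in * end.
change (Loop p (- p) mu = Im A + Im B).
lra.
Qed.

Lemma SaddleInt_bound (j k : nat) : exists M, 0 < M /\ forall s mu, 1 <= s -> 0 <= mu ->
  Cmod (RtoC (s ^ (1 + 2 * j + 3 * k))%R * SaddleInt j k (s ^ 2)%R mu)%C <= M.
Proof.
destruct (ArcInt_bound 1 _ _ j k arc_right) as [M1 [H1 B1]].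
destruct (ArcInt_bound (- 1) _ _ j k arc_left) as [M2 [H2 B2]].
exists (M1 + M2); split; [lra |]; intros s mu Hs Hmu.
assert (Hp : 0 < s ^ (1 + 2 * j + 3 * k)) by (apply pow_lt; lra).
rewrite Cmod_mult, Cmod_R, Rabs_pos_eq by lra.
specialize (B1 s mu Hs Hmu); specialize (B2 s mu Hs Hmu).
apply Rle_trans with (s ^ (1 + 2 * j + 3 * k)
  * (M1 / s ^ (1 + 2 * j + 3 * k) + M2 / s ^ (1 + 2 * j + 3 * k))).
- apply Rmult_le_compat_l; [lra |]; unfold SaddleInt.
  eapply Rle_trans; [apply Cmod_triangle | lra].
- right; field; lra.
Qed.

Lemma SaddleInt_taylor (j k : nat) : exists K, forall S mu S' mu',
  1 <= S -> 0 <= mu -> 1 <= S' -> 0 <= mu' ->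
  Cmod (SaddleInt j k S' mu' - SaddleInt j k S mu
      - (RtoC (S' - S) * SaddleInt (1 + j) k S mu + RtoC (mu' - mu) * SaddleInt j (1 + k) S mu))%C
    <= K * (Rabs (S' - S) + Rabs (mu' - mu)) ^ 2.
Proof.
destruct (ArcInt_taylor 1 _ _ j k arc_right) as [K1 B1].
destruct (ArcInt_taylor (- 1) _ _ j k arc_left) as [K2 B2].
exists (K1 + K2); intros S mu S' mu' H1 H2 H3 H4.
specialize (B1 S mu S' mu' H1 H2 H3 H4); specialize (B2 S mu S' mu' H1 H2 H3 H4).
rewrite Rmult_plus_distr_r; eapply Rle_trans; [| apply Rplus_le_compat; [exact B1 | exact B2]].
eapply Rle_trans; [| apply Cmod_triangle].
right; f_equal; unfold SaddleInt; ring.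
Qed.

(** Chain rule along a curve [mu -> (S mu, mu)]. *)
Lemma deriv_on_SaddleInt (j k : nat) (D : R -> Prop) (f : R -> R) (x l : R) :
  (forall t, D t -> 1 <= f t /\ 0 <= t) -> D x -> is_derive f x l ->
  deriv_on D (fun t => SaddleInt j k (f t) t) x
    (RtoC l * SaddleInt (1 + j) k (f x) x + SaddleInt j (1 + k) (f x) x)%C.
Proof.
intros HD Dx Hf.
destruct (SaddleInt_taylor j k) as [K HK].
assert (Hf' := deriv_on_RtoC D f x l Hf).
destruct (deriv_on_lip _ _ _ _ Hf') as [d0 [Hd0 B0]].
set (L := Cmod (RtoC l) + 2).
assert (HL : 0 <= L) by (unfold L; generalize (Cmod_ge_0 (RtoC l)); lra).
set (g := fun t => (SaddleInt j k (f t) t - RtoC (f t - f x) * SaddleInt (1 + j) k (f x) x)%C).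
assert (Dg : deriv_on D g x (SaddleInt j (1 + k) (f x) x)).
{ apply deriv_on_quadratic with (K := Rabs K * L ^ 2) (d := d0); [exact Hd0 |].
  intros t Dt Ht.
  destruct (HD t Dt) as [F1 F2]; destruct (HD x Dx) as [F3 F4].
  specialize (HK (f x) x (f t) t F3 F4 F1 F2).
  specialize (B0 t Dt Ht); rewrite <- RtoC_minus, Cmod_R in B0.
  unfold g.
  replace (SaddleInt j k (f t) t - RtoC (f t - f x) * SaddleInt (1 + j) k (f x) x
     - (SaddleInt j k (f x) x - RtoC (f x - f x) * SaddleInt (1 + j) k (f x) x)
     - RtoC (t - x) * SaddleInt j (1 + k) (f x) x)%C
    with (SaddleInt j k (f t) t - SaddleInt j k (f x) x
      - (RtoC (f t - f x) * SaddleInt (1 + j) k (f x) x + RtoC (t - x) * SaddleInt j (1 + k) (f x) x))%C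
    by (rewrite Rminus_diag; ring).
  eapply Rle_trans; [exact HK |].
  assert (Ha := Rabs_pos (t - x)). assert (Hb := Rabs_pos (f t - f x)).
  assert (Hsum : (Rabs (f t - f x) + Rabs (t - x)) ^ 2 <= (L * Rabs (t - x)) ^ 2)
    by (apply pow_incr; unfold L; lra).
  rewrite Rpow_mult_distr in Hsum; rewrite Rmult_assoc.
  apply Rle_trans with (Rabs K * (Rabs (f t - f x) + Rabs (t - x)) ^ 2).
  - apply Rmult_le_compat_r; [apply pow2_ge_0 | apply Rle_abs].
  - apply Rmult_le_compat_l; [apply Rabs_pos | exact Hsum]. }
apply deriv_on_ext with (f := fun t => (g t + RtoC (f t) * SaddleInt (1 + j) k (f x) x
   + RtoC (- f x) * SaddleInt (1 + j) k (f x) x)%C); [exact Dx | |].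
- intros t _; unfold g; rewrite RtoC_minus, RtoC_opp; ring.
- replace (RtoC l * SaddleInt (1 + j) k (f x) x + SaddleInt j (1 + k) (f x) x)%C
    with (SaddleInt j (1 + k) (f x) x + (RtoC l * SaddleInt (1 + j) k (f x) x + RtoC (f x) * 0) + 0)%C by ring.
  apply (deriv_on_plus D (fun t => g t + RtoC (f t) * SaddleInt (1 + j) k (f x) x)%C
    (fun _ => RtoC (- f x) * SaddleInt (1 + j) k (f x) x)%C); [| apply deriv_on_const].
  apply (deriv_on_plus D g (fun t => RtoC (f t) * SaddleInt (1 + j) k (f x) x)%C); [exact Dg |].
  apply (deriv_on_mult D (fun t => RtoC (f t)) (fun _ => SaddleInt (1 + j) k (f x) x)%C);
    [exact Hf' | apply deriv_on_const].
Qed.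

(** * Symbol calculus for the amplitude *)

Definition sigma (y mu : R) : R := sqrt (sqrt (y ^ 2 - mu ^ 2)).

Lemma osc_facts (y mu : R) : 8 <= y -> osc_range y mu ->
  0 <= mu /\ 1 <= y - mu /\ 1 <= sigma y mu /\
  sigma y mu ^ 2 = sqrt (y ^ 2 - mu ^ 2) /\
  sigma y mu ^ 4 = (y - mu) * (y + mu) /\ y - mu <= sigma y mu ^ 3.
Proof.
intros Hy [H0 H1].
destruct (cube_root y Hy) as [HY _].
assert (Hd : 1 <= y - mu) by lra.
assert (HX : 1 <= y ^ 2 - mu ^ 2) by nra.
assert (HS : 1 <= sqrt (y ^ 2 - mu ^ 2))
  by (rewrite <- sqrt_1; now apply sqrt_le_1_alt).
assert (Hs : 1 <= sigma y mu)
  by (unfold sigma; rewrite <- sqrt_1; now apply sqrt_le_1_alt).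
assert (E2 : sigma y mu ^ 2 = sqrt (y ^ 2 - mu ^ 2)) by (apply pow2_sqrt; lra).
assert (E4 : sigma y mu ^ 4 = (y - mu) * (y + mu)).
{ replace (sigma y mu ^ 4) with ((sigma y mu ^ 2) ^ 2) by ring.
  rewrite E2, pow2_sqrt by lra; ring. }
repeat split; try assumption.
assert (HdS : y - mu <= sigma y mu ^ 2).
{ rewrite E2, <- (sqrt_pow2 (y - mu)) by lra; apply sqrt_le_1_alt; nra. }
replace (sigma y mu ^ 3) with (sigma y mu ^ 2 * sigma y mu) by ring; nra.
Qed.

Lemma is_derive_sigma (y mu : R) : 8 <= y -> osc_range y mu ->
  is_derive (sigma y) mu (- mu / (2 * sigma y mu ^ 3)).
Proof.
intros Hy Ho.
destruct (osc_facts y mu Hy Ho) as [H0 [Hd [Hs [E2 [E4 _]]]]].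
assert (HX : 0 < y ^ 2 - mu ^ 2) by nra.
assert (HS : 0 < sqrt (y ^ 2 - mu ^ 2)) by now apply sqrt_lt_R0.
replace (- mu / (2 * sigma y mu ^ 3))
  with ((- (2 * mu)) * / (2 * sigma y mu ^ 2) * / (2 * sigma y mu)) by (field; lra).
rewrite E2; unfold sigma; auto_derive.
- repeat split; assumption.
- replace (y * (y * 1) + - (mu * (mu * 1))) with (y ^ 2 - mu ^ 2) by ring.
  assert (0 < sqrt (sqrt (y ^ 2 - mu ^ 2))) by now apply sqrt_lt_R0.
  field; lra.
Qed.

Lemma is_derive_sigma_pow (y mu : R) (n : nat) : 8 <= y -> osc_range y mu ->
  is_derive (fun t => sigma y t ^ n) mu
    (INR n * (- mu / (2 * sigma y mu ^ 3)) * sigma y mu ^ Nat.pred n).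
Proof.
intros Hy Ho; apply (is_derive_pow (sigma y) n mu); now apply is_derive_sigma.
Qed.

(** Formal expressions in functions of [(y, mu)] that are bounded in the
    oscillatory region and stable under [(y - mu) d/dmu]:
    [mu / (y + mu)], [(y - mu) / S^(3/2)], [(y / (y + mu))^(1/4)] and the
    normalised integrals [S^(1/2 + j + 3k/2) SaddleInt j k], where [S = sigma^2]. *)
Inductive sym : Set :=
| Scst (c : C)
| Sm | Sr | Sq
| St (j k : nat)
| Sadd (a b : sym)
| Smul (a b : sym).

Fixpoint ev (y mu : R) (e : sym) : C :=
  match e with
  | Scst c => c
  | Sm => RtoC (mu / (y + mu))
  | Sr => RtoC ((y - mu) / sigma y mu ^ 3)
  | Sq => RtoC (Rpower (y / (y + mu)) (1 / 4))
  | St j k => Cmult (RtoC (sigma y mu ^ (1 + 2 * j + 3 * k))) (SaddleInt j k (sigma y mu ^ 2) mu)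
  | Sadd a b => Cplus (ev y mu a) (ev y mu b)
  | Smul a b => Cmult (ev y mu a) (ev y mu b)
  end.

Definition Slin (a b : R) : sym := Sadd (Scst (RtoC a)) (Smul (Scst (RtoC b)) Sm).

(** The derivation [(y - mu) d/dmu]. *)
Fixpoint Dsym (e : sym) : sym :=
  match e with
  | Scst _ => Scst (RtoC 0)
  | Sm => Smul (Slin 1 (- 2)) (Slin 1 (- 1))
  | Sr => Smul (Slin (- 1) (3 / 2)) Sr
  | Sq => Smul (Slin (- (1 / 4)) (1 / 2)) Sq
  | St j k =>
      Sadd (Smul (Slin 0 (- INR (1 + 2 * j + 3 * k) / 2)) (St j k))
        (Sadd (Smul (Slin 0 (- 1)) (St (1 + j) k)) (Smul Sr (St j (1 + k))))
  | Sadd a b => Sadd (Dsym a) (Dsym b)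
  | Smul a b => Sadd (Smul (Dsym a) b) (Smul a (Dsym b))
  end.

(** Each generator is bounded uniformly in [(y, mu)]: for [Sr] because
    [y - mu <= S <= sigma^3], for [St] by the size of the saddle point integrals. *)
Lemma ev_bounded (e : sym) : exists M, 0 < M /\ forall y mu, 8 <= y -> osc_range y mu ->
  Cmod (ev y mu e) <= M.
Proof.
induction e as [c | | | | j k | a [Ma [HMa Ba]] b [Mb [HMb Bb]]
  | a [Ma [HMa Ba]] b [Mb [HMb Bb]]]; simpl ev.
- exists (Cmod c + 1); split; [generalize (Cmod_ge_0 c); lra | intros; lra].
- exists 1; split; [lra |]; intros y mu Hy Ho.
  destruct (osc_facts y mu Hy Ho) as [H0 _].
  rewrite Cmod_R, Rabs_pos_eq by (apply Rdiv_le_0_compat; lra).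
  apply (Rmult_le_reg_r (y + mu)); [lra |]; unfold Rdiv.
  rewrite Rmult_assoc, Rinv_l by lra; lra.
- exists 1; split; [lra |]; intros y mu Hy Ho.
  destruct (osc_facts y mu Hy Ho) as [H0 [Hd [_ [_ [_ H3]]]]].
  rewrite Cmod_R, Rabs_pos_eq by (apply Rdiv_le_0_compat; lra).
  apply (Rmult_le_reg_r (sigma y mu ^ 3)); [lra |]; unfold Rdiv.
  rewrite Rmult_assoc, Rinv_l by lra; lra.
- exists 1; split; [lra |]; intros y mu Hy Ho.
  destruct (osc_facts y mu Hy Ho) as [H0 _].
  rewrite Cmod_R, Rabs_pos_eq by apply Rlt_le, exp_pos.
  assert (E1 : Rpower 1 (1 / 4) = 1) by (unfold Rpower; rewrite ln_1, Rmult_0_r; apply exp_0).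
  rewrite <- E1 at 2; apply Rle_Rpower_l; [lra |].
  split; [apply Rdiv_lt_0_compat; lra |].
  apply (Rmult_le_reg_r (y + mu)); [lra |]; unfold Rdiv.
  rewrite Rmult_assoc, Rinv_l by lra; lra.
- destruct (SaddleInt_bound j k) as [M [HM B]]; exists M; split; [exact HM |].
  intros y mu Hy Ho; destruct (osc_facts y mu Hy Ho) as [H0 [_ [Hs _]]].
  now apply B.
- exists (Ma + Mb); split; [lra |]; intros y mu Hy Ho.
  eapply Rle_trans; [apply Cmod_triangle |].
  specialize (Ba y mu Hy Ho); specialize (Bb y mu Hy Ho); lra.
- exists (Ma * Mb); split; [now apply Rmult_lt_0_compat |]; intros y mu Hy Ho.
  rewrite Cmod_mult; apply Rmult_le_compat; try apply Cmod_ge_0; auto.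
Qed.

Lemma deriv_on_eq (D : R -> Prop) (f : R -> C) (x : R) (l l' : C) :
  l = l' -> deriv_on D f x l -> deriv_on D f x l'.
Proof. now intros ->. Qed.

Lemma deriv_on_ev (y mu : R) (e : sym) : 8 <= y -> osc_range y mu ->
  deriv_on (osc_range y) (fun t => ev y t e) mu (RtoC (/ (y - mu)) * ev y mu (Dsym e))%C.
Proof.
intros Hy Ho.
destruct (osc_facts y mu Hy Ho) as [H0 [Hd [Hs [E2 [E4 _]]]]].
assert (HE : / (y - mu) * (mu / (y + mu)) = mu / sigma y mu ^ 4)
  by (rewrite E4; field; lra).
induction e as [c | | | | j k | a IHa b IHb | a IHa b IHb].
- apply deriv_on_eq with (RtoC 0); [simpl; ring | exact (deriv_on_const (osc_range y) c mu)].
- apply deriv_on_eq with (RtoC (y / (y + mu) ^ 2)).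
  + simpl ev; rewrite <- !RtoC_mult, <- !RtoC_plus, <- !RtoC_mult; f_equal; field; lra.
  + apply (deriv_on_RtoC _ (fun t => t / (y + t))); auto_derive; [lra | field; lra].
- set (s := sigma y mu) in *.
  apply deriv_on_eq with
    (RtoC ((-1 * s ^ 3 - (y - mu) * (INR 3 * (- mu / (2 * s ^ 3)) * s ^ 2)) / (s ^ 3) ^ 2)).
  + simpl ev; rewrite <- !RtoC_mult, <- !RtoC_plus, <- !RtoC_mult; f_equal; fold s.
    change (s * (s * (s * 1))) with (s ^ 3).
    replace (/ (y - mu) * ((-1 + 3 / 2 * (mu / (y + mu))) * ((y - mu) / s ^ 3)))
      with ((/ (y - mu) * (-1) + 3 / 2 * (/ (y - mu) * (mu / (y + mu)))) * ((y - mu) / s ^ 3))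
      by (field; lra).
    rewrite HE; simpl INR; field; lra.
  + apply (deriv_on_RtoC _ (fun t => (y - t) / sigma y t ^ 3)).
    apply (is_derive_div (fun t => y - t) (fun t => sigma y t ^ 3) mu (-1)
      (INR 3 * (- mu / (2 * s ^ 3)) * s ^ 2)).
    * auto_derive; [exact I | ring].
    * now apply (is_derive_sigma_pow y mu 3).
    * apply pow_nonzero; fold s; lra.
- apply deriv_on_eq with
    (RtoC (1 / 4 * ((- y / (y + mu) ^ 2) / (y / (y + mu))) * Rpower (y / (y + mu)) (1 / 4))).
  + simpl ev; rewrite <- !RtoC_mult, <- !RtoC_plus, <- !RtoC_mult; f_equal.
    generalize (Rpower (y / (y + mu)) (1 / 4)); intros q; field; lra.
  + apply (deriv_on_RtoC _ (fun t => Rpower (y / (y + t)) (1 / 4))).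
    assert (Hq : 0 < y / (y + mu)) by (apply Rdiv_lt_0_compat; lra).
    unfold Rpower; auto_derive; [split; [lra | split; [exact Hq | exact I]] |].
    change (y * / (y + mu)) with (y / (y + mu)); generalize (exp (1 / 4 * ln (y / (y + mu)))).
    intros q; field; lra.
- set (s := sigma y mu) in *.
  set (N := (2 * j + 3 * k)%nat).
  assert (EN : (1 + 2 * j + 3 * k)%nat = S N) by (unfold N; lia).
  assert (D2 : is_derive (fun t => sigma y t ^ 2) mu (- mu / s ^ 2)).
  { replace (- mu / s ^ 2) with (INR 2 * (- mu / (2 * s ^ 3)) * s ^ Nat.pred 2)
      by (simpl; field; lra).
    now apply (is_derive_sigma_pow y mu 2). }
  assert (DT := deriv_on_SaddleInt j k (osc_range y) (fun t => sigma y t ^ 2) mu _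
    ltac:(intros t Ht; destruct (osc_facts y t Hy Ht) as [F0 [_ [Fs _]]];
          split; [apply pow_R1_Rle; exact Fs | exact F0]) Ho D2).
  assert (DS := deriv_on_RtoC (osc_range y) _ _ _ (is_derive_sigma_pow y mu (S N) Hy Ho)).
  assert (DM := deriv_on_mult _ _ _ _ _ _ DS DT); cbv beta in DM; fold s in DM.
  apply deriv_on_ext with (f := fun t => (RtoC (sigma y t ^ S N) * SaddleInt j k (sigma y t ^ 2)%R t)%C);
    [exact Ho | intros t _; cbn [ev]; rewrite EN; reflexivity |].
  eapply deriv_on_eq; [| exact DM].
  assert (EN1 : (1 + 2 * (1 + j) + 3 * k)%nat = S (S (S N))) by (unfold N; lia).
  assert (EN2 : (1 + 2 * j + 3 * (1 + k))%nat = S (S (S (S N)))) by (unfold N; lia).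
  cbn [Dsym]; unfold Slin; cbn [ev]; rewrite EN, EN1, EN2; fold s.
  set (t0 := SaddleInt j k (s ^ 2) mu); set (t1 := SaddleInt (1 + j) k (s ^ 2) mu);
    set (t2 := SaddleInt j (1 + k) (s ^ 2) mu).
  set (d := / (y - mu)) in *. set (m := mu / (y + mu)) in *.
  assert (HR : d * ((y - mu) / s ^ 3) = / s ^ 3) by (unfold d; field; lra).
  transitivity (RtoC (- INR (S N) / 2 * (d * m) * s ^ S N) * t0
    + (RtoC (- (d * m) * s ^ S (S (S N))) * t1
    + RtoC (d * ((y - mu) / s ^ 3) * s ^ S (S (S (S N)))) * t2))%C.
  + rewrite HE, HR.
    rewrite Cmult_plus_distr_l, Cmult_assoc, <- RtoC_mult.
    simpl Nat.pred.
    f_equal; [f_equal | f_equal; f_equal]; f_equal; simpl pow; field; lra.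
  + rewrite !RtoC_mult, !RtoC_opp, !RtoC_mult; ring.
- eapply deriv_on_eq; [| exact (deriv_on_plus _ _ _ _ _ _ IHa IHb)]; simpl ev; ring.
- eapply deriv_on_eq; [| exact (deriv_on_mult _ _ _ _ _ _ IHa IHb)]; cbn [Dsym ev]; ring.
Qed.

(** * The amplitudes *)

(** Twice the real part of [- i z / (2 PI)] is [Im z / PI]: this is where the two
    conjugate exponentials come from. *)
Definition amp0 : sym := Smul (Scst (0, - / (2 * PI))) (Smul Sq (St 0 0)).

(** The recursion is [d/dmu (f / (y - mu)^n) = (Df + n f) / (y - mu)^(n + 1)]
    with [D = (y - mu) d/dmu], so that [ampn n / (y - mu)^n] is the [n]-th
    derivative of [amp0]. *)
Fixpoint ampn (n : nat) : sym :=
  match n with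
  | O => amp0
  | S n => Sadd (Dsym (ampn n)) (Smul (Scst (RtoC (INR n))) (ampn n))
  end.

Definition dampl (y : R) (n : nat) (mu : R) : C :=
  Cmult (RtoC (/ (y - mu) ^ n)) (ev y mu (ampn n)).

Lemma deriv_on_dampl (y mu : R) (n : nat) : 8 <= y -> osc_range y mu ->
  deriv_on (osc_range y) (dampl y n) mu (dampl y (S n) mu).
Proof.
intros Hy Ho.
destruct (osc_facts y mu Hy Ho) as [H0 [Hd _]].
assert (Hp : 0 < (y - mu) ^ n) by (apply pow_lt; lra).
assert (D1 : is_derive (fun t => / (y - t) ^ n) mu (INR n / (y - mu) ^ S n)).
{ auto_derive; [apply pow_nonzero; lra |].
  destruct n as [| n]; [simpl; field; lra |].
  simpl Nat.pred; rewrite <- tech_pow_Rmult in *.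
  assert (Hp' : 0 < (y - mu) ^ n) by (apply pow_lt; lra).
  rewrite <- !tech_pow_Rmult; unfold Rminus in *; field; lra. }
assert (DM := deriv_on_mult _ _ _ _ _ _ (deriv_on_RtoC (osc_range y) _ _ _ D1)
  (deriv_on_ev y mu (ampn n) Hy Ho)).
eapply deriv_on_eq; [| exact DM].
unfold dampl; cbn [ampn ev].
replace (INR n / (y - mu) ^ S n) with (/ (y - mu) ^ S n * INR n) by (unfold Rdiv; ring).
replace (/ (y - mu) ^ S n) with (/ (y - mu) ^ n * / (y - mu))
  by (rewrite <- tech_pow_Rmult; field; lra).
rewrite !RtoC_mult; ring.
Qed.

Lemma osc_range_perfect (y x : R) : 8 <= y -> osc_range y x -> forall d, 0 < d ->
  exists t, osc_range y t /\ 0 < Rabs (t - x) < d.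
Proof.
intros Hy [H0 H1] d Hd.
destruct (cube_root y Hy) as [HY E]; unfold osc_range in *.
set (Y := Rpower y (1 / 3)) in *.
assert (Hb : 0 < y - 1 / 2 * Y) by (rewrite <- E; assert (4 <= Y ^ 2) by nra; nra).
destruct (Rlt_le_dec x (y - 1 / 2 * Y)) as [H | H].
- set (h := Rmin (d / 2) (y - 1 / 2 * Y - x)).
  assert (Hh : 0 < h) by (apply Rmin_pos; lra).
  assert (h <= d / 2) by apply Rmin_l. assert (h <= y - 1 / 2 * Y - x) by apply Rmin_r.
  exists (x + h); split; [lra |].
  replace (x + h - x) with h by ring; rewrite Rabs_pos_eq; lra.
- set (h := Rmin (d / 2) x).
  assert (Hh : 0 < h) by (apply Rmin_pos; lra).
  assert (h <= d / 2) by apply Rmin_l. assert (h <= x) by apply Rmin_r.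
  exists (x - h); split; [lra |].
  replace (x - h - x) with (- h) by ring; rewrite Rabs_Ropp, Rabs_pos_eq; lra.
Qed.

Definition ampl_plus (y mu : R) : C := ev y mu amp0.
Definition ampl_minus (y mu : R) : C := Cconj (ampl_plus y mu).

Lemma ampl_plus_derive (y : R) (n : nat) (x : R) : 8 <= y -> osc_range y x ->
  Derive_n_on (osc_range y) (ampl_plus y) n x = dampl y n x /\
  is_derive_on (osc_range y) (Derive_n_on (osc_range y) (ampl_plus y) n) x (dampl y (S n) x).
Proof.
intros Hy; revert n x; apply (Derive_n_on_eq (osc_range y) (ampl_plus y) (dampl y)).
- intros x Hx; now apply osc_range_perfect.
- intros x _; unfold dampl, ampl_plus; simpl; rewrite Rinv_1; ring.
- intros n x Hx; now apply deriv_on_dampl.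
Qed.

Lemma ampl_minus_derive (y : R) (n : nat) (x : R) : 8 <= y -> osc_range y x ->
  Derive_n_on (osc_range y) (ampl_minus y) n x = Cconj (dampl y n x) /\
  is_derive_on (osc_range y) (Derive_n_on (osc_range y) (ampl_minus y) n) x
    (Cconj (dampl y (S n) x)).
Proof.
intros Hy; revert n x.
apply (Derive_n_on_eq (osc_range y) (ampl_minus y) (fun n t => Cconj (dampl y n t))).
- intros x Hx; now apply osc_range_perfect.
- intros x _; unfold dampl, ampl_minus, ampl_plus; f_equal; simpl; rewrite Rinv_1; ring.
- intros n x Hx; now apply deriv_on_Cconj, deriv_on_dampl.
Qed.

(** [y^(1/4) (y - mu)^(1/4)] is [(y / (y + mu))^(1/4) S^(1/2)]. *)
Lemma prefactor (y mu : R) : 8 <= y -> osc_range y mu ->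
  Rpower y (- (1 / 4)) * Rpower (y - mu) (- (1 / 4))
  * (Rpower (y / (y + mu)) (1 / 4) * sigma y mu) = 1.
Proof.
intros Hy Ho.
destruct (osc_facts y mu Hy Ho) as [H0 [Hd [Hs [E2 [E4 _]]]]].
assert (Es : sigma y mu = Rpower ((y - mu) * (y + mu)) (1 / 4)).
{ rewrite <- E4, <- (Rpower_pow 4), Rpower_mult by lra.
  replace (INR 4 * (1 / 4)) with 1 by (simpl; field).
  symmetry; apply Rpower_1; lra. }
rewrite Es, !Rpower_mult_distr by
  (repeat first [apply Rdiv_lt_0_compat | apply Rmult_lt_0_compat]; lra).
replace (y / (y + mu) * ((y - mu) * (y + mu))) with (y * (y - mu)) by (field; lra).
rewrite <- Rpower_plus.
replace (- (1 / 4) + 1 / 4) with 0 by ring.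
apply Rpower_O, Rmult_lt_0_compat; lra.
Qed.

Lemma BesselJ_oscillatory (y mu : R) : 8 <= y -> osc_range y mu ->
  RtoC (BesselJ mu y)
  = (RtoC (Rpower y (- (1 / 4)) * Rpower (y - mu) (- (1 / 4)))
     * (ampl_plus y mu * Cexp (Ci * RtoC (y * h1 (mu / y)))
        + ampl_minus y mu * Cexp (- (Ci * RtoC (y * h1 (mu / y))))))%C.
Proof.
intros Hy Ho.
assert (Hp := prefactor y mu Hy Ho).
destruct (osc_facts y mu Hy Ho) as [H0 [Hd [Hs [E2 _]]]].
assert (Hpi := PI_RGT_0).
assert (HJ := BesselJ_SaddleInt y mu ltac:(lra) ltac:(rewrite <- E2; apply pow_R1_Rle; lra)).
rewrite <- E2 in HJ.
set (t := y * h1 (mu / y)) in *.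
replace (Ci * RtoC t)%C with ((0, t) : C) by (apply injective_projections; simpl; ring).
replace (- (0, t))%C with (Cconj (0, t)) by (apply injective_projections; simpl; ring).
rewrite Cexp_conj.
unfold ampl_minus, ampl_plus, amp0; simpl ev.
set (E := Cexp (0, t)) in *.
set (Z := SaddleInt 0 0 (sigma y mu * (sigma y mu * 1)) mu).
change (SaddleInt 0 0 (sigma y mu ^ 2) mu) with Z in HJ.
set (q := Rpower (y / (y + mu)) (1 / 4)) in *. set (s := sigma y mu) in *.
set (f := Rpower y (- (1 / 4)) * Rpower (y - mu) (- (1 / 4))) in *.
assert (EJ : BesselJ mu y = / PI * Im (E * Z)%C) by (rewrite <- HJ; field; lra).
rewrite EJ.
replace (/ PI * Im (E * Z)%C) with (f * (q * s) * (/ PI * Im (E * Z)%C))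
  by (rewrite Hp; apply Rmult_1_l).
clear EJ HJ Hp.
destruct E as [e1 e2]; destruct Z as [z1 z2].
apply injective_projections; unfold Im; simpl; field; lra.
Qed.

Theorem proposition3p1 :
  (exists a_plus a_minus : R -> R -> C,
     (forall y : R, 8 <= y ->
        smooth_on (osc_range y) (a_plus y) /\
        smooth_on (osc_range y) (a_minus y) /\
        (forall mu : R, osc_range y mu ->
           RtoC (BesselJ mu y)
           = (RtoC (Rpower y (- (1 / 4)) * Rpower (y - mu) (- (1 / 4)))
              * (a_plus y mu * Cexp (Ci * RtoC (y * h1 (mu / y)))
                 + a_minus y mu * Cexp (- (Ci * RtoC (y * h1 (mu / y))))))%C)) /\
     (forall alpha : nat, exists C_alpha : R, 0 < C_alpha /\
        forall y mu : R, 8 <= y -> osc_range y mu ->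
          Cmod (Derive_n_on (osc_range y) (a_plus y) alpha mu)
            <= C_alpha * Rpower (y - mu) (- INR alpha) /\
          Cmod (Derive_n_on (osc_range y) (a_minus y) alpha mu)
            <= C_alpha * Rpower (y - mu) (- INR alpha)))
  /\
  (forall alpha : nat,
     (exists C_alpha : R, 0 < C_alpha /\
        forall y mu : R, 8 <= y ->
          y - 2 * Rpower y (1 / 3) <= mu <= y + 2 * Rpower y (1 / 3) ->
          ex_derive_n (fun nu : R => BesselJ nu y) alpha mu /\
          Rabs (Derive_n (fun nu : R => BesselJ nu y) alpha mu)
            <= C_alpha * Rpower y (- ((1 + INR alpha) / 3))) /\
     (forall N : R, 0 < N ->
        exists C_alphaN : R, 0 < C_alphaN /\
          forall y mu : R, 8 <= y ->
            y + 1 / 2 * Rpower y (1 / 3) <= mu ->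
            ex_derive_n (fun nu : R => BesselJ nu y) alpha mu /\
            Rabs (Derive_n (fun nu : R => BesselJ nu y) alpha mu)
              <= C_alphaN * Rpower mu (- (1 / 4))
                 * Rpower (mu - y) (- (1 / 4) - INR alpha)
                 * Rpower (/ y * (mu - y) ^ 3) (- N))).
Proof.
split.
- exists ampl_plus, ampl_minus; split.
  + intros y Hy; split; [| split].
    * intros n x Hx; exists (dampl y (S n) x); now apply ampl_plus_derive.
    * intros n x Hx; exists (Cconj (dampl y (S n) x)); now apply ampl_minus_derive.
    * intros mu Hmu; now apply BesselJ_oscillatory.
  + intros n; destruct (ev_bounded (ampn n)) as [M [HM B]].
    exists M; split; [exact HM |]; intros y mu Hy Ho.
    rewrite (proj1 (ampl_plus_derive y n mu Hy Ho)),
      (proj1 (ampl_minus_derive y n mu Hy Ho)), Cmod_conj.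
    destruct (osc_facts y mu Hy Ho) as [_ [Hd _]].
    enough (H : Cmod (dampl y n mu) <= M * Rpower (y - mu) (- INR n)) by now split.
    unfold dampl; rewrite Cmod_mult, Cmod_R.
    rewrite Rpower_Ropp, Rpower_pow by lra.
    assert (0 < / (y - mu) ^ n) by (apply Rinv_0_lt_compat, pow_lt; lra).
    rewrite Rabs_pos_eq, Rmult_comm by lra.
    apply Rmult_le_compat_r; [lra | now apply B].
- intros n; split; [apply transition_bound |].
  intros N HN; now apply monotonic_region.
Qed.
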